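(* Let $A$ be the local ring of a Cohen--Macaulay singularity of dimension $N$ and minimal multiplicity $d\ge3$, with Noether normalisation $P\to A$ and coordinates $z_1,\dots,z_{d+N-1}$ as in the context. Then for every $n\ge 0$: (1) The natural map $T^n(A/P,\mathfrak m_A)\to T^n(A/P,A)$ is surjective. In particular, every element of the group $T^n(A/P,A)\cong\operatorname{Harr}^{n+1}(A/P,A)$ may be represented by a cocycle $f\colon A^{\otimes(n+1)}\to\mathfrak m_A$ (tensor product over $P$). (2) If $P\to A$ is $\mathbb Z$-graded with $\deg z_i=1$ for every $i$, then $T^n(A/P,A)$ sits in degrees $\ge -n$.
   Context: The ground field is $\mathbb C$. Setting: $A$ is the local ring, with maximal ideal $\mathfrak m_A$, of a Cohen--Macaulay singularity $Y$ of dimension $N$ and multiplicity $d$; minimal multiplicity means $\operatorname{embdim}Y=d+N-1$. Coordinates $(z_1,\dots,z_{d+N-1})$ (minimal generators of $\mathfrak m_A$) are chosen such that projection onto the last $N$ coordinates $(z_d,\dots,z_{d+N-1})$ is a Noether normalisation, i.e. a flat map $Y\to\mathbb C^N$ of degree $d$ (possibly after passing to an étale covering, or working in the analytic category). $P=\mathbb C[z_d,\dots,z_{d+N-1}]_{(z_d,\dots,z_{d+N-1})}$ is the corresponding regular local ring, and $A$ is a free $P$-module with basis $\{1,z_1,\dots,z_{d-1}\}$. In the graded situation of (2), $A$ and $P$ are the corresponding graded rings, and a homogeneous cochain has degree $e$ if it raises degrees by $e$. $T^n(A/S,M):=H^n(\operatorname{Hom}_A(\mathbb L^{A/S}_*,M))$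 is cotangent (André--Quillen) cohomology; since $A$ is flat over $P\supset\mathbb Q$ one has $T^n(A/P,M)\cong\operatorname{Harr}^{n+1}(A/P,M)$. Harrison cohomology: $\operatorname{Harr}^n(A/S,M)$ is the $n$-th cohomology of the subcomplex of the Hochschild cochain complex $C^n(A/S,M)=\operatorname{Hom}_S(A^{\otimes n},M)$ (with the usual Hochschild differential) consisting of those $f$ that vanish on all $\operatorname{sh}(a)$, $a\in A^{\otimes n}$. Here $\operatorname{sh}=\sum_{p=1}^{n-1}\sum_\sigma\operatorname{sgn}(\sigma)\,\sigma\in\mathbb Z[S_n]$, the inner sum running over the $(p,n-p)$-shuffles $\sigma$, i.e. permutations with $\sigma(1)<\dots<\sigma(p)$ and $\sigma(p+1)<\dots<\sigma(n)$, and $S_n$ acts on $A^{\otimes n}$ by permuting the tensor factors, $\sigma(a_1\otimes\cdots\otimes a_n)=a_{\sigma^{-1}(1)}\otimes\cdots\otimes a_{\sigma^{-1}(n)}$. *)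

(* Defs.v *)
From HB Require Import structures.
From mathcomp Require Import all_boot all_order all_algebra all_fingroup.
From mathcomp Require Import finmap.
From mathcomp.multinomials Require Import monalg.
From mathcomp Require Import reals.
From mathcomp.real_closed Require Import complex.

Set Implicit Arguments.
Unset Strict Implicit.
Unset Printing Implicit Defensive.

Import Order.TTheory GRing.Theory Num.Theory.
Local Open Scope ring_scope.

Section Ideals.
Variable A : comNzRingType.

Definition is_ideal (I : A -> Prop) : Prop :=
  [/\ I 0, forall x y, I x -> I y -> I (x + y) & forall a x, I x -> I (a * x)].

Definition is_prime (I : A -> Prop) : Prop :=
  [/\ is_ideal I, ~ I 1 & forall x y, I (x * y) -> I x \/ I y].

Definition sub_ideal (I J : A -> Prop) : Prop := forall x, I x -> J x.

Definition ideal_gen (T : finType) (D : pred T) (e : T -> A) (x : A) : Prop :=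
  exists c : T -> A, x = \sum_(i | D i) c i * e i.

Definition noetherian : Prop :=
  forall I, is_ideal I ->
    exists (k : nat) (e : 'I_k -> A), forall x, I x <-> ideal_gen predT e x.

(* I_0 < I_1 < ... < I_l, strictly increasing, with every term satisfying Q *)
Definition strict_chain (Q : (A -> Prop) -> Prop) (l : nat)
    (I : nat -> A -> Prop) : Prop :=
  (forall i, (i <= l)%N -> Q (I i)) /\
  (forall i, (i < l)%N ->
     sub_ideal (I i) (I i.+1) /\ exists x, I i.+1 x /\ ~ I i x).

Definition max_chain_length (Q : (A -> Prop) -> Prop) (l : nat) : Prop :=
  (exists I, strict_chain Q l I) /\
  (forall k I, strict_chain Q k I -> (k <= l)%N).

Definition krull_dim (n : nat) : Prop := max_chain_length is_prime n.

(* The length of the A-module J / I, for ideals I <= J, is the maximal length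
   of a chain of submodules. *)
Definition module_length (I J : A -> Prop) (l : nat) : Prop :=
  max_chain_length (fun K => [/\ is_ideal K, sub_ideal I K & sub_ideal K J]) l.

Fixpoint ideal_pow (I : A -> Prop) (k : nat) : A -> Prop :=
  if k is k'.+1 then
    fun z => forall J, is_ideal J ->
      (forall x y, I x -> ideal_pow I k' y -> J (x * y)) -> J z
  else fun _ => True.

Definition minimal_generators (T : finType) (e : T -> A) (I : A -> Prop) : Prop :=
  (forall x, I x <-> ideal_gen predT e x) /\
  (forall i, ~ ideal_gen (predC1 i) e (e i)).

End Ideals.

Section LocalRings.
Variable A : comUnitRingType.

Definition nonunit (x : A) : Prop := x \isn't a GRing.unit.

Definition local_ring : Prop :=
  forall x y, nonunit x -> nonunit y -> nonunit (x + y).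

(* dim_k (m / m^2) is the length of m / m^2 *)
Definition embdim (e : nat) : Prop :=
  module_length (ideal_pow nonunit 2) nonunit e.

Definition regular_sequence (n : nat) (r : 'I_n -> A) : Prop :=
  ~ ideal_gen predT r 1 /\
  forall (i : 'I_n) (a : A),
    ideal_gen (fun j : 'I_n => (j < i)%N) r (r i * a) ->
    ideal_gen (fun j : 'I_n => (j < i)%N) r a.

(* depth = Krull dimension; the inequality depth <= dimension always holds *)
Definition cohen_macaulay : Prop :=
  exists n, krull_dim A n /\
    exists r : 'I_n -> A, (forall i, nonunit (r i)) /\ regular_sequence r.

(* The Hilbert-Samuel function k |-> length (A / m^k) of a local ring of
   dimension n is, for k >> 0, a polynomial with leading term (d / n!) k^n. *)
Definition multiplicity (d : nat) : Prop :=
  exists n, krull_dim A n /\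
  exists q : {poly rat},
    [/\ (size q <= n.+1)%N, q`_n = d%:R / (n`!)%:R
      & exists k0, forall k, (k0 <= k)%N -> exists l,
          module_length (ideal_pow nonunit k) (fun _ => True) l /\
          l%:R = q.[k%:R]].

End LocalRings.

Record CM_minimal_multiplicity (A : comUnitRingType) (n d : nat) : Prop := {
  cmm_local : local_ring A;
  cmm_noetherian : noetherian A;
  cmm_dim : krull_dim A n;
  cmm_cm : cohen_macaulay A;
  cmm_mult : multiplicity A d;
  cmm_embdim : embdim A (d + n - 1)
}.

Section MaximalIdeal.
Variables (A : comUnitRingType) (hA : local_ring A).

Definition nonunit_pred of local_ring A : {pred A^o} :=
  fun x : A => x \isn't a GRing.unit.

Lemma nonunit_submod : GRing.submod_closed (nonunit_pred hA).
Proof.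
split=> [|a x y]; first by rewrite unfold_in /= unitr0.
rewrite !unfold_in => hx hy; apply: (hA _ hy).
by move: hx; apply: contra; rewrite unitrM => /andP[].
Qed.

HB.instance Definition _ :=
  GRing.isSubmodClosed.Build A A^o (nonunit_pred hA) nonunit_submod.

Definition max_ideal : Type := {x : A^o | x \in nonunit_pred hA}.

HB.instance Definition _ := SubChoice.on max_ideal.
HB.instance Definition _ := [SubChoice_isSubLmodule of max_ideal by <:].

Definition max_ideal_incl (x : max_ideal) : A^o := val x.

End MaximalIdeal.

(* the polynomial P-algebra on an arbitrary (possibly infinite) set X *)
Notation polyalg P X := {malg P[{cmonom X}]}.

Definition pvar (P : nzRingType) (X : choiceType) (x : X) : polyalg P X :=
  << ucm x >>.

(* phi : C[x_0, ..., x_(n-1)] -> P is the localisation at the origin;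
   the coefficient of the monomial 1 is the value at the origin. *)
Record localisation_at_origin (C : fieldType) (n : nat) (P : comUnitRingType)
    (phi : polyalg C 'I_n -> P) : Prop := {
  lao_unit : forall f, f@_(mone) != 0 -> phi f \is a GRing.unit;
  lao_frac : forall p, exists f g, g@_(mone) != 0 /\ p * phi g = phi f;
  lao_inj : forall f, phi f = 0 -> exists g, g@_(mone) != 0 /\ g * f = 0
}.

Definition module_basis (P : comNzRingType) (A : comAlgType P) (T : finType)
    (b : T -> A) : Prop :=
  forall a, exists! c : {ffun T -> P}, a = \sum_i c i *: b i.

Definition with_one (A : nzRingType) (k : nat) (z : 'I_k -> A)
    (i : option 'I_k) : A := oapp z 1 i.

Definition coordinates (A : Type) (k n : nat) (z : 'I_k -> A) (x : 'I_n -> A)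
    (i : 'I_k + 'I_n) : A :=
  match i with inl j => z j | inr j => x j end.

(* The cotangent complex is L_n = A (x)_(R_n) Omega_(R_n / P) for a simplicial
   resolution R -> A of A by polynomial P-algebras R_n = P[X_n], for instance
   the standard one, R_n = P[R_(n-1)] with R_(-1) = A; up to homotopy
   equivalence it does not depend on R. *)

Record simplicial_resolution (P : comNzRingType) (A : comAlgType P) := {
  gens : nat -> choiceType;
  face : forall n, nat ->
    {lrmorphism polyalg P (gens n.+1) -> polyalg P (gens n)};
  degen : forall n, nat ->
    {lrmorphism polyalg P (gens n) -> polyalg P (gens n.+1)};
  augm : {lrmorphism polyalg P (gens 0) -> A};
  (* only face n i with i <= n.+1 and degen n i with i <= n are meaningful *)
  face_face : forall n i j x, (i < j)%N -> (j <= n.+2)%N ->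
    face n i (face n.+1 j x) = face n j.-1 (face n.+1 i x);
  degen_degen : forall n i j x, (i <= j)%N -> (j <= n)%N ->
    degen n.+1 i (degen n j x) = degen n.+1 j.+1 (degen n i x);
  face_degen_lt : forall n i j x, (i < j)%N -> (j <= n.+1)%N ->
    face n.+1 i (degen n.+1 j x) = degen n j.-1 (face n i x);
  face_degen_id : forall n i j x, (j <= i)%N -> (i <= j.+1)%N -> (j <= n)%N ->
    face n i (degen n j x) = x;
  face_degen_gt : forall n i j x, (j.+1 < i)%N -> (i <= n.+2)%N ->
    face n.+1 i (degen n.+1 j x) = degen n j (face n i.-1 x);
  augm_face : forall x, augm (face 0 0 x) = augm (face 0 1 x);
  (* R -> A is a weak equivalence: exactness of the augmented complex *)
  augm_surj : forall a, exists x, augm x = a;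
  exact0 : forall x, augm x = 0 ->
    exists y, x = \sum_(i < 2) (-1) ^+ i * face 0 i y;
  exactS : forall n x, \sum_(i < n.+2) (-1) ^+ i * face n i x = 0 ->
    exists y, x = \sum_(i < n.+3) (-1) ^+ i * face n.+1 i y
}.

Section CotangentCohomology.
Variables (P : comNzRingType) (A : comAlgType P) (S : simplicial_resolution A).

Notation Rs n := (polyalg P (gens S n)).

(* the structure map R_n -> A; all composites of faces agree *)
Fixpoint to_base (n : nat) : Rs n -> A :=
  if n is n'.+1 return Rs n -> A then fun x => to_base (face S n' 0 x)
  else augm S.

Section Coefficients.
Variable M : lmodType A.

(* Hom_A (L_n, M) = Der_P (R_n, M) *)
Definition T_cochain (n : nat) (D : Rs n -> M) : Prop :=
  [/\ forall x y, D (x + y) = D x + D y,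
      forall (p : P) x, D (p *: x) = p%:A *: D x
    & forall x y, D (x * y) = to_base x *: D y + to_base y *: D x].

Definition T_diff (n : nat) (D : Rs n -> M) : Rs n.+1 -> M :=
  fun x => \sum_(i < n.+2) (-1) ^+ i *: D (face S n i x).

Definition T_cocycle (n : nat) (D : Rs n -> M) : Prop :=
  T_cochain D /\ forall x, T_diff D x = 0.

Definition T_coboundary_of (Q : forall n, (Rs n -> M) -> Prop) (n : nat) :
    (Rs n -> M) -> Prop :=
  if n is n'.+1 return (Rs n -> M) -> Prop then
    fun D => exists E : Rs n' -> M,
      [/\ T_cochain E, Q n' E & forall x, D x = T_diff E x]
  else fun D => forall x, D x = 0.

Definition T_coboundary : forall n, (Rs n -> M) -> Prop :=
  T_coboundary_of (fun _ _ => True).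

End Coefficients.

Definition T_map_surjective (M M' : lmodType A) (u : M -> M') (n : nat) :
    Prop :=
  forall D : Rs n -> M', T_cocycle D ->
    exists E : Rs n -> M, T_cocycle E /\
      T_coboundary (fun x => D x - u (E x)).

End CotangentCohomology.

(* Harrison cohomology; a P-linear map A^(x)n -> M is encoded as a
   P-multilinear map on {ffun 'I_n -> A}. *)

Section Harrison.
Variables (P : comNzRingType) (A : comAlgType P) (M : lmodType A).

Definition upd (n : nat) (a : {ffun 'I_n -> A}) (i : 'I_n) (x : A) :
    {ffun 'I_n -> A} :=
  [ffun k => if k == i then x else a k].

Definition multilinear (n : nat) (f : {ffun 'I_n -> A} -> M) : Prop :=
  forall a i (p : P) x y,
    f (upd a i (p *: x + y)) = p%:A *: f (upd a i x) + f (upd a i y).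

Definition is_shuffle (n p : nat) (s : 'S_n) : bool :=
  [forall i : 'I_n, forall j : 'I_n,
     (i < j)%N && ((j < p)%N || (p <= i)%N) ==> (s i < s j)%N].

(* f (sh (a)) *)
Definition eval_sh (n : nat) (f : {ffun 'I_n -> A} -> M) (a : {ffun 'I_n -> A})
    : M :=
  \sum_(1 <= p < n) \sum_(s : 'S_n | is_shuffle p s)
    (-1) ^+ s *: f [ffun i => a ((s^-1)%g i)].

Definition Harr_cochain (n : nat) (f : {ffun 'I_n -> A} -> M) : Prop :=
  multilinear f /\ forall a, eval_sh f a = 0.

(* (a_0, ..., a_n) |-> (a_0, ..., a_k a_(k+1), ..., a_n); here
   lift ord_max i has value i and lift ord0 i has value i + 1. *)
Definition merge (n : nat) (a : {ffun 'I_n.+1 -> A}) (k : 'I_n) :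
    {ffun 'I_n -> A} :=
  [ffun i : 'I_n =>
     if (i < k)%N then a (lift ord_max i)
     else if i == k then a (lift ord_max i) * a (lift ord0 i)
     else a (lift ord0 i)].

Definition hochschild_diff (n : nat) (f : {ffun 'I_n -> A} -> M) :
    {ffun 'I_n.+1 -> A} -> M :=
  fun a =>
    a ord0 *: f [ffun i => a (lift ord0 i)]
    + \sum_(k < n) (-1) ^+ k.+1 *: f (merge a k)
    + (-1) ^+ n.+1 *: (a ord_max *: f [ffun i => a (lift ord_max i)]).

Definition Harr_cocycle (n : nat) (f : {ffun 'I_n -> A} -> M) : Prop :=
  Harr_cochain f /\ forall a, hochschild_diff f a = 0.

Definition Harr_coboundary (n : nat) : ({ffun 'I_n -> A} -> M) -> Prop :=
  if n is n'.+1 return ({ffun 'I_n -> A} -> M) -> Prop then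
    fun f => exists g : {ffun 'I_n' -> A} -> M,
      Harr_cochain g /\ forall a, f a = hochschild_diff g a
  else fun f => forall a, f a = 0.

End Harrison.

Record Z_grading (A : comNzRingType) (gr : int -> A -> Prop) : Prop := {
  zgr_0 : forall i, gr i 0;
  zgr_B : forall i x y, gr i x -> gr i y -> gr i (x - y);
  zgr_1 : gr 0 1;
  zgr_M : forall i j x y, gr i x -> gr j y -> gr (i + j) (x * y);
  zgr_span : forall x, exists (s : seq int) (c : int -> A),
    (forall i, gr i (c i)) /\ x = \sum_(i <- s) c i;
  zgr_free : forall (s : seq int) (c : int -> A), uniq s ->
    (forall i, gr i (c i)) -> \sum_(i <- s) c i = 0 ->
    forall i, i \in s -> c i = 0
}.

Definition std_homog (C : fieldType) (n : nat) (j : int) (p : polyalg C 'I_n) :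
    Prop :=
  forall m, m \in msupp p -> (mdeg m)%:Z = j.

(* If P is graded by gr, the grading of P[X] in which x has degree w x *)
Definition poly_homog (P : comNzRingType) (gr : int -> P -> Prop)
    (X : choiceType) (w : X -> int) (j : int) (f : polyalg P X) : Prop :=
  forall m : {cmonom X}, m \in msupp f ->
    gr (j - \sum_(x <- finsupp m) w x *+ m x) f@_m.

Section GradedCotangentCohomology.
Variables (P : comNzRingType) (grP : int -> P -> Prop).
Variables (A : comAlgType P) (grA : int -> A -> Prop).

Record graded_resolution (S : simplicial_resolution A)
    (w : forall n, gens S n -> int) : Prop := {
  face_homog : forall n i j f, (i <= n.+1)%N ->
    poly_homog grP (@w n.+1) j f -> poly_homog grP (@w n) j (face S n i f);
  degen_homog : forall n i j f, (i <= n)%N ->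
    poly_homog grP (@w n) j f -> poly_homog grP (@w n.+1) j (degen S n i f);
  augm_homog : forall j f, poly_homog grP (@w 0) j f -> grA j (augm S f)
}.

Variables (S : simplicial_resolution A) (w : forall n, gens S n -> int).

Definition T_homog (e : int) (n : nat) (D : polyalg P (gens S n) -> A^o) :
    Prop :=
  forall j f, poly_homog grP (@w n) j f -> grA (j + e) (D f).

(* The group T^n(A/P, A) is the sum of its homogeneous parts T^n(A/P, A)_e,
   and T^n(A/P, A)_e = 0 for e < b. *)
Definition T_in_degrees_ge (n : nat) (b : int) : Prop :=
  (forall D : polyalg P (gens S n) -> A^o, T_cocycle D ->
     exists (s : seq int) (E : int -> polyalg P (gens S n) -> A^o),
       (forall e, T_cocycle (E e) /\ T_homog e (E e)) /\
       T_coboundary (fun x => D x - \sum_(e <- s) E e x)) /\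
  (forall e (D : polyalg P (gens S n) -> A^o), e < b ->
     T_cocycle D -> T_homog e D -> T_coboundary_of (@T_homog e) D).

End GradedCotangentCohomology.

(* The coordinates z on the local ring A and the Noether normalisation
   C[x_0, ..., x_(n-1)]_(0) = P -> A : the images of the variables of P are the
   last n coordinates. *)
Record noether_normalisation (C : fieldType) (n d : nat) (P : comUnitRingType)
    (phi : polyalg C 'I_n -> P) (A : comUnitAlgType P)
    (z : 'I_d.-1 -> A) : Prop := {
  nn_loc : localisation_at_origin phi;
  nn_basis : module_basis (with_one z);
  nn_coord : minimal_generators
    (coordinates z (fun j : 'I_n => (phi (pvar C j))%:A)) (@nonunit A)
}.

Definition irrelevant (C : fieldType) (n k : nat)
    (B : comAlgType (polyalg C 'I_n)) (z : 'I_k -> B) : B -> Prop :=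
  ideal_gen predT (coordinates z (fun j : 'I_n => (pvar C j)%:A)).

(* P -> A is graded: it is the localisation at the irrelevant ideal of
   C[x_0, ..., x_(n-1)] -> B with B graded, z_i and x_j of degree 1. *)
Record graded_model (C : fieldType) (n d : nat) (P : comUnitRingType)
    (phi : polyalg C 'I_n -> P) (A : comUnitAlgType P) (z : 'I_d.-1 -> A)
    (B : comAlgType (polyalg C 'I_n)) (grB : int -> B -> Prop)
    (zB : 'I_d.-1 -> B) (psi : B -> A) : Prop := {
  gm_grading : Z_grading grB;
  gm_base : forall j p, std_homog j p -> grB j p%:A;
  gm_deg1 : forall i, grB 1 (zB i);
  gm_basis : module_basis (with_one zB);
  gm_phi : forall p, psi p%:A = (phi p)%:A;
  gm_z : forall i, psi (zB i) = z i;
  gm_unit : forall b, ~ irrelevant zB b -> psi b \is a GRing.unit;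
  gm_frac : forall a, exists b s, ~ irrelevant zB s /\ a * psi s = psi b;
  gm_inj : forall b, psi b = 0 -> exists s, ~ irrelevant zB s /\ s * b = 0
}.

(* Main.v *)
Require Import Defs.
From HB Require Import structures.
From mathcomp Require Import all_boot all_order all_algebra all_fingroup.
From mathcomp Require Import finmap.
From mathcomp.multinomials Require Import monalg.
From mathcomp Require Import reals boolp.
From mathcomp.real_closed Require Import complex.
From mathcomp Require Import zify ring.

Set Implicit Arguments.
Unset Strict Implicit.
Unset Printing Implicit Defensive.

Import Order.TTheory GRing.Theory Num.Theory.
Local Open Scope ring_scope.

(** Cotangent cohomology is computed by normalized Harrison cochains, and a
normalized Harrison cocycle is forced into the maximal ideal by looking at a
single coefficient.

The coefficient. Write elements of [A] in the basis consisting of [1] and the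
[z i]. As the coordinates generate the maximal ideal minimally, the coefficients
of every product [z i * z j] lie in the maximal ideal of [P]
([product_coef_nonunit]). Modulo that ideal, multiplication by [z a] therefore
moves the coefficient of [1] to that of [z a] and kills the other ones. In the
cocycle identity for [f] on the word [z a, z i_1, ..., z i_q] all the terms with
a product of two letters vanish modulo the ideal, and if [a] differs from [i_q],
comparing the coefficients of [z a] shows that the coefficient of [1] in
[f (z i_1, ..., z i_q)] lies in the ideal. Since there are [d - 1 >= 2] letters,
such an [a] exists ([cocycle_unit_coef]). A normalized [f] vanishes on words
containing [1], so that all its values are nonunits ([cocycle_maximal]). In the
graded case the polynomials without constant term take the place of the maximal
ideal: a cocycle of degree [e < - n] maps a word of [n + 1] generators to degree
[e + n + 1 <= 0], that is to a constant, and the constant is zero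
([cocycle_low_degree]).

The comparison. Normalized Harrison cochains on the algebras of a resolution form
a double complex. It is exact in the simplicial direction because the resolution
has a unital linear contraction ([exists_contraction]), and exact above degree one
in the Harrison direction because the Harrison complex of a polynomial algebra in
characteristic zero is ([poly_exact]): an Euler operator is invertible there and
null-homotopic. The resulting relation [zigzag] between cocycles of the two kinds
is total on both sides and detects coboundaries ([T_represent], [T_lift],
[T_trivial]). It is natural in the module of coefficients, so that a cocycle
with values in the maximal ideal can be lifted; this gives the surjectivity. It
also respects degrees, and the homogeneous parts of a Harrison cocycle are easily
written down on basis words ([part_sum]); this gives the grading.

Unnormalized cochains. The Harrison cochains of the statement vanish on the sum of
all the shuffle products of the two parts of a word. That sum is the second Adams
operation minus twice the identity, and on products of [k] words it acts as
multiplication by [2 ^ k - 2], up to products of more words; hence the cochains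
vanish on each shuffle product ([adams_harrison]). A cocycle is then normalized by
subtracting coboundaries: inserting a one gives an operator homotopic to zero that
is triangular on basis words, with a positive integer on the diagonal for every
word containing a one ([unit_laplace_basis], [exists_normalized]). *)

(** * Identities in abelian groups *)

Section LinearIdentities.
Variable V : zmodType.

(** Formal signed sums, compared by counting each variable with sign. *)
Inductive zexp := ZVar of nat | ZZero | ZAdd of zexp & zexp | ZOpp of zexp.

Fixpoint zeval (vs : seq V) (e : zexp) : V :=
  match e with
  | ZVar i => nth 0 vs i
  | ZZero => 0
  | ZAdd a b => zeval vs a + zeval vs b
  | ZOpp a => - zeval vs a
  end.

Fixpoint zcoef (e : zexp) (i : nat) : int :=
  match e with
  | ZVar j => (i == j)%:Z
  | ZZero => 0
  | ZAdd a b => zcoef a i + zcoef b i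
  | ZOpp a => - zcoef a i
  end.

Fixpoint zvars (n : nat) (e : zexp) : bool :=
  match e with
  | ZVar j => (j < n)%N
  | ZZero => true
  | ZAdd a b => zvars n a && zvars n b
  | ZOpp a => zvars n a
  end.

Lemma zeval_coef vs e : zvars (size vs) e ->
  zeval vs e = \sum_(0 <= i < size vs) nth 0 vs i *~ zcoef e i.
Proof.
elim: e => [j|_|a IHa b IHb|a IHa] /=.
- move=> hj; rewrite (bigD1_seq j) ?mem_index_iota ?iota_uniq //= eqxx mulr1z.
  by rewrite big1 ?addr0 // => i /negPf ->.
- by rewrite big1.
- case/andP=> ha hb; rewrite IHa // IHb // -big_split /=.
  by apply: eq_bigr => i _; rewrite mulrzDr.
- by move=> ha; rewrite IHa // -sumrN; apply: eq_bigr => i _; rewrite mulrNz.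
Qed.

Lemma zeval_eq vs e1 e2 :
  [&& zvars (size vs) e1, zvars (size vs) e2 &
      all (fun i => zcoef e1 i == zcoef e2 i) (iota 0 (size vs))] ->
  zeval vs e1 = zeval vs e2.
Proof.
case/and3P=> h1 h2 /allP h; rewrite !zeval_coef //.
rewrite big_nat_cond [RHS]big_nat_cond.
apply: eq_bigr => i /andP[hi _].
by rewrite (eqP (h i _)) // mem_iota.
Qed.

End LinearIdentities.

Lemma scaleCA (K : comNzRingType) (V : lmodType K) (c k : K) (x : V) :
  c *: (k *: x) = k *: (c *: x).
Proof. by rewrite !scalerA mulrC. Qed.

Lemma signsK (K : comNzRingType) (V : lmodType K) n (x : V) :
  (-1) ^+ n *: ((-1) ^+ n *: x) = x.
Proof. by rewrite scalerA -exprD addnn -mul2n exprM sqrrN !expr1n scale1r. Qed.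

Ltac zlookup x vs :=
  match vs with
  | x :: _ => constr:(0%N)
  | _ :: ?t => let n := zlookup x t in constr:(S n)
  end.

(** Terms that differ only in their structure instances must become the same variable. *)
Ltac zlookup_conv x vs :=
  match vs with
  | ?y :: _ =>
      let _ := match goal with _ => unify x y with typeclass_instances end in
      constr:(0%N)
  | _ :: ?t => let n := zlookup_conv x t in constr:(S n)
  end.

Ltac zfind x vs :=
  match vs with
  | _ => zlookup x vs
  | _ => zlookup_conv x vs
  end.

Ltac zcollect t vs :=
  match t with
  | (?a + ?b)%R => let vs1 := zcollect a vs in zcollect b vs1
  | (- ?a)%R => zcollect a vs
  | 0%R => vs
  | _ => match vs with
         | _ => let _ := zfind t vs in vs
         | _ => constr:(t :: vs)
         end
  end.

Ltac zreify t vs :=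
  match t with
  | (?a + ?b)%R =>
      let a' := zreify a vs in let b' := zreify b vs in constr:(ZAdd a' b')
  | (- ?a)%R => let a' := zreify a vs in constr:(ZOpp a')
  | 0%R => constr:(ZZero)
  | _ => let n := zfind t vs in constr:(ZVar n)
  end.

(** Identities between signed sums that hold in every abelian group. *)
Ltac zmodule :=
  match goal with
  | |- @eq ?T ?x ?y =>
      let vs0 := zcollect x (@nil T) in
      let vs := zcollect y vs0 in
      let ex := zreify x vs in
      let ey := zreify y vs in
      exact: (@zeval_eq _ vs ex ey (erefl true))
  end.

(** * Shuffles of words *)

Section LinearFunctionals.
Variables (K : comNzRingType) (M : lmodType K) (X : Type).

(** Linear functionals of a function argument, applied to maps written under a
binder; the operators on words below are all of this kind. *)
Definition oplin (T : (X -> M) -> M) : Prop :=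
  forall c f g, T (fun x => c *: f x + g x) = c *: T f + T g.

Variable T : (X -> M) -> M.
Hypothesis linT : oplin T.

Lemma opD f g : T (fun x => f x + g x) = T f + T g.
Proof.
rewrite -[T f]scale1r -linT; congr T; apply: funext => x.
by rewrite scale1r.
Qed.

Lemma op0 : T (fun _ => 0) = 0.
Proof.
have := opD (fun _ => 0) (fun _ => 0).
rewrite (_ : (fun _ => 0 + 0) = fun=> 0); last by apply: funext => x; rewrite addr0.
by move/(congr1 (fun z => z - T (fun=> 0))); rewrite subrr addrK => <-.
Qed.

Lemma opZ c f : T (fun x => c *: f x) = c *: T f.
Proof.
rewrite -[c *: T f]addr0 -op0 -linT; congr T; apply: funext => x.
by rewrite addr0.
Qed.

Lemma opN f : T (fun x => - f x) = - T f.
Proof.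
rewrite -scaleN1r -opZ; congr T; apply: funext => x.
by rewrite scaleN1r.
Qed.

Lemma opB f g : T (fun x => f x - g x) = T f - T g.
Proof. by rewrite opD opN. Qed.

Lemma op_sum (I : Type) (r : seq I) (F : I -> X -> M) :
  T (fun x => \sum_(i <- r) F i x) = \sum_(i <- r) T (F i).
Proof.
elim: r => [|i r IH].
  rewrite big_nil -[RHS]op0; congr T; apply: funext => x; exact: big_nil.
rewrite big_cons -IH -opD; congr T; apply: funext => x; exact: big_cons.
Qed.

End LinearFunctionals.

Section Words.
Variables (L : Type) (K : comNzRingType) (M : lmodType K).
Implicit Types (a b : L) (u v w : seq L) (f g : seq L -> M).

Definition prep a f : seq L -> M := fun w => f (a :: w).

(** The signed sum of the values of [f] at the shuffles of [u] and [v]. *)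
Fixpoint sh u : (seq L -> M) -> seq L -> M :=
  match u with
  | [::] => fun f v => f v
  | a :: u' =>
      fix sh_a f v {struct v} : M :=
        match v with
        | [::] => f (a :: u')
        | b :: v' =>
            sh u' (prep a f) (b :: v') + (-1) ^+ (size u').+1 *: sh_a (prep b f) v'
        end
  end.

Lemma sh0l f v : sh [::] f v = f v. Proof. by []. Qed.

Lemma sh0r u f : sh u f [::] = f u. Proof. by case: u. Qed.

Lemma sh_cons a u f b v :
  sh (a :: u) f (b :: v) =
  sh u (prep a f) (b :: v) + (-1) ^+ (size u).+1 *: sh (a :: u) (prep b f) v.
Proof. by []. Qed.

End Words.

Arguments sh : simpl never.

Section Derivations.
Variables (L : Type) (K : comNzRingType) (M : lmodType K).
Implicit Types (a b : L) (u v w : seq L) (f g : seq L -> M).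

Lemma sh_lin u v : oplin (fun f => sh u f v).
Proof.
elim: u v => [|a u IHu] v c f g //.
elim: v f g => [|b v IHv] f g //.
rewrite !sh_cons (IHu (b :: v) c (prep a f) (prep a g)).
rewrite (IHv (prep b f) (prep b g)).
rewrite !scalerDr [_ *: (c *: _)]scaleCA.
zmodule.
Qed.

(** An operator [theta] changing the length of words by one, whose graded
commutator with [prep a] is [Psi a], is a graded derivation for the shuffle
product as soon as [Psi] satisfies the identity [PsiP]. *)
Section OddDerivation.
Variable theta : (seq L -> M) -> seq L -> M.
Variable Psi : L -> (seq L -> M) -> seq L -> M.
Hypothesis theta_lin : forall w, oplin (fun f => theta f w).
Hypothesis theta0 : forall f, theta f [::] = 0.
Hypothesis theta_cons : forall a f w,
  theta f (a :: w) = Psi a f w - theta (prep a f) w.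
Hypothesis theta_odd : forall f w,
  theta (fun w => (-1) ^+ size w *: f w) w = - ((-1) ^+ size w *: theta f w).
Hypothesis PsiP : forall a u b v f,
  sh u (Psi a f) (b :: v) + (-1) ^+ (size u).+1 *: sh (a :: u) (Psi b f) v =
  Psi a (fun X => sh X f (b :: v)) u
  + (-1) ^+ (size u).+1 *: (Psi a (fun X => sh X (prep b f) v) u
     + Psi b (fun Y => sh (a :: u) f Y) v
     - Psi b (fun Y => sh u (prep a f) Y) v).

Lemma odd_derivation u f v :
  sh u (theta f) v =
  theta (fun X => sh X f v) u + (-1) ^+ size u *: theta (fun Y => sh u f Y) v.
Proof.
elim: u f v => [|a u IHu] f v; first by rewrite theta0 add0r scale1r.
elim: v f => [|b v IHv] f.
  rewrite sh0r theta0 scaler0 addr0; congr theta.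
  by apply: funext => X; rewrite sh0r.
have prep_theta c : prep c (theta f) = fun w => Psi c f w - theta (prep c f) w.
  by apply: funext => w; rewrite /prep theta_cons.
rewrite sh_cons !prep_theta (opB (sh_lin _ _)) (opB (sh_lin _ _)) IHu IHv.
set chi := fun X => sh X (prep b f) v.
have E1 : theta (fun X => sh X f (b :: v)) (a :: u) =
    Psi a (fun X => sh X f (b :: v)) u
    - theta (fun X => sh X (prep a f) (b :: v)) u
    - (-1) ^+ size u *: (Psi a chi u - theta chi (a :: u)).
  rewrite theta_cons.
  have -> : prep a (fun X => sh X f (b :: v)) =
     fun X => sh X (prep a f) (b :: v) - (-1) ^+ size X *: prep a chi X.
    by apply: funext => X; rewrite /prep sh_cons exprS mulN1r scaleNr.
  rewrite (opB (theta_lin _)) theta_odd (theta_cons a chi) !scalerBr.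
zmodule.
have E2 : theta (fun Y => sh (a :: u) f Y) (b :: v) =
    Psi b (fun Y => sh (a :: u) f Y) v
    - (Psi b (fun Y => sh u (prep a f) Y) v
       - theta (fun Y => sh u (prep a f) Y) (b :: v))
    + (-1) ^+ size u *: theta (fun Y => sh (a :: u) (prep b f) Y) v.
  rewrite theta_cons.
  have -> : prep b (fun Y => sh (a :: u) f Y) =
     fun Y => prep b (fun Y => sh u (prep a f) Y) Y
              - (-1) ^+ size u *: sh (a :: u) (prep b f) Y.
    by apply: funext => Y; rewrite /prep sh_cons exprS mulN1r scaleNr.
  rewrite (opB (theta_lin _)) (opZ (theta_lin _)).
  rewrite (theta_cons b (fun Y => sh u (prep a f) Y)).
zmodule.
rewrite E1 E2; have := PsiP a u b v f; rewrite -/chi.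
rewrite [size (a :: u)]/= exprS !mulN1r !scaleNr !(scalerDr, scalerN).
rewrite !signsK => /(canRL (addrK _)) ->.
zmodule.
Qed.

End OddDerivation.

Section Marking.
Variables (Y : Type) (tau : L -> seq (Y * L)).
Implicit Types (h : Y -> seq L -> M).

(** Each [(y, a')] in [tau a] marks the letter [a] by [y] and replaces it by [a'];
[mark] sums [h] over all the ways of marking one letter of a word. *)
Fixpoint mark h w : M :=
  if w is a :: w' then
    \sum_(p <- tau a) h p.1 (p.2 :: w') + mark (fun y => prep a (h y)) w'
  else 0.

Lemma mark_lin (Z : Type) (F : (Z -> M) -> Y -> seq L -> M) w :
  (forall y w, oplin (fun z => F z y w)) -> oplin (fun z => mark (F z) w).
Proof.
elim: w F => [|a w IH] F linF c z1 z2 /=; first by rewrite scaler0 addr0.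
rewrite (IH (fun z y => prep a (F z y))) => [|y x]; last exact: linF.
under eq_bigr => p _ do rewrite linF.
rewrite big_split /= -scaler_sumr scalerDr.
zmodule.
Qed.

Lemma markD h1 h2 w :
  mark (fun y x => h1 y x + h2 y x) w = mark h1 w + mark h2 w.
Proof.
elim: w h1 h2 => [|a w IH] h1 h2 /=; first by rewrite addr0.
rewrite (IH (fun y => prep a (h1 y)) (fun y => prep a (h2 y))) big_split /=.
zmodule.
Qed.

Lemma mark_ext h1 h2 w :
  (forall y x, size x = size w -> h1 y x = h2 y x) -> mark h1 w = mark h2 w.
Proof.
elim: w h1 h2 => [|a w IH] h1 h2 eqh //=.
rewrite (IH _ (fun y => prep a (h2 y))) => [|y x sx]; last first.
  by apply: eqh; rewrite /= sx.
by congr (_ + _); apply: eq_bigr => p _; apply: eqh.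
Qed.

Lemma markZ c h w : mark (fun y x => c *: h y x) w = c *: mark h w.
Proof.
elim: w h => [|a w IH] h /=; first by rewrite scaler0.
by rewrite (IH (fun y => prep a (h y))) scalerDr scaler_sumr.
Qed.

(** A Leibniz rule: the marked letter of a shuffle comes from one of the two words. *)
Lemma mark_derivation u h v :
  sh u (mark h) v =
  mark (fun y X => sh X (h y) v) u + mark (fun y Z => sh u (h y) Z) v.
Proof.
elim: u h v => [|a u IHu] h v; first by rewrite add0r.
elim: v h => [|b v IHv] h.
  by rewrite sh0r addr0; apply: mark_ext => y x _; rewrite sh0r.
have prep_mark c : prep c (mark h) =
    fun w => \sum_(p <- tau c) prep p.2 (h p.1) w
             + mark (fun y => prep c (h y)) w by [].
rewrite sh_cons !prep_mark (opD (sh_lin _ _)) (opD (sh_lin _ _)).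
rewrite !(op_sum (sh_lin _ _)) IHu IHv.
have E1 : mark (fun y X => sh X (h y) (b :: v)) (a :: u) =
    \sum_(p <- tau a) sh u (prep p.2 (h p.1)) (b :: v)
    + mark (fun y X => sh X (prep a (h y)) (b :: v)) u
    + (-1) ^+ (size u).+1 *: mark (fun y X => sh X (prep b (h y)) v) (a :: u).
  rewrite /=; under eq_bigr => p _ do rewrite sh_cons.
  rewrite big_split /=.
  have -> : mark (fun y => prep a (fun X => sh X (h y) (b :: v))) u =
     mark (fun y X => sh X (prep a (h y)) (b :: v)) u
     + (-1) ^+ (size u).+1 *: mark (fun y X => sh (a :: X) (prep b (h y)) v) u.
    rewrite -markZ -markD; apply: mark_ext => y x sx.
    by rewrite /prep sh_cons sx.
  rewrite -scaler_sumr scalerDr.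
zmodule.
have E2 : mark (fun y Z => sh (a :: u) (h y) Z) (b :: v) =
    mark (fun y Z => sh u (prep a (h y)) Z) (b :: v)
    + (-1) ^+ (size u).+1 *: (\sum_(p <- tau b) sh (a :: u) (prep p.2 (h p.1)) v
       + mark (fun y Z => sh (a :: u) (prep b (h y)) Z) v).
  rewrite /=; under eq_bigr => p _ do rewrite sh_cons.
  rewrite big_split /=.
  have -> : mark (fun y => prep b (fun Z => sh (a :: u) (h y) Z)) v =
     mark (fun y => prep b (fun Z => sh u (prep a (h y)) Z)) v
     + (-1) ^+ (size u).+1 *: mark (fun y Z => sh (a :: u) (prep b (h y)) Z) v.
    by rewrite -markZ -markD; apply: mark_ext => y x sx; rewrite /prep sh_cons.
  rewrite -scaler_sumr scalerDr.
zmodule.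
rewrite E1 E2 !scalerDr.
zmodule.
Qed.

End Marking.

Section Insertion.
Variable tau : L -> seq (L * L).

(** Mark a letter [a], replacing it by [a'] for [(y, a')] in [tau a], and insert
[y] with alternating signs at all the places before it. *)
Fixpoint insert f w : M :=
  if w is a :: w' then mark tau (fun y => prep y f) w - insert (prep a f) w'
  else 0.

Lemma insert_lin w : oplin (fun f => insert f w).
Proof.
elim: w => [|a w IH] c f g; first by rewrite /= scaler0 addr0.
rewrite /insert -/insert (IH c (prep a f) (prep a g)).
rewrite (@mark_lin _ _ _ (fun z y => prep y z)) // scalerBr.
zmodule.
Qed.

Lemma insert_odd f w :
  insert (fun w => (-1) ^+ size w *: f w) w = - ((-1) ^+ size w *: insert f w).
Proof.
elim: w f => [|a w IH] f; first by rewrite /= scaler0 oppr0.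
rewrite /insert -/insert.
have -> : mark tau (fun y => prep y (fun x => (-1) ^+ size x *: f x)) (a :: w)
   = - ((-1) ^+ (size w).+1 *: mark tau (fun y => prep y f) (a :: w)).
  rewrite -markZ -scaleN1r -markZ; apply: mark_ext => y x sx.
  by rewrite /prep /= sx /= !exprS !mulN1r !scaleNr scale1r.
have -> : prep a (fun x => (-1) ^+ size x *: f x) =
          fun x => - ((-1) ^+ size x *: prep a f x).
  by apply: funext => x; rewrite /prep /= exprS mulN1r scaleNr.
rewrite (opN (insert_lin _)) IH /= exprS mulN1r !scaleNr scalerBr.
zmodule.
Qed.

Lemma insert_derivation u f v :
  sh u (insert f) v =
  insert (fun X => sh X f v) u + (-1) ^+ size u *: insert (fun Z => sh u f Z) v.
Proof.
apply: (odd_derivation (Psi := fun a f w => mark tau (fun y => prep y f) (a :: w)))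
  => //; [exact: insert_lin | exact: insert_odd | ].
move=> {}a {}u b {}v {}f.
have -> : forall z, sh u (fun w => mark tau (fun y => prep y f) (a :: w)) z =
    sh u (prep a (mark tau (fun y => prep y f))) z by [].
rewrite -[X in _ + _ *: X]/(sh (a :: u) (prep b (mark tau (fun y => prep y f))) v).
rewrite -sh_cons mark_derivation.
have -> : mark tau (fun y => prep y (fun X => sh X f (b :: v))) (a :: u) =
    mark tau (fun y X => sh X (prep y f) (b :: v)) (a :: u)
    - (-1) ^+ (size u).+1 *:
       mark tau (fun y => prep y (fun X => sh X (prep b f) v)) (a :: u).
  rewrite -scaleNr -markZ -markD; apply: mark_ext => y x sx.
  by rewrite /prep sh_cons sx /= [in LHS]exprS mulN1r.
have -> : mark tau (fun y => prep y (fun Z => sh (a :: u) f Z)) (b :: v) =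
    mark tau (fun y => prep y (fun Z => sh u (prep a f) Z)) (b :: v)
    + (-1) ^+ (size u).+1 *: mark tau (fun y Z => sh (a :: u) (prep y f) Z) (b :: v).
  by rewrite -markZ -markD; apply: mark_ext => y x sx; rewrite /prep sh_cons.
move: (mark _ _ (b :: v)) (mark _ _ (a :: u)) (mark _ _ (b :: v)) => m1 m2 m3.
move: (mark _ _ (a :: u)) => m4.
rewrite !(scalerDr, scalerN) signsK.
zmodule.
Qed.

End Insertion.
End Derivations.

(** * The Hochschild differential *)

Section Hochschild.
Variables (L : Type) (mul : L -> L -> L) (K : comNzRingType) (rho : L -> K).
Variable M : lmodType K.
Implicit Types (a b : L) (u v w : seq L) (f g : seq L -> M).

Fixpoint hoch_tail f a w : M :=
  if w is b :: w' then f (mul a b :: w') - hoch_tail (prep a f) b w'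
  else rho a *: f [::].

(** The Hochschild differential on functions of words in [L]; both ends of a
word act on [M] through [rho]. *)
Definition hoch f w : M :=
  if w is a :: w' then rho a *: f w' - hoch_tail f a w' else 0.

(** The graded commutator of the differential with [prep a], which makes
[hoch_cons] a recursion over the word. *)
Definition hoch_comm a f w : M :=
  if w is b :: w' then rho a *: f w + rho b *: f (a :: w') - f (mul a b :: w')
  else 0.

Lemma hoch_cons f a w : hoch f (a :: w) = hoch_comm a f w - hoch (prep a f) w.
Proof.
case: w => [|b w] /=; first by rewrite !subrr.
rewrite -[prep a f w]/(f (a :: w)).
zmodule.
Qed.

Lemma hoch_commZ a c f w :
  hoch_comm a (fun x => c *: f x) w = c *: hoch_comm a f w.
Proof.
case: w => [|b w] /=; first by rewrite scaler0.
by rewrite !scalerDr scalerN !(scaleCA c).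
Qed.

Lemma hoch_comm_lin a w : oplin (fun f => hoch_comm a f w).
Proof.
move=> c f g; case: w => [|b w] /=; first by rewrite scaler0 addr0.
rewrite !(scalerDr, scalerN) ![c *: (rho _ *: _)]scaleCA.
zmodule.
Qed.

Lemma hoch_lin w : oplin (fun f => hoch f w).
Proof.
elim: w => [|a w IH] c f g; first by rewrite /= scaler0 addr0.
rewrite !hoch_cons hoch_comm_lin (IH c (prep a f) (prep a g)) scalerBr.
zmodule.
Qed.

Lemma hoch_tail_lin a w : oplin (fun f => hoch_tail f a w).
Proof.
elim: w a => [|b w IH] a c f g /=; first by rewrite scalerDr scaleCA.
rewrite (IH b c (prep a f) (prep a g)) scalerBr.
zmodule.
Qed.

(** Signs by the length anticommute with an operator that changes it by one. *)
Lemma hoch_odd f w :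
  hoch (fun w => (-1) ^+ size w *: f w) w = - ((-1) ^+ size w *: hoch f w).
Proof.
elim: w f => [|a w IH] f; first by rewrite /= scaler0 oppr0.
rewrite !hoch_cons.
have -> : hoch_comm a (fun w => (-1) ^+ size w *: f w) w =
          (-1) ^+ size w *: hoch_comm a f w.
  rewrite -hoch_commZ; case: w {IH} => [|b w] //=.
have -> : prep a (fun x => (-1) ^+ size x *: f x) =
          fun x => - ((-1) ^+ size x *: prep a f x).
  by apply: funext => x; rewrite /prep /= exprS mulN1r scaleNr.
rewrite (opN (hoch_lin _)) IH /= exprS mulN1r !scaleNr scalerBr.
zmodule.
Qed.

Hypothesis mulA : associative mul.
Hypothesis mulC : commutative mul.
Hypothesis rhoM : forall a b, rho (mul a b) = rho a * rho b.

(** The Hochschild differential is a graded derivation for the shuffle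
product; this is where the symmetry of the coefficients enters. *)
Lemma hoch_derivation u f v :
  sh u (hoch f) v =
  hoch (fun X => sh X f v) u + (-1) ^+ size u *: hoch (fun Z => sh u f Z) v.
Proof.
apply: (odd_derivation (Psi := hoch_comm)) => //.
- exact: hoch_lin.
- by move=> *; exact: hoch_cons.
- exact: hoch_odd.
move=> {}a {}u b {}v {}f.
have prep_comm c d : prep d (hoch_comm c f) = fun w =>
    rho c *: prep d f w + rho d *: prep c f w - prep (mul c d) f w by [].
have shD c d x y : sh x (prep d (hoch_comm c f)) y =
    rho c *: sh x (prep d f) y + rho d *: sh x (prep c f) y
    - sh x (prep (mul c d) f) y.
  rewrite prep_comm (opB (sh_lin _ _)) (opD (sh_lin _ _)).
  by rewrite !(opZ (sh_lin _ _)).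
case: u => [|p u]; case: v => [|r v].
- rewrite !sh0l !sh0r /= (mulC b a) expr1 !scaleN1r; zmodule.
- rewrite sh0l [sh _ (hoch_comm b f) _]sh_cons !shD /= ![sh _ f (_ :: _)]sh_cons.
  rewrite !sh0l /= /prep (mulC b a).
  rewrite !exprS !(scalerDr, scalerN, mulN1r, scaleNr, opprK, scale1r).
  zmodule.
- rewrite [sh _ (hoch_comm b f) _]sh0r [sh _ (hoch_comm a f) _]sh_cons !shD /=.
  rewrite ![sh _ f (_ :: _)]sh_cons.
  rewrite (mulC b a).
  rewrite !exprS !(scalerDr, scalerN, mulN1r, scaleNr, opprK).
  rewrite ![rho _ *: ((-1) ^+ _ *: _)]scaleCA ?signsK !sh0r.
  zmodule.
rewrite ![sh _ (hoch_comm _ f) _]sh_cons !shD /=.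
rewrite ![sh _ f (_ :: _)]sh_cons (mulC b a).
rewrite !exprS !(scalerDr, scalerN, mulN1r, scaleNr, opprK).
rewrite ![rho _ *: ((-1) ^+ _ *: _)]scaleCA !signsK.
zmodule.
Qed.

Lemma hoch_hoch f w : hoch (hoch f) w = 0.
Proof.
elim: w f => [|a w IH] f //; rewrite hoch_cons.
have -> : prep a (hoch f) = fun x => hoch_comm a f x - hoch (prep a f) x.
  by apply: funext => x; rewrite /prep hoch_cons.
rewrite (opB (hoch_lin _)) IH subr0.
case: w {IH} => [|b w]; first by rewrite subrr.
rewrite [hoch (hoch_comm a f) _]hoch_cons.
have -> : prep b (hoch_comm a f) = fun w =>
    rho a *: prep b f w + rho b *: prep a f w - prep (mul a b) f w by [].
rewrite (opB (hoch_lin _)) (opD (hoch_lin _)) !(opZ (hoch_lin _)).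
rewrite {1}/hoch_comm !hoch_cons.
case: w => [|c w].
  rewrite /= !(scalerDr, scalerN, scaler0); zmodule.
rewrite [hoch_comm b f _]/= [hoch_comm a f (c :: w)]/=.
rewrite [hoch_comm (mul a b) f _]/= [hoch_comm b (hoch_comm a f) _]/=.
rewrite !(scalerDr, scalerN) !rhoM -!scalerA mulA.
rewrite [rho c *: (rho b *: _)]scaleCA [rho c *: (rho a *: _)]scaleCA.
rewrite [rho b *: (rho a *: _)]scaleCA.
zmodule.
Qed.

(** A marking that satisfies the Leibniz rule commutes with the differential,
except for the marks on the two letters that act on the coefficients. *)
Section MarkedDifferential.
Variables (Y : Type) (tau : L -> seq (Y * L)).
Hypothesis tauM : forall a b (F : Y -> L -> M),
  \sum_(p <- tau (mul a b)) F p.1 p.2 =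
  \sum_(p <- tau a) F p.1 (mul p.2 b) + \sum_(p <- tau b) F p.1 (mul a p.2).
Implicit Type h : Y -> seq L -> M.

Lemma mark_hoch_tail h a w :
  \sum_(p <- tau a) hoch_tail (h p.1) p.2 w
  + mark tau (fun y x => hoch_tail (h y) a x) w - hoch_tail (mark tau h) a w =
  (-1) ^+ size w *:
    \sum_(p <- tau (last a w)) rho p.2 *: h p.1 (belast a w).
Proof.
elim: w h a => [|b w IH] h a /=.
  by rewrite scaler0 subr0 addr0 expr0 scale1r.
rewrite exprS mulN1r scaleNr -(IH (fun y => prep a (h y)) b).
rewrite (tauM a b (fun y c => h y (c :: w))).
have -> : prep a (mark tau h) = fun x =>
    \sum_(p <- tau a) prep p.2 (h p.1) x + mark tau (fun y => prep a (h y)) x.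
  by [].
rewrite (opD (hoch_tail_lin _ _)) (op_sum (hoch_tail_lin _ _)).
have -> : mark tau (fun y => prep b (fun x => hoch_tail (h y) a x)) w =
    mark tau (fun y => prep (mul a b) (h y)) w
    - mark tau (fun y x => hoch_tail (prep a (h y)) b x) w.
  rewrite -[- mark _ _ w]scaleN1r -markZ -markD.
  by apply: mark_ext => y x _; rewrite scaleN1r.
under eq_bigr => p _ do rewrite /=.
rewrite sumrB.
under [\sum_(p <- tau b) (h p.1 _ - _)]eq_bigr => p _ do rewrite /=.
rewrite sumrB.
zmodule.
Qed.

Lemma mark_hoch h a w :
  mark tau (fun y => hoch (h y)) (a :: w) - hoch (mark tau h) (a :: w) =
  \sum_(p <- tau a) rho p.2 *: h p.1 w
  - (-1) ^+ size w *:
    \sum_(p <- tau (last a w)) rho p.2 *: h p.1 (belast a w).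
Proof.
rewrite -mark_hoch_tail.
have -> : mark tau (fun y => hoch (h y)) (a :: w) =
    \sum_(p <- tau a) (rho p.2 *: h p.1 w - hoch_tail (h p.1) p.2 w)
    + (rho a *: mark tau h w - mark tau (fun y x => hoch_tail (h y) a x) w).
  rewrite -[- mark _ _ w]scaleN1r -!markZ -markD /=.
  by congr (_ + _); apply: mark_ext => y x _; rewrite scaleN1r.
rewrite sumrB.
have -> : hoch (mark tau h) (a :: w) =
  rho a *: mark tau h w - hoch_tail (mark tau h) a w by [].
zmodule.
Qed.

End MarkedDifferential.

End Hochschild.

(** * The Euler operator *)

Section EulerHomotopy.
Variables (L : Type) (mul : L -> L -> L) (K : comNzRingType) (rho : L -> K).
Variable M : lmodType K.
Variable tau : L -> seq (L * L).
Implicit Types (a b : L) (u v w : seq L) (f g : seq L -> M).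

Hypothesis mulC : commutative mul.
Hypothesis rhoM : forall a b, rho (mul a b) = rho a * rho b.
Hypothesis tauM : forall a b (F : L -> L -> M),
  \sum_(p <- tau (mul a b)) F p.1 p.2 =
  \sum_(p <- tau a) F p.1 (mul p.2 b) + \sum_(p <- tau b) F p.1 (mul a p.2).
Hypothesis tau_size : forall a b,
  size (tau (mul a b)) = (size (tau a) + size (tau b))%N.
Hypothesis tau_mul : forall a (F : L -> M),
  \sum_(p <- tau a) F (mul p.1 p.2) = F a *+ size (tau a).

Local Notation d := (hoch mul rho).
Local Notation ins := (insert tau).

Definition weight w : nat := sumn [seq size (tau a) | a <- w].

(** For the marking that splits off a variable from a monomial, this is multiplication
by the total degree minus the operator that differentiates one letter at a time and
lets the variable act on the coefficients. *)
Definition euler f w : M :=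
  f w *+ weight w - mark tau (fun y x => rho y *: f x) w.

(** The contribution of the last letter, whose marks act on the coefficients from
the right. *)
Definition right_end f w : M :=
  if w is a :: w' then
    (-1) ^+ size w' *:
      \sum_(p <- tau (last a w')) rho p.2 *: sh [:: p.1] f (belast a w')
  else 0.

Lemma right_end_cons f a w :
  right_end f (a :: w) = right_end (prep a f) w
  + (-1) ^+ size w *: \sum_(p <- tau (last a w)) rho p.2 *: f (p.1 :: belast a w).
Proof.
case: w => [|b w] /=; first by rewrite add0r.
under eq_bigr => p _ do rewrite sh_cons sh0l expr1 scaleN1r scalerBr.
rewrite sumrB exprS mulN1r !scaleNr scalerBr.
zmodule.
Qed.

Lemma euler_cons f a w :
  euler f (a :: w) = euler (prep a f) w
  + (f (a :: w) *+ size (tau a) - \sum_(p <- tau a) rho p.1 *: f (p.2 :: w)).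
Proof.
rewrite /euler /= mulrnDr.
rewrite -[mark _ (fun y => prep a _) w]/(mark tau (fun y x => rho y *: prep a f x) w).
rewrite -[prep a f w]/(f (a :: w)).
zmodule.
Qed.

(** The Cartan-type homotopy between the Euler operator and a term involving
only shuffles of a single letter with a word. *)
Lemma insert_homotopy f w :
  d (ins f) w + ins (d f) w = right_end f w - euler f w.
Proof.
elim: w f => [|a w IH] f; first by rewrite /euler /= mulr0n !subrr addr0.
set G := mark tau (fun y => prep y f).
have prep_ins c : prep c (ins f) = fun x => prep c G x - ins (prep c f) x.
  by apply: funext => x.
have prep_d c : prep c (d f) = fun x => hoch_comm mul rho c f x - d (prep c f) x.
  by apply: funext => x; rewrite /prep hoch_cons.
rewrite [d (ins f) _]hoch_cons prep_ins (opB (hoch_lin _ _ _)).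
have E0 : d (prep a G) w = hoch_comm mul rho a G w - d G (a :: w).
  rewrite hoch_cons; zmodule.
have E1 : ins (d f) (a :: w) =
   mark tau (fun y => hoch_comm mul rho y f) (a :: w)
   - mark tau (fun y => d (prep y f)) (a :: w)
   - (ins (hoch_comm mul rho a f) w - ins (d (prep a f)) w).
  rewrite -[ins _ (a :: w)]/(mark tau (fun y => prep y (d f)) (a :: w)
                             - ins (prep a (d f)) w).
  rewrite prep_d (opB (insert_lin _ _)); congr (_ - _).
  rewrite -[- mark _ (fun y => d _) _]scaleN1r -markZ -markD.
  by apply: mark_ext => y x _; rewrite prep_d scaleN1r.
have E2 := mark_hoch rho tauM (fun y => prep y f) a w.
rewrite -/G in E2.
rewrite E0 E1 right_end_cons euler_cons.
have {}IH := IH (prep a f).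
suff E3 : hoch_comm mul rho a (ins f) w - hoch_comm mul rho a G w
   + mark tau (fun y => hoch_comm mul rho y f) (a :: w)
   - ins (hoch_comm mul rho a f) w =
   \sum_(p <- tau a) rho p.2 *: f (p.1 :: w) - f (a :: w) *+ size (tau a)
   + \sum_(p <- tau a) rho p.1 *: f (p.2 :: w).
  move: (mark tau _ _) (mark tau _ _) E2 E3 IH => x1 x2.
  move: (d G _) (d _ w) (ins (d _) w) => x3 x4 x5.
  move/(canRL (subrK _)) => -> /(canRL (subrK _))/(canRL (addKr _)) -> /(canRL (addrK _)) ->.
  zmodule.
have -> : mark tau (fun y => hoch_comm mul rho y f) (a :: w) =
    \sum_(p <- tau a) (rho p.1 *: f (p.2 :: w) + rho p.2 *: f (p.1 :: w)
                       - f (mul p.1 p.2 :: w))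
    + mark tau (fun y x => rho y *: prep a f x + rho a *: f (y :: x)
                           - f (mul y a :: x)) w by [].
rewrite sumrB big_split /= (tau_mul a (fun c => f (c :: w))).
set T := mark _ _ w.
suff E3 : hoch_comm mul rho a (ins f) w - hoch_comm mul rho a G w + T
          - ins (hoch_comm mul rho a f) w = 0.
  rewrite -[RHS]addr0 -E3; zmodule.
rewrite {}/T; case: w {E0 E1 E2 IH} => [|b w].
  by rewrite /= !subr0 addr0.
have insE c : ins f (c :: w) = G (c :: w) - ins (prep c f) w by [].
have -> : ins (hoch_comm mul rho a f) (b :: w) =
    mark tau (fun y => prep y (hoch_comm mul rho a f)) (b :: w)
    - ins (prep b (hoch_comm mul rho a f)) w by [].
have -> : prep b (hoch_comm mul rho a f) = fun w =>
    rho a *: prep b f w + rho b *: prep a f w - prep (mul a b) f w by [].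
rewrite (opB (insert_lin _ _)) (opD (insert_lin _ _)) !(opZ (insert_lin _ _)).
have -> : mark tau (fun y => prep y (hoch_comm mul rho a f)) (b :: w) =
    mark tau (fun y x => rho y *: prep a f x + rho a *: f (y :: x)
                         - f (mul y a :: x)) (b :: w).
  apply: mark_ext => y x sx; case: x sx => // c x _.
  by rewrite /prep /hoch_comm mulC; zmodule.
rewrite /hoch_comm !insE !(scalerDr, scalerN); zmodule.
Qed.

(** Multiplication by the weight is itself a marking, with one trivial mark for each
factor; so [hoch_euler] can use [mark_hoch] for both terms. *)
Lemma mark_weight f w :
  mark (fun a => [seq (tt, a) | _ <- tau a]) (fun=> f) w = f w *+ weight w.
Proof.
elim: w f => [|a w IH] f; first by rewrite /= mulr0n.
rewrite /= IH mulrnDr big_map /=; congr (_ + _).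
by elim: (tau a) => [|p s IHs]; rewrite ?big_nil // big_cons IHs mulrS.
Qed.

Lemma hoch_euler f w : d (euler f) w = euler (d f) w.
Proof.
case: w => [|a w]; first by rewrite /euler /= mulr0n subr0.
have -> : euler f = fun x =>
    mark (fun a => [seq (tt, a) | _ <- tau a]) (fun=> f) x
    - mark tau (fun y x => rho y *: f x) x.
  by apply: funext => x; rewrite mark_weight.
rewrite (opB (hoch_lin _ _ _)) /euler -mark_weight.
have sumN (b : L) (F : unit -> L -> M) :
    \sum_(p <- [seq (tt, b) | _ <- tau b]) F p.1 p.2 = F tt b *+ size (tau b).
  rewrite big_map; elim: (tau b) => [|p s IHs]; rewrite ?big_nil //=.
  by rewrite big_cons IHs mulrS.
have tauNM (b c : L) (F : unit -> L -> M) :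
    \sum_(p <- [seq (tt, mul b c) | _ <- tau (mul b c)]) F p.1 p.2 =
    \sum_(p <- [seq (tt, b) | _ <- tau b]) F p.1 (mul p.2 c)
    + \sum_(p <- [seq (tt, c) | _ <- tau c]) F p.1 (mul b p.2).
  rewrite !sumN (sumN _ (fun y e => F y (mul e c))).
  by rewrite (sumN _ (fun y e => F y (mul b e))) tau_size mulrnDr.
have /(canRL (subrK _)) -> :=
  mark_hoch (tau := fun a => [seq (tt, a) | _ <- tau a]) rho tauNM (fun=> f) a w.
have E2 := mark_hoch rho tauM (fun y x => rho y *: f x) a w.
move/(canRL (subrK _)): E2.
have -> : mark tau (fun y => d (fun x => rho y *: f x)) (a :: w) =
          mark tau (fun y x => rho y *: d f x) (a :: w).
  by apply: mark_ext => y x _; rewrite (opZ (hoch_lin _ _ _)).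
move=> ->.
rewrite !(sumN _ (fun _ c => rho c *: f w)).
rewrite !(sumN _ (fun _ c => rho c *: f (belast a w))).
have tau2 b x : \sum_(p <- tau b) rho p.2 *: (rho p.1 *: f x) =
                (rho b *: f x) *+ size (tau b).
  rewrite -(tau_mul b (fun c => rho c *: f x)); apply: eq_bigr => p _.
  by rewrite rhoM -scalerA scaleCA.
rewrite !tau2; zmodule.
Qed.

End EulerHomotopy.

(** * Harrison cochains on words *)

Section Predicates.
Variables (L : eqType) (K : comNzRingType) (M : lmodType K).
Implicit Types (a b : L) (u v w : seq L) (f g : seq L -> M).

Definition supported (q : nat) f := forall w, size w != q -> f w = 0.

Definition harrison f :=
  forall u v, u != [::] -> v != [::] -> sh u f v = 0.

Definition normalized (one : L) f := forall w, one \in w -> f w = 0.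

(** [deg] is a degree on letters, [gr j] the part of degree [j] of [M]; [f]
raises degrees by [t]. *)
Definition homogeneous (gr : int -> M -> Prop) (deg : L -> int) t f :=
  forall w, gr (t + \sum_(a <- w) deg a) (f w).

Lemma prep_eq0 a f : (forall w, f (a :: w) = 0) -> prep a f = fun=> 0.
Proof. by move=> h; apply: funext. Qed.

Lemma supported_prep q a f : supported q.+1 f -> supported q (prep a f).
Proof. by move=> sf w; rewrite -eqSS => /(sf (a :: w)). Qed.

Lemma supported0_prep a f : supported 0 f -> prep a f = fun=> 0.
Proof. by move=> sf; apply: prep_eq0 => w; apply: sf. Qed.

Lemma normalized_prep one a f : normalized one f -> normalized one (prep a f).
Proof. by move=> nf w ow; apply: nf; rewrite inE ow orbT. Qed.

Lemma normalized_prep1 one f : normalized one f -> prep one f = fun=> 0.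
Proof. by move=> nf; apply: prep_eq0 => w; apply: nf; rewrite mem_head. Qed.

Lemma homogeneous_prep gr deg t a f :
  homogeneous gr deg t f -> homogeneous gr deg (t + deg a) (prep a f).
Proof. by move=> hf w; have := hf (a :: w); rewrite big_cons addrA. Qed.

Lemma sh_perm u f v :
  (forall w, perm_eq w (u ++ v) -> f w = 0) -> sh u f v = 0.
Proof.
elim: u f v => [|a u IHu] f v hf; first by rewrite sh0l hf.
elim: v f hf => [|b v IHv] f hf; first by rewrite sh0r hf // cats0.
rewrite sh_cons IHu => [|w pw]; last by rewrite /prep hf // perm_cons.
rewrite IHv ?scaler0 ?addr0 // => w pw; apply: hf.
by rewrite -[b :: v]cat1s perm_sym perm_catCA perm_sym perm_cons.
Qed.

Lemma sh_perm_eq u f g v :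
  (forall w, perm_eq w (u ++ v) -> f w = g w) -> sh u f v = sh u g v.
Proof.
move=> h; apply/subr0_eq; rewrite -(opB (sh_lin _ _)).
by apply: sh_perm => w pw; rewrite h // subrr.
Qed.

Section Marked.
Variables (Y : eqType) (tau : L -> seq (Y * L)).

Inductive marked : seq L -> Y -> seq L -> Prop :=
| marked_head a y a' w : (y, a') \in tau a -> marked (a :: w) y (a' :: w)
| marked_tail a w y x : marked w y x -> marked (a :: w) y (a :: x).

Lemma mark_ext_in (h1 h2 : Y -> seq L -> M) w :
  (forall y x, marked w y x -> h1 y x = h2 y x) -> mark tau h1 w = mark tau h2 w.
Proof.
elim: w h1 h2 => [|a w IH] h1 h2 eqh //=; congr (_ + _).
  rewrite big_seq_cond [RHS]big_seq_cond; apply: eq_bigr => -[y b].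
  by rewrite andbT => /= yb; apply: eqh; apply: marked_head.
by apply: IH => y x mx; apply: eqh; apply: marked_tail.
Qed.

Lemma mark_eq0 (h : Y -> seq L -> M) w :
  (forall y x, marked w y x -> h y x = 0) -> mark tau h w = 0.
Proof.
move=> h0; rewrite (@mark_ext_in _ (fun _ _ => 0)) // => {h0}.
by elim: w => //= a w ->; rewrite big1 ?addr0.
Qed.

Lemma mark_closed (Q : M -> Prop) (h : Y -> seq L -> M) w :
  Q 0 -> (forall x y, Q x -> Q y -> Q (x + y)) ->
  (forall y x, marked w y x -> Q (h y x)) -> Q (mark tau h w).
Proof.
move=> Q0 QD; elim: w h => [|a w IH] h Qh //=; apply: (QD).
  rewrite big_seq_cond; apply: (big_ind Q) => // -[y b] /=.
  by rewrite andbT => yb; apply: Qh; apply: marked_head.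
by apply: IH => y x mx; apply: Qh; apply: marked_tail.
Qed.

Lemma marked_size w y x : marked w y x -> size x = size w.
Proof. by elim=> {w y x} // a w y x _ /= ->. Qed.

End Marked.

Section Differential.
Variables (mul : L -> L -> L) (one : L) (rho : L -> K).
Hypothesis mulC : commutative mul.
Hypothesis mul1 : left_id one mul.
Hypothesis rho1 : rho one = 1.

Local Notation d := (hoch mul rho).

Lemma hoch_supported q f : supported q f -> supported q.+1 (d f).
Proof.
move=> sf w; elim: w q f sf => [|a w IH] q f sf // sw.
rewrite hoch_cons.
have -> : hoch_comm mul rho a f w = 0.
  case: w sw {IH} => [|b w] //= sw.
  by rewrite !sf ?scaler0 ?subr0 ?addr0 // -eqSS.
case: q sf sw => [|q] sf sw.
  by rewrite supported0_prep // (op0 (hoch_lin _ _ _)) subr0.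
by rewrite (IH q) ?subr0 //; apply: supported_prep.
Qed.

Lemma hoch_normalized f : normalized one f -> normalized one (d f).
Proof.
move=> nf w; elim: w f nf => [|a w IH] f nf // ow; rewrite hoch_cons.
have [ow'|now'] := boolP (one \in w).
  rewrite IH ?subr0 //; last exact: normalized_prep.
  case: w ow' {IH ow} => [|b w] //; rewrite inE => /orP[/eqP <-|ow] /=.
    rewrite rho1 scale1r mulC mul1 nf ?scaler0 ?add0r ?subrr //.
    by rewrite mem_head.
  by rewrite !nf ?scaler0 ?addr0 ?subr0 // inE ow orbT.
have/eqP <- : one == a by move: ow; rewrite inE (negPf now') orbF.
rewrite normalized_prep1 // (op0 (hoch_lin _ _ _)) subr0.
case: w {IH ow now'} => [|b w] //=.
rewrite mul1 rho1 scale1r [f (one :: w)]nf ?mem_head // scaler0 addr0 subrr //.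
Qed.

Lemma hoch_harrison f : harrison f -> harrison (d f).
Proof.
move=> hf u v u0 v0; rewrite (hoch_derivation rho mulC).
have hoch0 (x : seq L) g : (forall z, z != [::] -> g z = 0) -> d g x = 0.
  case: x => [|a x] // g0; rewrite hoch_cons.
  rewrite prep_eq0 ?(op0 (hoch_lin _ _ _)) ?subr0 => [|z]; last exact: g0.
  by case: x => [|b x] //=; rewrite !g0 // !scaler0 addr0 subr0.
by rewrite !hoch0 ?scaler0 ?addr0 // => z z0; apply: hf.
Qed.

End Differential.
End Predicates.

(** * Harrison cohomology of a free commutative monoid *)

Section FreeMonoid.
Variables (L : eqType) (mul : L -> L -> L) (one : L).
Variables (K : comNzRingType) (rho : L -> K) (M : lmodType K).
Variable tau : L -> seq (L * L).
Implicit Types (a b : L) (u v w : seq L) (f g : seq L -> M).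

Hypothesis mulC : commutative mul.
Hypothesis mul1 : left_id one mul.
Hypothesis rho1 : rho one = 1.
Hypothesis rhoM : forall a b, rho (mul a b) = rho a * rho b.

Hypothesis tauM : forall a b (F : L -> L -> M),
  \sum_(p <- tau (mul a b)) F p.1 p.2 =
  \sum_(p <- tau a) F p.1 (mul p.2 b) + \sum_(p <- tau b) F p.1 (mul a p.2).
Hypothesis tau_size : forall a b,
  size (tau (mul a b)) = (size (tau a) + size (tau b))%N.
Hypothesis tau_mul : forall a y a', (y, a') \in tau a -> mul y a' = a.
Hypothesis tau_marked : forall a y a',
  (y, a') \in tau a -> size (tau a) = (size (tau a')).+1.
Hypothesis tau_nil : forall a, (tau a == [::]) = (a == one).

Variable qinv : nat -> K.
Hypothesis qinvP : forall n, n.+1%:R * qinv n.+1 = 1.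

Variables (gr : int -> M -> Prop) (deg : L -> int).
Hypothesis gr0 : forall j, gr j 0.
Hypothesis grD : forall j x y, gr j x -> gr j y -> gr j (x + y).
Hypothesis grN : forall j x, gr j x -> gr j (- x).
Hypothesis gr_q : forall j n x, gr j x -> gr j (qinv n *: x).
Hypothesis gr_rho : forall j a x, gr j x -> gr (j + deg a) (rho a *: x).
Hypothesis degM : forall a b, deg (mul a b) = deg a + deg b.

Local Notation d := (hoch mul rho).
Local Notation weight := (weight tau).
Local Notation euler := (euler rho tau).

Lemma marked_weight w y x : marked tau w y x -> weight w = (weight x).+1.
Proof.
elim=> {w y x} [a y a' w /tau_marked|a w y x _ IH]; rewrite /weight /=.
  by move=> ->.
by rewrite -/(weight w) IH addnS.
Qed.

Lemma marked_deg w y x : marked tau w y x ->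
  \sum_(a <- w) deg a = deg y + \sum_(a <- x) deg a.
Proof.
elim=> {w y x} [a y a' w /tau_mul <-|a w y x _ IH]; rewrite !big_cons.
  by rewrite degM addrA.
by rewrite IH addrCA.
Qed.

Lemma marked_one w y x : marked tau w y x -> one \in w -> one \in x.
Proof.
elim=> {w y x} [a y a' w ya|a w y x _ IH]; rewrite !inE.
  case/orP=> [/eqP oa|->]; last by rewrite orbT.
  by move: ya; rewrite -oa (eqP (_ : tau one == [::])) // tau_nil.
by case/orP=> [->//|/IH ->]; rewrite orbT.
Qed.

Lemma weight0 w : weight w = 0%N -> w = nseq (size w) one.
Proof.
elim: w => [|a w IH] //= /eqP; rewrite addn_eq0 => /andP[a0 /eqP/IH {1}->].
by congr (_ :: _); apply/eqP; rewrite -tau_nil -size_eq0.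
Qed.

Lemma perm_weight w1 w2 : perm_eq w1 w2 -> weight w1 = weight w2.
Proof. by move=> p12; apply/perm_sumn/perm_map. Qed.

Lemma natr_inj n (x : M) : x *+ n.+1 = 0 -> x = 0.
Proof.
move=> xn; rewrite -[x]scale1r -(qinvP n) mulrC -scalerA scaler_nat xn.
by rewrite scaler0.
Qed.

(** The counter [k] bounds the weight, which a mark lowers by one. *)
Fixpoint einv_rec k f w : M :=
  if k is k'.+1 then
    qinv (weight w) *: (f w + mark tau (fun y x => rho y *: einv_rec k' f x) w)
  else 0.

Definition einv f w := einv_rec (weight w) f w.

Lemma einvE f w n : weight w = n.+1 ->
  einv f w = qinv n.+1 *: (f w + mark tau (fun y x => rho y *: einv f x) w).
Proof.
move=> wn; rewrite /einv wn /= wn; congr (_ *: (_ + _)).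
by apply: mark_ext_in => y x /marked_weight; rewrite wn => -[->].
Qed.

Lemma eulerK f w : (weight w = 0%N -> f w = 0) -> euler (einv f) w = f w.
Proof.
move=> f0; rewrite /euler; case wn : (weight w) => [|n].
  rewrite mulr0n f0 // mark_eq0 ?subrr // => y x /marked_weight.
  by rewrite wn.
rewrite (einvE f wn) -scaler_nat scalerA qinvP scale1r addrK //.
Qed.

Lemma euler_inj f w :
  (forall w, weight w = 0%N -> f w = 0) -> (forall w, euler f w = 0) -> f w = 0.
Proof.
move=> f0 ef0; move wn : (weight w) => n; elim: n w wn => [|n IH] w wn.
  exact: f0.
apply: (@natr_inj n); have := ef0 w; rewrite /euler wn mark_eq0 ?subr0 // => y x.
by move=> /marked_weight; rewrite wn => -[/esym/IH ->]; rewrite scaler0.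
Qed.

Lemma einv_supported q f : supported q f -> supported q (einv f).
Proof.
move=> sf w; rewrite /einv; elim: (weight w) {-2}w => //= k IH x sx.
rewrite sf // mark_eq0 ?addr0 ?scaler0 // => y z xz.
by rewrite IH ?scaler0 ?(marked_size xz).
Qed.

Lemma einv_normalized f : normalized one f -> normalized one (einv f).
Proof.
move=> nf w; rewrite /einv; elim: (weight w) {-2}w => //= k IH x ox.
rewrite nf // mark_eq0 ?addr0 ?scaler0 // => y z xz.
by rewrite IH ?scaler0 ?(marked_one xz).
Qed.

Lemma einv_homogeneous t f : homogeneous gr deg t f -> homogeneous gr deg t (einv f).
Proof.
move=> hf w; rewrite /einv; elim: (weight w) {-2}w => //= k IH x.
apply/gr_q/grD => //; apply: mark_closed => [//||y z xz]; first exact: grD.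
by rewrite (marked_deg xz) addrCA addrC; apply: gr_rho.
Qed.

(** By induction on the weight: after multiplication by the weight, the value on a
shuffle product is a sum of values on shuffle products of smaller weight. *)
Lemma einv_harrison f :
  (forall w, weight w = 0%N -> f w = 0) -> harrison f -> harrison (einv f).
Proof.
move=> f0 hf u v; move wn : (weight (u ++ v)) => n.
elim: n u v wn => [|n IH] u v wn u0 v0.
  by apply: sh_perm => w /perm_weight; rewrite wn /einv => ->.
apply: (@natr_inj n); rewrite -wn.
have -> : sh u (einv f) v *+ weight (u ++ v) =
          sh u (fun w => einv f w *+ weight w) v.
  rewrite -scaler_nat -(opZ (sh_lin _ _)); apply: sh_perm_eq => w /perm_weight <-.
  by rewrite scaler_nat.
have -> : (fun w => einv f w *+ weight w) =
    fun w => f w + mark tau (fun y x => rho y *: einv f x) w.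
  apply: funext => w; rewrite -[f w]eulerK //; last exact: f0.
  by rewrite /euler subrK.
rewrite (opD (sh_lin _ _)) hf // add0r mark_derivation.
rewrite !mark_eq0 ?addr0 // => y x mx; rewrite (opZ (sh_lin _ _)) IH ?scaler0 //.
- move: wn; rewrite /weight !map_cat !sumn_cat -!/(weight _).
  by rewrite (marked_weight mx) addnS => -[].
- by move: v0; rewrite -!size_eq0 (marked_size mx).
- move: wn; rewrite /weight !map_cat !sumn_cat -!/(weight _).
  by rewrite (marked_weight mx) addSn => -[].
by move: u0; rewrite -!size_eq0 (marked_size mx).
Qed.

Lemma insert_supported q f : supported q.+1 f -> supported q (insert tau f).
Proof.
suff H p (g : seq L -> M) w : supported p g -> (size w).+1 != p ->
    insert tau g w = 0.
  by move=> sf w sw; apply: (H q.+1).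
elim: w p g => [|a w IH] p g sg //= sw.
rewrite -[X in X - _]/(mark tau (fun y => prep y g) (a :: w)).
rewrite mark_eq0 ?sub0r => [|y x mx]; last first.
  by rewrite /prep sg //= (marked_size mx).
case: p sg sw => [|p] sg sw.
  by rewrite supported0_prep // (op0 (insert_lin _ _)) oppr0.
by rewrite (IH p) ?oppr0 //; apply: supported_prep.
Qed.

Lemma insert_normalized f : normalized one f -> normalized one (insert tau f).
Proof.
move=> nf w; elim: w f nf => [|a w IH] f nf // ow.
rewrite -[insert _ _ _]/(mark tau (fun y => prep y f) (a :: w)
                         - insert tau (prep a f) w).
rewrite mark_eq0 ?sub0r => [|y x mx]; last first.
  by rewrite /prep nf // inE (marked_one mx) ?orbT.
have [ow'|now'] := boolP (one \in w).
  by rewrite IH ?oppr0 //; apply: normalized_prep.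
have/eqP <- : one == a by move: ow; rewrite inE (negPf now') orbF.
by rewrite normalized_prep1 // (op0 (insert_lin _ _)) oppr0.
Qed.

Lemma insert_homogeneous t f :
  homogeneous gr deg t f -> homogeneous gr deg t (insert tau f).
Proof.
move=> hf w; elim: w t f hf => [|a w IH] t f hf; first exact: gr0.
rewrite -[insert _ _ _]/(mark tau (fun y => prep y f) (a :: w)
                         - insert tau (prep a f) w).
apply: grD; last first.
  apply: grN; rewrite big_cons addrA; apply: (IH (t + deg a)).
  exact: homogeneous_prep.
apply: mark_closed => [//||y x mx]; first exact: grD.
by rewrite (marked_deg mx); have := hf (y :: x); rewrite big_cons.
Qed.

Lemma insert_harrison f : harrison f -> harrison (insert tau f).
Proof.
move=> hf u v u0 v0; rewrite insert_derivation.
have ins0 (x : seq L) g : (forall z, z != [::] -> g z = 0) -> insert tau g x = 0.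
  elim: x g => [|a x IH] g g0 //.
  rewrite -[insert _ _ _]/(mark tau (fun y => prep y g) (a :: x)
                           - insert tau (prep a g) x).
  rewrite mark_eq0 => [|y z _]; last exact: g0.
  by rewrite IH ?subrr // => z _; apply: g0.
rewrite !ins0 ?scaler0 ?addr0 // => z z0; exact: hf.
Qed.

(** The last letter only contributes shuffles of a one-letter word. *)
Lemma right_end_harrison q f w :
  harrison f -> supported q.+2 f -> right_end rho tau f w = 0.
Proof.
move=> hf sf; case: w => [|a [|b w]] //=; rewrite big1 ?scaler0 // => p _.
  by rewrite sh0r sf ?scaler0.
by rewrite hf ?scaler0.
Qed.

(** The Harrison complex of a free commutative monoid is exact in degrees at
least two: on Harrison cocycles the Euler operator is a coboundary, and it is
invertible because the weights are invertible. *)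
Lemma harrison_exact q t f :
  supported q.+2 f -> normalized one f -> harrison f -> homogeneous gr deg t f ->
  (forall w, d f w = 0) ->
  exists g, [/\ supported q.+1 g, normalized one g, harrison g,
                homogeneous gr deg t g & forall w, d g w = f w].
Proof.
move=> sf nf hf gf df; pose g0 w := - insert tau f w.
have sg0 : supported q.+1 g0.
  by move=> w sw; rewrite /g0 (insert_supported sf) ?oppr0.
have ng0 : normalized one g0.
  by move=> w ow; rewrite /g0 insert_normalized ?oppr0.
have hg0 : harrison g0.
  by move=> u v u0 v0; rewrite (opN (sh_lin _ _)) insert_harrison ?oppr0.
have gg0 : homogeneous gr deg t g0.
  by move=> w; apply: grN; apply: insert_homogeneous.
have w0 p (h : seq L -> M) w : supported p.+1 h -> normalized one h ->
    weight w = 0%N -> h w = 0.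
  move=> sh nh /weight0; case: w => [|a w] wE; first exact: sh.
  by apply: nh; rewrite wE mem_head.
exists (einv g0); split.
- exact: einv_supported.
- exact: einv_normalized.
- by apply: einv_harrison => // w; apply: w0 sg0 ng0.
- exact: einv_homogeneous.
move=> w; apply/subr0_eq; pose h w := d (einv g0) w - f w.
rewrite -/(h w); apply: euler_inj => {}w.
  apply: (@w0 q.+1).
    move=> x sx; rewrite /h sf // subr0.
    by apply: hoch_supported sx; apply: einv_supported.
  move=> x ox; rewrite /h nf // subr0.
  by apply: hoch_normalized ox => //; apply: einv_normalized.
have -> : euler h w = euler (d (einv g0)) w - euler f w.
  rewrite /euler /h mulrnBl.
  have -> : mark tau (fun y x => rho y *: (d (einv g0) x - f x)) w =
     mark tau (fun y x => rho y *: d (einv g0) x) w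
     - mark tau (fun y x => rho y *: f x) w.
    rewrite -[- mark _ _ w]scaleN1r -markZ -markD; apply: mark_ext => y x _.
    by rewrite scalerBr scaleN1r.
  zmodule.
have tau_mulE a (F : L -> M) :
    \sum_(p <- tau a) F (mul p.1 p.2) = F a *+ size (tau a).
  rewrite big_seq (eq_bigr (fun=> F a)) => [|[y b] /tau_mul /= ->//].
  rewrite -big_seq; elim: (tau a) => [|p s IHs]; first by rewrite big_nil.
  by rewrite big_cons IHs mulrS.
rewrite -(hoch_euler rhoM tauM tau_size tau_mulE).
have -> : euler (einv g0) = g0.
  by apply: funext => x; apply: eulerK; apply: w0 sg0 ng0.
have := insert_homotopy rho mulC tauM tau_mulE f w.
rewrite (right_end_harrison w hf sf) sub0r.
have -> : d f = fun=> 0 by apply: funext.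
rewrite (op0 (insert_lin _ _)) addr0 /g0 (opN (hoch_lin _ _ _)) => ->.
by rewrite opprK subrr.
Qed.

End FreeMonoid.

(** * Monomials *)

Section Monomials.
Variable X : choiceType.
Implicit Types (m : {cmonom X}) (x : X).

(** The ways of splitting off one variable from a monomial, with multiplicity: the
formal derivative. *)
Definition cm_split m : seq ({cmonom X} * {cmonom X}) :=
  flatten [seq nseq (m x) (ucm x, divcm m (ucm x)) | x <- finsupp m].

Lemma sum_cm_split (V : zmodType) m (D : {fset X})
    (F : {cmonom X} -> {cmonom X} -> V) : (finsupp m `<=` D)%fset ->
  \sum_(p <- cm_split m) F p.1 p.2 =
  \sum_(x <- D) F (ucm x) (divcm m (ucm x)) *+ m x.
Proof.
move=> sD; rewrite /cm_split big_flatten big_map /=.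
rewrite -(big_fset_incl _ sD) /= => [|x _]; last first.
  by rewrite -cmE_neq0 negbK => /eqP ->; rewrite mulr0n.
apply: eq_bigr => x _; move: (divcm m (ucm x)) => c.
elim: (m x) => [|n IH]; first by rewrite big_nil.
by rewrite big_cons IH mulrS.
Qed.

Lemma divcmMl m1 m2 x : (0 < m1 x)%N ->
  divcm (mmul m1 m2) (ucm x) = mmul (divcm m1 (ucm x)) m2.
Proof.
move=> m1x; apply/eqP/cmP => y; rewrite divcmE !cmM divcmE ucmE.
by have [<-|_] := eqVneq x y; rewrite ?subn0 // addnBAC.
Qed.

Lemma mul_ucm_div m x : (0 < m x)%N -> mmul (ucm x) (divcm m (ucm x)) = m.
Proof.
move=> mx; apply/eqP/cmP => y; rewrite cmM divcmE ucmE.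
by have [<-|_] := eqVneq x y; rewrite ?subn0 // subnKC.
Qed.

Lemma cm_splitM (V : zmodType) m1 m2 (F : {cmonom X} -> {cmonom X} -> V) :
  \sum_(p <- cm_split (mmul m1 m2)) F p.1 p.2 =
  \sum_(p <- cm_split m1) F p.1 (mmul p.2 m2)
  + \sum_(p <- cm_split m2) F p.1 (mmul m1 p.2).
Proof.
pose D := (finsupp m1 `|` finsupp m2)%fset.
rewrite (@sum_cm_split _ _ D) ?mdomD //.
rewrite (@sum_cm_split _ _ D (fun a b => F a (mmul b m2))) ?fsubsetUl //.
rewrite (@sum_cm_split _ _ D (fun a b => F a (mmul m1 b))) ?fsubsetUr //.
rewrite -big_split /=; apply: eq_bigr => x _; rewrite cmM mulrnDr.
congr (_ + _).
  by case m1x: (m1 x) => [|n]; rewrite ?mulr0n // divcmMl // m1x.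
case m2x: (m2 x) => [|n]; rewrite ?mulr0n //.
by rewrite mulmC divcmMl ?m2x // mulmC.
Qed.

Lemma size_cm_split m : size (cm_split m) = mdeg m.
Proof.
rewrite /cm_split size_flatten /shape -map_comp mdegE sumnE big_map.
by apply: eq_bigr => x _ /=; rewrite size_nseq.
Qed.

Lemma cm_splitP m a b : (a, b) \in cm_split m ->
  exists2 x, (0 < m x)%N & a = ucm x /\ b = divcm m (ucm x).
Proof.
case/flattenP => s /mapP[x xm ->] /nseqP[[-> ->] mx].
by exists x.
Qed.

Lemma cm_split_mul m a b : (a, b) \in cm_split m -> mmul a b = m.
Proof. by case/cm_splitP=> x mx [-> ->]; apply: mul_ucm_div. Qed.

Lemma cm_split_size m a b : (a, b) \in cm_split m ->
  size (cm_split m) = (size (cm_split b)).+1.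
Proof.
move=> ab; rewrite !size_cm_split -{1}(cm_split_mul ab) mdegM.
by case/cm_splitP: ab => x _ [-> _]; rewrite mdegU.
Qed.

Lemma cm_split_nil m : (cm_split m == [::]) = (m == mone).
Proof. by rewrite -size_eq0 size_cm_split mdeg_eq0. Qed.

Definition wdeg (wt : X -> int) m : int := \sum_(x <- finsupp m) wt x *+ m x.

Lemma wdegE wt m (D : {fset X}) : (finsupp m `<=` D)%fset ->
  wdeg wt m = \sum_(x <- D) wt x *+ m x.
Proof.
move=> sD; rewrite /wdeg (big_fset_incl _ sD) // => x _.
by rewrite -cmE_neq0 negbK => /eqP ->; rewrite mulr0n.
Qed.

Lemma wdegM wt m1 m2 : wdeg wt (mmul m1 m2) = wdeg wt m1 + wdeg wt m2.
Proof.
pose D := (finsupp m1 `|` finsupp m2)%fset.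
rewrite !(@wdegE _ _ D) ?mdomD ?fsubsetUl ?fsubsetUr // -big_split /=.
by apply: eq_bigr => x _; rewrite cmM mulrnDr.
Qed.

Lemma wdeg1 wt : wdeg wt mone = 0.
Proof. by rewrite /wdeg mdom1 big_nil. Qed.

End Monomials.

Section LetterMaps.
Variables (L L' : Type) (h : L -> L') (K : comNzRingType) (M : lmodType K).
Implicit Types (f : seq L' -> M).

Lemma sh_map u f v : sh u (fun w => f (map h w)) v = sh (map h u) f (map h v).
Proof.
elim: u f v => [|a u IHu] f v //; elim: v f => [|b v IHv] f //.
rewrite /= !sh_cons size_map -(IHv (prep (h b) f)) -[h b :: _]/(map h (b :: v)).
by rewrite -(IHu (prep (h a) f)).
Qed.

Lemma hoch_map mul mul' (rho : L -> K) (rho' : L' -> K) f w :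
  (forall a b, h (mul a b) = mul' (h a) (h b)) ->
  (forall a, rho a = rho' (h a)) ->
  hoch mul rho (fun w => f (map h w)) w = hoch mul' rho' f (map h w).
Proof.
move=> hM hrho; elim: w f => [|a w IH] f //.
rewrite map_cons !hoch_cons -(IH (prep (h a) f)); congr (_ - _).
by case: w {IH} => [|b w] //=; rewrite hM !hrho.
Qed.

End LetterMaps.

(** * Gradings and multilinear maps *)

(** Degrees on the base ring, the algebra and the module of coefficients. The
ungraded theory is the case in which every element has every degree. *)
Record degrees (P : comNzRingType) (A : comAlgType P) (M : lmodType A) := Degrees {
  inP : int -> P -> Prop;
  inA : int -> A -> Prop;
  inM : int -> M -> Prop;
  quo : nat -> P;
  inP0 : forall j, inP j 0;
  inP1 : inP 0 1;
  inM0 : forall j, inM j 0;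
  inMD : forall j x y, inM j x -> inM j y -> inM j (x + y);
  inMN : forall j x, inM j x -> inM j (- x);
  inAM : forall i j a x, inA i a -> inM j x -> inM (i + j) (a *: x);
  inPA : forall i p, inP i p -> inA i p%:A;
  quoP : forall n, n.+1%:R * quo n.+1 = 1;
  in_quo : forall n, inP 0 (quo n)
}.

(** The letters of [w] have degrees that add up to [j]. *)
Fixpoint in_word (U : Type) (hU : int -> U -> Prop) (w : seq U) (j : int) : Prop :=
  if w is a :: w' then exists2 i, hU i a & in_word hU w' (j - i) else j = 0.

(** A homogeneous basis, with finitely supported coordinates. *)
Record gbasis (P : comNzRingType) (hP : int -> P -> Prop) (U : lmodType P)
    (hU : int -> U -> Prop) := GBasis {
  bI : choiceType;
  bE : bI -> U;
  bco : U -> bI -> P;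
  bsupp : U -> seq bI;
  bdeg : bI -> int;
  bco_lin : forall p x y i, bco (p *: x + y) i = p * bco x i + bco y i;
  bsupp_uniq : forall x, uniq (bsupp x);
  bco_out : forall x i, i \notin bsupp x -> bco x i = 0;
  bcoE : forall i j, bco (bE i) j = (i == j)%:R;
  bexpand : forall x, x = \sum_(i <- bsupp x) bco x i *: bE i;
  bE_hom : forall i, hU (bdeg i) (bE i);
  bco_hom : forall j x i, hU j x -> hP (j - bdeg i) (bco x i)
}.

Section Multilinear.
Variables (P : comNzRingType) (A : comAlgType P) (M : lmodType A).

Definition linear_map (U : lmodType P) (g : U -> M) : Prop :=
  forall p x y, g (p *: x + y) = p%:A *: g x + g y.

Definition multilin (U : lmodType P) (f : seq U -> M) : Prop :=
  forall u v, linear_map (fun x => f (u ++ x :: v)).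

Lemma linear_map_sum (U : lmodType P) (g : U -> M) (I : Type) (s : seq I)
    (c : I -> P) (x : I -> U) : linear_map g ->
  g (\sum_(i <- s) c i *: x i) = \sum_(i <- s) (c i)%:A *: g (x i).
Proof.
move=> gl; have g0 : g 0 = 0.
  have := gl 1 0 0; rewrite scaler0 addr0 scale1r scale1r.
  by move/eqP; rewrite -subr_eq0 opprD addrA subrr add0r oppr_eq0 => /eqP.
by elim: s => [|i s IH]; rewrite ?big_nil // !big_cons gl IH.
Qed.

Lemma linear_comb (U : lmodType P) (g h : U -> M) (a : A) :
  linear_map g -> linear_map h -> linear_map (fun x => a *: g x + h x).
Proof.
move=> gl hl p x y; rewrite gl hl !scalerDr [a *: (p%:A *: _)]scaleCA.
zmodule.
Qed.

Lemma multilin_prep (U : lmodType P) (f : seq U -> M) a :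
  multilin f -> multilin (prep a f).
Proof. by move=> fl u; apply: (fl (a :: u)). Qed.

Lemma multilin_comb (U : lmodType P) (f g : seq U -> M) a :
  multilin f -> multilin g -> multilin (fun w => a *: f w + g w).
Proof. by move=> fl gl u v; apply: linear_comb. Qed.

Lemma prep_lin (U : lmodType P) (f : seq U -> M) p x y : multilin f ->
  prep (p *: x + y) f = fun w => p%:A *: prep x f w + prep y f w.
Proof. by move=> fl; apply: funext => w; rewrite /prep (fl [::]). Qed.

Lemma sh_multilin_l (U : lmodType P) (f : seq U -> M) v :
  multilin f -> multilin (fun u => sh u f v).
Proof.
move=> + u1 u2 p x y; elim: u1 f v => [|a u1 IHu] f v fl /=.
  elim: v f fl => [|b v IHv] f fl; first by rewrite !sh0r (fl [::]).
  rewrite !sh_cons (IHv (prep b f)); last exact: multilin_prep.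
  rewrite (prep_lin _ _ _ fl) (sh_lin u2 (b :: v)) !scalerDr.
  rewrite [_ *: (p%:A *: _)]scaleCA; zmodule.
elim: v f fl => [|b v IHv] f fl; first by rewrite !sh0r (fl (a :: u1)).
rewrite !sh_cons (IHu (prep a f)); last exact: multilin_prep.
rewrite (IHv (prep b f)); last exact: multilin_prep.
rewrite !size_cat /= !scalerDr [_ *: (p%:A *: _)]scaleCA; zmodule.
Qed.

Lemma sh_multilin_r (U : lmodType P) (f : seq U -> M) u :
  multilin f -> multilin (fun v => sh u f v).
Proof.
move=> + v1 v2 p x y; elim: u f v1 => [|a u IHu] f v1 fl /=.
  by rewrite !sh0l fl.
elim: v1 f fl => [|b v1 IHv] f fl /=.
  rewrite !sh_cons (IHu (prep a f) [::]); last exact: multilin_prep.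
  rewrite (prep_lin _ _ _ fl) (sh_lin (a :: u) v2) !scalerDr.
  rewrite [_ *: (p%:A *: _)]scaleCA; zmodule.
rewrite !sh_cons (IHu (prep a f) (b :: v1)); last exact: multilin_prep.
rewrite (IHv (prep b f)); last exact: multilin_prep.
rewrite !scalerDr [_ *: (p%:A *: _)]scaleCA; zmodule.
Qed.

Lemma hoch_multilin (U : comAlgType P) (rho : U -> A) (f : seq U -> M) :
  (forall p x y, rho (p *: x + y) = p *: rho x + rho y) ->
  multilin f -> multilin (hoch *%R rho f).
Proof.
move=> rl + u v p x y; have rho_lin z : rho (p *: x + y) *: z =
    p%:A *: (rho x *: z) + rho y *: z.
  by rewrite rl scalerDl scalerA -scalerAl mul1r.
elim: u f => [|a u IH] f fl /=.
  rewrite -![rho _ *: f v - _]/(hoch _ _ _ (_ :: v)) !hoch_cons.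
  rewrite (prep_lin _ _ _ fl) (hoch_lin _ _ v).
  case: v => [|b v] /=; first by rewrite !sub0r scalerN; zmodule.
  rewrite rho_lin (fl [::]) mulrDl -scalerAl (fl [::]) !scalerBr !scalerDr.
  rewrite [rho b *: (p%:A *: _)]scaleCA /=; zmodule.
rewrite -![rho a *: _ - _]/(hoch _ _ _ (a :: _)) !hoch_cons.
rewrite (IH (prep a f)); last exact: multilin_prep.
have -> : hoch_comm *%R rho a f (u ++ (p *: x + y) :: v) =
    p%:A *: hoch_comm *%R rho a f (u ++ x :: v) + hoch_comm *%R rho a f (u ++ y :: v).
  case: u {IH} => [|b u] /=.
    rewrite rho_lin (fl [::]) mulrDr -scalerAr (fl [::]) !scalerBr !scalerDr.
    rewrite [rho a *: (p%:A *: _)]scaleCA /=; zmodule.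
  rewrite (fl (b :: u)) (fl (a :: u)) (fl (a * b :: u)) /= !scalerBr !scalerDr.
  rewrite ![rho _ *: (p%:A *: _)]scaleCA; zmodule.
rewrite scalerBr; zmodule.
Qed.

Section Extension.
Variables (hP : int -> P -> Prop) (U : lmodType P) (hU : int -> U -> Prop).
Variable B : gbasis hP hU.
Local Notation I := (bI B).

(** The linear extension of a map given on a basis, and below its multilinear
version. *)
Definition bext (phi : I -> M) (x : U) : M :=
  \sum_(i <- bsupp B x) (bco x i)%:A *: phi i.

Lemma bext_big phi x s : uniq s -> {subset bsupp B x <= s} ->
  bext phi x = \sum_(i <- s) (bco x i)%:A *: phi i.
Proof.
move=> us xs; rewrite [RHS](bigID [in bsupp B x]) /= [X in _ + X]big1 ?addr0.
  rewrite -big_filter; apply: perm_big.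
  apply: uniq_perm; rewrite ?filter_uniq ?bsupp_uniq // => i.
  by rewrite mem_filter; case: (boolP (i \in bsupp B x)) => // /xs ->.
by move=> i /bco_out ->; rewrite scale0r scale0r.
Qed.

Lemma bext_lin phi : linear_map (bext phi).
Proof.
move=> p x y; pose s := undup (bsupp B (p *: x + y) ++ bsupp B x ++ bsupp B y).
have us : uniq s by apply: undup_uniq.
rewrite !(@bext_big _ _ s) // => [|i ii|i ii|i ii]; last first.
- by rewrite mem_undup !mem_cat ii.
- by rewrite mem_undup !mem_cat ii !orbT.
- by rewrite mem_undup !mem_cat ii !orbT.
rewrite scaler_sumr -big_split /=; apply: eq_bigr => i _.
by rewrite bco_lin scalerDl scalerDl scalerA -scalerAl mul1r scalerA.
Qed.

Lemma bextE phi i : bext phi (bE i) = phi i.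
Proof.
rewrite (@bext_big _ _ (undup (i :: bsupp B (bE i)))) ?undup_uniq //; last first.
  by move=> j jj; rewrite mem_undup inE jj orbT.
rewrite (bigD1_seq i) ?undup_uniq ?mem_undup ?mem_head //= bcoE eqxx !scale1r.
rewrite big1 ?addr0 // => j ji; rewrite bcoE eq_sym (negPf ji).
by rewrite scale0r scale0r.
Qed.

Lemma lin_bext (g : U -> M) x : linear_map g -> g x = bext (fun i => g (bE i)) x.
Proof. by move=> gl; rewrite {1}[x](bexpand B) linear_map_sum. Qed.

Fixpoint mext (F : seq I -> M) (w : seq U) : M :=
  if w is a :: w' then bext (fun i => mext (prep i F) w') a else F [::].

Lemma mext_lin w : oplin (fun F => mext F w).
Proof.
elim: w => [|a w IH] c F G //=.
rewrite /bext scaler_sumr -big_split /=; apply: eq_bigr => i _.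
rewrite (IH c (prep i F) (prep i G)) scalerDr; congr (_ + _).
by rewrite scaleCA.
Qed.

Lemma mext_multilin F : multilin (mext F).
Proof.
move=> u v p x y; elim: u F => [|a u IH] F /=; first exact: bext_lin.
rewrite /bext scaler_sumr -big_split /=; apply: eq_bigr => i _.
by rewrite (IH (prep i F)) scalerDr [_ *: (p%:A *: _)]scaleCA.
Qed.

Lemma mextE F s : mext F (map (@bE _ _ _ _ B) s) = F s.
Proof. by elim: s F => [|i s IH] F //=; rewrite bextE IH. Qed.

Lemma multilin_eq (f g : seq U -> M) : multilin f -> multilin g ->
  (forall s, f (map (@bE _ _ _ _ B) s) = g (map (@bE _ _ _ _ B) s)) -> f =1 g.
Proof.
move=> fl gl fg w; rewrite -[w]/(map (@bE _ _ _ _ B) [::] ++ w).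
elim: w [::] => [|a w IH] s; first by rewrite cats0.
rewrite (lin_bext a (fl _ w)) (lin_bext a (gl _ w)).
apply: eq_bigr => i _; have := IH (rcons s i).
by rewrite map_rcons !cat_rcons => ->.
Qed.

End Extension.
End Multilinear.

(** * Normalized Harrison cochains *)

Section Cochains.
Variables (P : comNzRingType) (A : comAlgType P) (M : lmodType A).
Variable G : degrees M.

Record cochain (U : comAlgType P) (hU : int -> U -> Prop) (q : nat) (e : int)
    (f : seq U -> M) : Prop := Cochain {
  ch_supp : supported q f;
  ch_lin : multilin f;
  ch_norm : normalized 1 f;
  ch_harr : harrison f;
  ch_deg : forall w j, in_word hU w j -> inM G (e + j) (f w)
}.

Lemma cochain0 (U : comAlgType P) hU q e : @cochain U hU q e (fun=> 0).
Proof.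
split=> //; last by move=> *; apply: inM0.
- by move=> u v p x y; rewrite scaler0 addr0.
- by move=> u v _ _; rewrite (op0 (sh_lin _ _)).
Qed.

Lemma cochainB (U : comAlgType P) hU q e f g :
  @cochain U hU q e f -> @cochain U hU q e g ->
  cochain hU q e (fun w => f w - g w).
Proof.
case=> fs fl fn fh fd [gs gl gn gh gd]; split.
- by move=> w sw; rewrite fs // gs // subrr.
- by move=> u v p x y; rewrite fl gl scalerBr; zmodule.
- by move=> w ow; rewrite fn // gn // subrr.
- by move=> u v u0 v0; rewrite (opB (sh_lin _ _)) fh // gh // subrr.
by move=> w j wj; apply: inMD; [apply: fd | apply/inMN/gd].
Qed.

Lemma cochain_sum (U : comAlgType P) hU q e (I : Type) (s : seq I) (F : I -> seq U -> M) :
  (forall i, cochain hU q e (F i)) -> cochain hU q e (fun w => \sum_(i <- s) F i w).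
Proof.
move=> hF; elim: s => [|i s IH].
  by rewrite (_ : (fun=> _) = fun=> 0); [exact: cochain0|apply: funext => w; rewrite big_nil].
have -> : (fun w => \sum_(j <- i :: s) F j w) =
          fun w => F i w - (0 - \sum_(j <- s) F j w).
  by apply: funext => w; rewrite big_cons sub0r opprK.
by do 2?[apply: cochainB => //]; apply: cochain0.
Qed.

Section Ring.
Variables (U : comAlgType P) (hU : int -> U -> Prop) (rho : {lrmorphism U -> A}).
Hypothesis rho_hom : forall j x, hU j x -> inA G j (rho x).
Hypothesis hUM : forall i j x y, hU i x -> hU j y -> hU (i + j) (x * y).

Lemma in_word_homogeneous e (f : seq U -> M) :
  (forall w j, in_word hU w j -> inM G (e + j) (f w)) ->
  forall w j, in_word hU w j -> inM G (e + j) (hoch *%R rho f w).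
Proof.
move=> hf w; elim: w e f hf => [|a w IH] e f hf j; first by move=> _; apply: inM0.
case=> i ai wj; rewrite hoch_cons; apply: inMD; last first.
  apply: inMN; have -> : e + j = (e + i) + (j - i) by ring.
  apply: IH => // x k xk; rewrite /prep -addrA; apply: hf; exists i => //.
  by rewrite addrAC subrr add0r.
case: w wj {IH} => [|b w] /= => [_|[k bk wk]]; first exact: inM0.
apply: inMD; first apply: inMD.
- rewrite (_ : e + j = i + (e + (j - i))); last by ring.
  by apply: inAM; [exact: rho_hom | apply: hf; exists k].
- rewrite (_ : e + j = k + (e + (j - k))); last by ring.
  apply: inAM; [exact: rho_hom | apply: hf; exists i => //].
  by rewrite addrAC.
apply/inMN/hf; exists (i + k); first exact: hUM.
by rewrite opprD addrA.
Qed.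

Lemma cochain_hoch q e f :
  cochain hU q e f -> cochain hU q.+1 e (hoch *%R rho f).
Proof.
case=> fs fl fn fh fd; split.
- exact: hoch_supported.
- by apply: hoch_multilin => // p x y; rewrite linearP.
- by apply: hoch_normalized => //; [exact: mulrC | exact: mul1r | exact: rmorph1].
- by apply: hoch_harrison => //; exact: mulrC.
exact: in_word_homogeneous.
Qed.

End Ring.

Lemma cochain_map (U U' : comAlgType P) hU hU' q e (h : U -> U') f :
  (forall p x y, h (p *: x + y) = p *: h x + h y) -> h 1 = 1 ->
  (forall j x, hU j x -> hU' j (h x)) ->
  cochain hU' q e f -> cochain hU q e (fun w => f (map h w)).
Proof.
move=> hl h1 hh [fs fl fn fh fd]; split.
- by move=> w sw; rewrite fs ?size_map.
- by move=> u v p x y; rewrite !map_cat /= hl fl.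
- by move=> w ow; rewrite fn // -h1 map_f.
- by move=> u v u0 v0; rewrite sh_map fh // -size_eq0 size_map size_eq0.
move=> w j wj; apply: fd; elim: w j wj => [|a w IH] j //= [i ai wi].
by exists i; [exact: hh | exact: IH].
Qed.

Section FreeExtension.
Variables (U : comAlgType P) (hU : int -> U -> Prop) (B : gbasis (inP G) hU).
Variable i1 : bI B.
Hypothesis bE1 : bE i1 = 1 :> U.
Implicit Type F : seq (bI B) -> M.

Lemma mext0 w : mext (B := B) (fun=> 0 : M) w = 0.
Proof. exact: (@op0 _ _ _ (fun F => mext (B := B) F w) (@mext_lin _ _ _ _ _ _ B w)). Qed.

Lemma mext_supported q F : supported q F -> supported q (mext (B := B) F).
Proof.
move=> sF w; elim: w q F sF => [|a w IH] q F sF sw; first exact: sF.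
rewrite /= /bext big1 // => i _; case: q sF sw => [|q] sF sw.
  by rewrite supported0_prep // mext0 scaler0.
by rewrite (IH q) ?scaler0 //; apply: supported_prep.
Qed.

Lemma mext_normalized F : normalized i1 F -> normalized 1 (mext (B := B) F).
Proof.
move=> nF w; elim: w F nF => [|a w IH] F nF //; rewrite inE => /orP[/eqP <-|ow].
  by rewrite /= -bE1 bextE normalized_prep1 // mext0.
rewrite /= /bext big1 // => i _; rewrite IH ?scaler0 //.
exact: normalized_prep.
Qed.

Lemma mext_harrison F : harrison F -> harrison (mext (B := B) F).
Proof.
move=> hF u v u0 v0; pose T u v : M := if (u == [::]) || (v == [::]) then 0
                                        else sh u (mext (B := B) F) v.
have Fl : multilin (mext (B := B) F) by apply: mext_multilin.
suff T0 : T u v = 0 by rewrite -T0 /T (negPf u0) (negPf v0).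
have Tl v1 : multilin (T^~ v1).
  move=> u1 u2 p x y; rewrite /T; have [->|v10] := eqVneq v1 [::].
    by rewrite !orbT scaler0 addr0.
  by rewrite -!size_eq0 !size_cat !addnS /= sh_multilin_l.
have Tr u1 : multilin (T u1).
  move=> v1 v2 p x y; rewrite /T; have [->|u10] := eqVneq u1 [::].
    by rewrite scaler0 addr0.
  by rewrite -!size_eq0 !size_cat !addnS /= sh_multilin_r.
have Z : multilin (fun _ : seq U => 0 : M).
  by move=> *; rewrite /linear_map => *; rewrite scaler0 addr0.
apply: (multilin_eq (B := B) (Tl v) Z) => s; rewrite -/(T _ v).
apply: (multilin_eq (B := B) (Tr _) Z) => s'; rewrite /T.
rewrite -!size_eq0 !size_map !size_eq0; case: eqP => //= /eqP s0.
case: eqP => //= /eqP s'0; rewrite -sh_map.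
have -> : (fun w => mext (B := B) F (map (@bE _ _ _ _ B) w)) = F.
  by apply: funext => w; rewrite mextE.
exact: hF.
Qed.

Lemma mext_deg t F w j : homogeneous (inM G) (@bdeg _ _ _ _ B) t F ->
  in_word hU w j -> inM G (t + j) (mext (B := B) F w).
Proof.
elim: w t F j => [|a w IH] t F j hF /=.
  by move=> ->; have := hF [::]; rewrite big_nil.
case=> k ak wk; rewrite /bext; apply: (big_ind (inM G (t + j))).
- exact: inM0.
- by move=> x y; apply: inMD.
move=> i _; rewrite (_ : t + j = (k - bdeg i) + (t + bdeg i + (j - k))); last by ring.
apply: inAM; first by apply: inPA; apply: bco_hom.
by apply: IH => //; apply: homogeneous_prep.
Qed.

Lemma mext_cochain q e F : supported q F -> normalized i1 F -> harrison F ->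
  homogeneous (inM G) (@bdeg _ _ _ _ B) e F -> cochain hU q e (mext (B := B) F).
Proof.
move=> sF nF hF gF; split; [exact: mext_supported|exact: mext_multilin|
  exact: mext_normalized|exact: mext_harrison|].
by move=> w j; apply: mext_deg.
Qed.

End FreeExtension.

Section Polynomial.
Variables (X : choiceType) (wt : X -> int).
Notation U := (polyalg P X).
Local Notation hU := (poly_homog (inP G) wt).
Variable rho : {lrmorphism U -> A}.
Hypothesis rho_hom : forall j x, hU j x -> inA G j (rho x).

Lemma wdeg_poly (j : int) (x : U) (m : {cmonom X}) :
  hU j x -> inP G (j - wdeg wt m) x@_m.
Proof.
move=> xj; have [/xj//|/mcoeff_outdom ->] := boolP (m \in msupp x).
exact: inP0.
Qed.

Lemma monom_hom m : hU (wdeg wt m) (<< m >> : U).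
Proof.
move=> m'; rewrite msuppU1 in_fset1 => /eqP ->; rewrite mcoeffU1 eqxx.
rewrite -/(wdeg wt m) subrr; exact: inP1.
Qed.

Definition poly_basis : gbasis (inP G) hU.
Proof.
apply: (@GBasis _ _ _ _ {cmonom X} (fun m => << m >>) (fun x m => x@_m)
  (fun x => msupp x) (wdeg wt)).
- by move=> p x y m; rewrite mcoeffD mcoeffZ.
- by move=> x; apply: fset_uniq.
- by move=> x m; apply: mcoeff_outdom.
- by move=> m m'; rewrite mcoeffU1.
- move=> x; rewrite {1}[x]monalgE; apply: eq_bigr => m _.
  apply/malgP => m'; rewrite [RHS]mcoeffZ [LHS]mcoeffU mcoeffU1.
  by rewrite mulr_natr.
- exact: monom_hom.
exact: wdeg_poly.
Defined.

(** Harrison cohomology of a polynomial algebra in characteristic zero is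
concentrated in degree one. *)
Lemma poly_exact q e f : cochain hU q.+2 e f ->
  (forall w, hoch *%R rho f w = 0) ->
  exists2 g, cochain hU q.+1 e g & hoch *%R rho g = f.
Proof.
case=> fs fl fn fh fd df.
pose mon (m : {cmonom X}) : U := << m >>.
pose F w := f (map mon w).
have monM m m' : mon (mmul m m') = mon m * mon m'.
  by rewrite /mon [RHS]malgM_def fgmulUU mulr1.
have mon1 : mon mone = 1 by [].
pose r m : A := rho (mon m).
have r1 : r mone = 1 by rewrite /r mon1 rmorph1.
have rM m m' : r (mmul m m') = r m * r m' by rewrite /r monM rmorphM.
have sizeM (m m' : {cmonom X}) : size (cm_split (mmul m m')) =
    (size (cm_split m) + size (cm_split m'))%N.
  by rewrite !size_cm_split mdegM.
have quoA n : n.+1%:R * (quo G n.+1)%:A = 1 :> A.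
  by rewrite mulr_natl -scaler_nat scalerA quoP scale1r.
have in_q j n x : inM G j x -> inM G j ((quo G n)%:A *: x).
  by move=> jx; rewrite -[j]add0r; apply: inAM => //; apply/inPA/in_quo.
have in_r j m x : inM G j x -> inM G (j + wdeg wt m) (r m *: x).
  by move=> jx; rewrite addrC; apply: inAM => //; apply/rho_hom/monom_hom.
have := harrison_exact (@mulmC _) (@mul1m _) r1 rM (@cm_splitM X M) sizeM
  (@cm_split_mul X) (@cm_split_size X) (@cm_split_nil X) quoA
  (inM0 G) (@inMD _ _ _ G) (@inMN _ _ _ G) in_q in_r (wdegM wt).
case/(_ q e F).
- by move=> w sw; rewrite /F fs ?size_map.
- by move=> w ow; rewrite /F fn // -mon1 map_f.
- by move=> u v u0 v0; rewrite /F sh_map fh // -size_eq0 size_map size_eq0.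
- move=> w; apply: fd; elim: w => [|m w IH]; first by rewrite big_nil.
  rewrite big_cons; exists (wdeg wt m); first exact: monom_hom.
  by rewrite addrAC subrr add0r.
- by move=> w; rewrite (hoch_map (mul' := *%R) (rho' := rho)) //.
move=> g [gs gn gh gd dg]; pose g1 := mext (B := poly_basis) g.
have g1P : cochain hU q.+1 e g1 by apply: (mext_cochain (i1 := mone : bI poly_basis)).
exists g1 => //; apply: funext; apply: (multilin_eq (B := poly_basis)) => //.
  by apply: hoch_multilin => [p x y|]; [rewrite linearP | case: g1P].
move=> s; rewrite -[RHS]/(F s) -dg.
rewrite -(hoch_map (mul := mmul) (rho := r)) //; congr (hoch _ _ _ s).
by apply: funext => w; apply: (mextE (B := poly_basis)).
Qed.

End Polynomial.
End Cochains.

(** * A contraction of a simplicial resolution *)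

Lemma big_nat2 (V : zmodType) (F : nat -> V) k :
  \sum_(k <= i < k.+2) F i = F k + F k.+1.
Proof. by rewrite big_ltn // big_nat1. Qed.

Lemma lrmorph_sign (P : comNzRingType) (U V : comAlgType P)
    (h : {lrmorphism U -> V}) n x : h ((-1) ^+ n * x) = (-1) ^+ n * h x.
Proof. exact: raddfMsign. Qed.

(** An augmented simplicial algebra: [aug 0] is the augmentation, and [aug n.+1]
is the algebra of [n]-simplices. *)
Section Contraction.
Variables (P : comNzRingType) (aug : nat -> comAlgType P).
Variable aface : forall n : nat, nat -> {lrmorphism aug n.+1 -> aug n}.
Variable adegen : forall n : nat, nat -> {lrmorphism aug n.+1 -> aug n.+2}.

Hypothesis aface_swap : forall n i j (x : aug n.+2), (i <= j)%N -> (j <= n)%N ->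
  aface n i (aface n.+1 j.+1 x) = aface n j (aface n.+1 i x).
Hypothesis aface_degen_id : forall n i j (x : aug n.+1),
  (j <= i)%N -> (i <= j.+1)%N -> (j <= n)%N -> aface n.+1 i (adegen n j x) = x.
Hypothesis aface_degen_gt : forall n i j (x : aug n.+2),
  (j.+1 < i)%N -> (i <= n.+2)%N ->
  aface n.+2 i (adegen n.+1 j x) = adegen n j (aface n.+1 i.-1 x).
Hypothesis aface_degen_lt : forall n i j (x : aug n.+2),
  (i < j)%N -> (j <= n.+1)%N ->
  aface n.+2 i (adegen n.+1 j x) = adegen n j.-1 (aface n.+1 i x).

Definition alt (n : nat) (x : aug n.+1) : aug n :=
  \sum_(0 <= i < n.+1) (-1) ^+ i * aface n i x.

Variable hU : forall n, int -> aug n -> Prop.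
Hypothesis hU0 : forall n j, @hU n j 0.
Hypothesis hUD : forall n j x y, @hU n j x -> hU j y -> hU j (x + y).
Hypothesis hUN : forall n j x, @hU n j x -> hU j (- x).
Hypothesis aface_hom : forall n i j x, (i <= n)%N ->
  @hU n.+1 j x -> hU j (aface n i x).
Hypothesis adegen_hom : forall n i j x, (i <= n)%N ->
  @hU n.+1 j x -> hU j (adegen n i x).
Hypothesis alt_exact : forall n j x, @hU n.+1 j x -> alt x = 0 ->
  exists2 y, @hU n.+2 j y & x = alt y.
Hypothesis aug_onto : forall j x, @hU 0 j x ->
  exists2 y, @hU 1 j y & aface 0 0 y = x.

Lemma hUB n j x y : @hU n j x -> hU j y -> hU j (x - y).
Proof. by move=> hx hy; apply/hUD/hUN. Qed.

(** The faces are corrected from the last one down, adding a degenerate simplex each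
time; this does not disturb the faces that are already right. *)
Lemma horn_filling n j (y : nat -> aug n.+1) :
  (forall i, (i <= n.+1)%N -> hU j (y i)) ->
  (forall i k, (i <= k)%N -> (k <= n)%N ->
     aface n i (y k.+1) = aface n k (y i)) ->
  exists2 z, @hU n.+2 j z & forall i, (0 < i <= n.+1)%N -> aface n.+1 i z = y i.
Proof.
move=> hy ys; suff H m : (m <= n.+1)%N -> exists2 z, @hU n.+2 j z &
    forall i, (n.+1 - m < i <= n.+1)%N -> aface n.+1 i z = y i.
  by have [z hz zP] := H n.+1 (leqnn _); exists z => // i; rewrite -(subnn n.+1); apply: zP.
elim: m => [|m IH] mn.
  by exists 0; [exact: hU0 | move=> i; rewrite subn0; lia].
have [r hr rP] := IH (ltnW mn); move kE: (n - m)%N => k.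
have kn : (k <= n)%N by lia.
exists (r + adegen n k (y k.+1 - aface n.+1 k.+1 r)).
  apply/hUD => //; apply: adegen_hom => //; apply: hUB; first exact: hy.
  exact: aface_hom.
move=> i /andP[ki iN]; rewrite raddfD /=.
have [->|ik] := eqVneq i k.+1.
  by rewrite aface_degen_id ?leqnSn // subrKC.
have {}ki : (k.+1 < i)%N by move/eqP: ik; lia.
rewrite rP; last by lia.
case: n y hy ys {IH} mn r hr rP kE kn ki iN => [|n] y hy ys mn r hr rP kE kn ki iN.
  by lia.
case: i ik ki iN => // i ik ki iN.
rewrite aface_degen_gt // raddfB /= -aface_swap //.
rewrite rP ?[aface _ k.+1 (y i.+1)]ys; [|lia|lia|lia].
by rewrite subrr raddf0 addr0.
Qed.

(** The correction used in [moore_exact] does not change the boundary. *)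
Lemma alt_degen n k (v : aug n.+2) : (k <= n)%N ->
  (forall i, (i <= n)%N -> aface n i (alt v) = 0) ->
  (forall i, (k.+1 < i <= n.+1)%N -> aface n.+1 i v = 0) ->
  alt (adegen n k (aface n.+1 k.+1 v)) = 0.
Proof.
move=> kn av v0; set u := aface n.+1 k.+1 v.
have u0 i : (k < i <= n)%N -> aface n i u = 0.
  move=> ki; rewrite /u -aface_swap; [|lia|lia].
  by rewrite v0 ?raddf0 //; lia.
have sum0 : \sum_(0 <= i < k) (-1) ^+ i * aface n i u = 0.
  have := av k kn; rewrite raddf_sum /= (big_cat_nat (n := k)) /=; [|lia|lia].
  rewrite (big_cat_nat (m := k) (n := k.+2)) /=; [|lia|lia].
  rewrite [X in _ + (_ + X)]big_nat_cond [X in _ + (_ + X)]big1 => [|i]; last first.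
    by move=> hi; rewrite v0 ?mulr0 ?raddf0 //; lia.
  rewrite addr0 big_nat2.
  rewrite !(lrmorph_sign (aface n k)) (aface_swap v (leqnn k)) // -/u.
  rewrite exprS mulN1r mulNr subrr addr0 => {2}<-.
  rewrite big_nat_cond [RHS]big_nat_cond; apply: eq_bigr => i hi.
  rewrite (lrmorph_sign (aface n k)) /u aface_swap //; lia.
rewrite /alt (big_cat_nat (n := k)) /=; [|lia|lia].
rewrite (big_cat_nat (m := k) (n := k.+2)) /=; [|lia|lia].
rewrite [X in _ + (_ + X)]big_nat_cond [X in _ + (_ + X)]big1 => [|i]; last first.
  move=> hi; case: n {av} v kn v0 u u0 sum0 hi => [|n] v kn v0 u u0 sum0 hi; first by lia.
  rewrite aface_degen_gt; [|lia|lia].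
  by rewrite u0 ?raddf0 ?mulr0 //; lia.
rewrite addr0 big_nat2.
rewrite !aface_degen_id // exprS mulN1r mulNr subrr addr0.
case: n {av} v kn v0 u u0 sum0 => [|n] v kn v0 u u0 sum0.
  by rewrite big_geq //; lia.
have E : adegen n k.-1 (\sum_(0 <= i < k) (-1) ^+ i * aface n.+1 i u) = 0.
  by rewrite sum0 raddf0.
rewrite -[RHS]E raddf_sum big_nat_cond [RHS]big_nat_cond; apply: eq_bigr => i hi.
rewrite aface_degen_lt; [|lia|lia].
exact/esym/(lrmorph_sign (adegen n k.-1)).
Qed.

(** A simplex bounding [x] exists by [alt_exact]; it is corrected by degenerate
simplices until only its first face is nonzero. *)
Lemma moore_exact n j (x : aug n.+1) : hU j x ->
  (forall i, (i <= n)%N -> aface n i x = 0) ->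
  exists z, [/\ @hU n.+2 j z, aface n.+1 0 z = x &
                forall i, (0 < i <= n.+1)%N -> aface n.+1 i z = 0].
Proof.
move=> hx x0.
have [v0 hv0 xv0] : exists2 y, @hU n.+2 j y & x = alt y.
  apply: alt_exact => //; rewrite /alt big_nat_cond big1 // => i hi.
  by rewrite x0 ?mulr0 //; lia.
suff H m : (m <= n.+1)%N -> exists v, [/\ @hU n.+2 j v, x = alt v &
    forall i, (n.+1 - m < i <= n.+1)%N -> aface n.+1 i v = 0].
  have [v [hv xv v0']] := H n.+1 (leqnn _); exists v; split=> //; last first.
    by move=> i; rewrite -(subnn n.+1); apply: v0'.
  rewrite xv /alt big_ltn // expr0 mul1r big_nat_cond big1 ?addr0 // => i hi.
  by rewrite v0' ?mulr0 //; lia.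
elim: m => [|m IH] mn.
  by exists v0; split=> // i; rewrite subn0; lia.
have [v [hv xv vP]] := IH (ltnW mn); move kE: (n - m)%N => k.
have kn : (k <= n)%N by lia.
have vP' i : (k.+1 < i <= n.+1)%N -> aface n.+1 i v = 0.
  by move=> hi; apply: vP; lia.
exists (v - adegen n k (aface n.+1 k.+1 v)); split.
- by apply: hUB => //; apply: adegen_hom => //; apply: aface_hom.
- have altB (a b : aug n.+2) : alt (a - b) = alt a - alt b.
    by rewrite /alt -sumrB; apply: eq_bigr => i _; rewrite raddfB mulrBr.
  by rewrite altB alt_degen ?subr0 // -xv.
move=> i hi; rewrite raddfB /=.
have [->|ik] := eqVneq i k.+1.
  by rewrite aface_degen_id ?leqnSn // subrr.
have ki : (k.+1 < i)%N by move/eqP: ik; lia.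
rewrite (vP' i); last by lia.
case: n x hx x0 v0 hv0 xv0 {IH} mn v hv xv vP kE kn vP' hi ik ki
  => [|n] x hx x0 v0 hv0 xv0 mn v hv xv vP kE kn vP' hi ik ki; first by lia.
case: i hi ik ki => // i hi ik ki.
rewrite aface_degen_gt //; last by lia.
rewrite -aface_swap; [|lia|lia].
by rewrite /= (vP' i.+1); [rewrite !raddf0 addr0 | lia].
Qed.

(** Fill the horn, then correct the remaining face by [moore_exact]. *)
Lemma sphere_filling n j (y : nat -> aug n.+1) :
  (forall i, (i <= n.+1)%N -> hU j (y i)) ->
  (forall i k, (i <= k)%N -> (k <= n)%N ->
     aface n i (y k.+1) = aface n k (y i)) ->
  exists2 z, @hU n.+2 j z & forall i, (i <= n.+1)%N -> aface n.+1 i z = y i.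
Proof.
move=> hy ys; have [r hr rP] := horn_filling hy ys.
have [||v [hv v0 vP]] := @moore_exact n j (y 0%N - aface n.+1 0 r).
- by apply: hUB; [exact: hy | exact: aface_hom].
- by move=> i hi; rewrite raddfB /= -aface_swap // rP // ys // subrr.
exists (r + v); first exact: hUD.
case=> [|i] hi; rewrite raddfD /=; first by rewrite v0 subrKC.
by rewrite rP // vP // addr0.
Qed.

Variable inP : int -> P -> Prop.
Hypothesis hUZ : forall n i j p x, inP i p -> @hU n j x -> hU (i + j) (p *: x).
Hypothesis hU1 : forall n, @hU n 0 1.
Variable basis : forall n, gbasis inP (@hU n).
Variable bone : forall n, bI (basis n).
Hypothesis bE1 : forall n, bE (bone n) = 1 :> aug n.
Hypothesis bone_deg : forall n, bdeg (bone n) = 0.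

Record contraction n (h : aug n -> aug n.+1) : Prop := Contraction {
  ct_lin : forall p x y, h (p *: x + y) = p *: h x + h y;
  ct_one : h 1 = 1;
  ct_hom : forall j x, hU j x -> hU j (h x);
  ct_face : forall x, aface n 0 (h x) = x;
  ct_swap : forall x i j, (i < j)%N -> (j <= n)%N ->
    aface n i.+1 (h (aface n j x)) = aface n j (h (aface n i x))
}.

(** Solutions are chosen on a basis containing [1] and extended linearly; choosing
[1] at [1] makes the result unital. *)
Lemma linear_choice n (Q : aug n -> aug n.+1 -> Prop) :
  (forall p x y x' y', Q x y -> Q x' y' -> Q (p *: x + x') (p *: y + y')) ->
  Q 1 1 -> (forall j x, hU j x -> exists2 y, hU j y & Q x y) ->
  exists h : aug n -> aug n.+1,
    [/\ forall p x y, h (p *: x + y) = p *: h x + h y, h 1 = 1,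
        forall j x, hU j x -> hU j (h x) & forall x, Q x (h x)].
Proof.
move=> Qlin Q1 Qex; have Q0 : Q 0 0.
  by have := Qlin (-1) _ _ _ _ Q1 Q1; rewrite !scaleN1r !addNr.
have /choice[phi phiP] : forall i : bI (basis n), exists y,
    [/\ hU (bdeg i) y, Q (bE i) y & i = bone n -> y = 1].
  move=> i; have [->|i1] := eqVneq i (bone n).
    by exists 1; rewrite bE1 bone_deg; split.
  have [y hy Qy] := Qex _ _ (bE_hom i); exists y; split=> // ii.
  by rewrite ii eqxx in i1.
pose h := bext (B := basis n) (M := ((aug n.+1)^o : lmodType (aug n.+1))) phi.
have hE x : h x = \sum_(i <- bsupp (basis n) x) bco x i *: phi i.
  by rewrite /h /bext; apply: eq_bigr => i _; rewrite -[LHS]/(_ * _) -scalerAl mul1r.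
exists h; split.
- move=> p x y; rewrite /h bext_lin -[_ *: (_ : _^o)]/(_ * _) -scalerAl mul1r.
  by [].
- by rewrite -bE1 /h bextE; case: (phiP (bone n)) => _ _ ->.
- move=> j x jx; rewrite hE; apply: (big_ind (hU j)) => // [y z|i _].
    exact: hUD.
  rewrite -[j](subrK (bdeg i)); apply: hUZ; first exact: bco_hom.
  by case: (phiP i).
move=> x; rewrite hE {1}[x](bexpand (basis n)).
elim: (bsupp _ x) => [|i s IH]; first by rewrite !big_nil.
by rewrite !big_cons; apply: Qlin => //; case: (phiP i).
Qed.

Lemma contraction0 : exists h, @contraction 0 h.
Proof.
have [||j x /aug_onto[y hy yx]|h [hl h1 hh hf]] :=
    @linear_choice 0 (fun x y => aface 0 0 y = x).
- by move=> p x y x' y' <- <-; rewrite linearP.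
- exact: rmorph1.
- by exists y.
by exists h; split=> // x i j ij; rewrite leqn0 => /eqP j0; rewrite j0 in ij.
Qed.

(** The prescribed faces of [h' x] form a sphere; it is filled linearly in [x]. *)
Lemma contractionS n h : @contraction n h -> exists2 h', @contraction n.+1 h' &
  forall x i, (i <= n)%N -> aface n.+1 i.+1 (h' x) = h (aface n i x).
Proof.
case=> hl h1 hh hf hs.
have lin m i p x y : aface m i (p *: x + y) = p *: aface m i x + aface m i y.
  exact: linearP.
have [||j x hx|h' [hl' h1' hh' hQ]] := @linear_choice n.+1 (fun x y =>
    aface n.+1 0 y = x /\
    forall i, (i <= n)%N -> aface n.+1 i.+1 y = h (aface n i x)).
- move=> p x y x' y' [<- yi] [<- yi']; split; first by rewrite lin.
  by move=> i ni; rewrite !lin yi // yi' // hl.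
- by split=> [|i _]; rewrite ?rmorph1 ?h1.
- pose y k := if k is k'.+1 then h (aface n k' x) else x.
  have [||z hz zP] := @sphere_filling n j y.
  + by case=> [//|k] kn; apply/hh/aface_hom.
  + by case=> [|i] k ik kn; [exact: hf | exact: hs].
  exists z => //; split; first exact: (zP 0%N).
  by move=> i ni; apply: (zP i.+1).
exists h'; last by move=> x i ni; case: (hQ x) => _ ->.
split=> // [x|x i j ij jn]; first by case: (hQ x).
case: (hQ (aface n.+1 j x)) => _ ->; last by lia.
case: j ij jn => // j ij jn.
case: (hQ (aface n.+1 i x)) => _ ->; last by lia.
by rewrite aface_swap //; lia.
Qed.

Lemma exists_contraction : exists h : forall n, aug n -> aug n.+1,
  (forall n, contraction (h n)) /\
  (forall n x i, (i <= n)%N -> aface n.+1 i.+1 (h n.+1 x) = h n (aface n i x)).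
Proof.
have [h0 h0P] := cid contraction0.
have step n (h : {h | @contraction n h}) : {h' : {h' | @contraction n.+1 h'} |
    forall x i, (i <= n)%N -> aface n.+1 i.+1 (sval h' x) = sval h (aface n i x)}.
  have /cid2[h' h'P hs] := contractionS (svalP h).
  by exists (exist _ h' h'P).
pose H := fix H n : {h | @contraction n h} :=
  if n is n'.+1 then sval (step n' (H n')) else exist _ h0 h0P.
exists (fun n => sval (H n)); split=> [n|n x i ni]; first exact: svalP (H n).
exact: (svalP (step n (H n))).
Qed.

End Contraction.

(** * The double complex *)

(** The identity behind the square of an alternating sum of faces being zero. *)
Lemma alternating_cancel (K : comNzRingType) (V : lmodType K) n
    (F : nat -> nat -> V) :
  (forall i j, (i <= j)%N -> (j <= n)%N -> F i j.+1 = F j i) ->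
  \sum_(0 <= i < n.+1) \sum_(0 <= j < n.+2) (-1) ^+ (i + j) *: F i j = 0.
Proof.
move=> swapF.
pose T i j := (-1) ^+ (i + j) *: F i j.
have E i : (i < n.+1)%N -> \sum_(0 <= j < n.+2) T i j =
    \sum_(0 <= j < n.+1 | (j <= i)%N) T i j
    - \sum_(0 <= j < n.+1 | (i <= j)%N) T j i.
  move=> hi; rewrite (bigID (fun j => (j <= i)%N)) /=; congr (_ + _).
    rewrite big_mkcond big_nat_recr //= -big_mkcond /=.
    by rewrite (_ : (n < i)%N = false) ?addr0 //; lia.
  rewrite big_mkcond big_ltn //= add0r big_add1 /= -big_mkcond /=.
  rewrite -sumrN big_nat_cond [RHS]big_nat_cond; apply: eq_big => j.
    by rewrite -ltnNge.
  rewrite -ltnNge ltnS => /andP[/andP[_ hj] ij].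
  by rewrite /T swapF // addnS exprS mulN1r scaleNr addnC.
rewrite big_nat_cond (eq_bigr (fun i =>
    \sum_(0 <= j < n.+1 | (j <= i)%N) T i j
    - \sum_(0 <= j < n.+1 | (i <= j)%N) T j i)); last first.
  by move=> i /andP[hi _]; apply: E.
rewrite -big_nat_cond sumrB; apply/eqP; rewrite subr_eq0; apply/eqP.
rewrite (exchange_big_dep_nat xpredT) //.
Qed.

Section Zigzag.
Variables (P : comNzRingType) (A : comAlgType P) (M : lmodType A).
Variable aug : nat -> comAlgType P.
Variable aface : forall n : nat, nat -> {lrmorphism aug n.+1 -> aug n}.
Variable rho : forall n, {lrmorphism aug n -> A}.
Implicit Types (n q : nat).

Hypothesis aface_swap : forall n i j (x : aug n.+2), (i <= j)%N -> (j <= n)%N ->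
  aface n i (aface n.+1 j.+1 x) = aface n j (aface n.+1 i x).
Hypothesis rho_face : forall n i x, (i <= n)%N ->
  rho n (aface n i x) = rho n.+1 x.

Definition delta n (f : seq (aug n) -> M) (w : seq (aug n.+1)) : M :=
  \sum_(0 <= i < n.+1) (-1) ^+ i *: f (map (aface n i) w).

Definition hd n (f : seq (aug n) -> M) := hoch *%R (rho n) f.

Lemma delta_delta n (f : seq (aug n) -> M) w : delta (delta f) w = 0.
Proof.
rewrite /delta; under eq_bigr => j _ do rewrite scaler_sumr.
rewrite exchange_big /=.
under eq_bigr => i _ do under eq_bigr => j _ do rewrite scalerA -exprD addnC.
apply: (alternating_cancel (F := fun i j =>
  f (map (aface n i) (map (aface n.+1 j) w)))) => i j ij jn.
by rewrite -!map_comp; congr f; apply: eq_map => x; apply: aface_swap.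
Qed.

Lemma delta_comb n c (f g : seq (aug n) -> M) w :
  delta (fun w => c *: f w + g w) w = c *: delta f w + delta g w.
Proof.
rewrite /delta scaler_sumr -big_split /=; apply: eq_bigr => i _.
by rewrite scalerDr scaleCA.
Qed.

Lemma deltaB n (f g : seq (aug n) -> M) w :
  delta (fun w => f w - g w) w = delta f w - delta g w.
Proof. by rewrite -[RHS](opB (T := fun f => delta f w)) // => c ? ?; apply: delta_comb. Qed.

Lemma delta0 n w : delta (fun _ : seq (aug n) => 0) w = 0.
Proof. by rewrite /delta big1 // => i _; rewrite scaler0. Qed.

Lemma hdB n (f g : seq (aug n) -> M) w :
  hd (fun w => f w - g w) w = hd f w - hd g w.
Proof. exact: (opB (hoch_lin _ _ w)). Qed.

Lemma hd0 n w : hd (fun _ : seq (aug n) => 0) w = 0.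
Proof. exact: (op0 (hoch_lin _ _ w)). Qed.

Lemma hd_hd n (f : seq (aug n) -> M) w : hd (hd f) w = 0.
Proof. by apply: hoch_hoch => [|a b]; [exact: mulrA | rewrite rmorphM]. Qed.

Lemma hd_delta n (f : seq (aug n) -> M) w : hd (delta f) w = delta (hd f) w.
Proof.
rewrite /hd (_ : delta f = fun w =>
    \sum_(i <- iota 0 n.+1) (-1) ^+ i *: f (map (aface n i) w)); last first.
  by apply: funext => x; rewrite /delta /index_iota subn0.
rewrite (op_sum (hoch_lin _ _ w)) /delta /index_iota subn0.
rewrite big_seq [RHS]big_seq; apply: eq_bigr => i.
rewrite mem_iota add0n ltnS => /andP[_ hi].
rewrite (opZ (hoch_lin _ _ w)) (hoch_map (mul' := *%R) (rho' := rho n)) //.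
  by move=> a b; rewrite rmorphM.
by move=> a; rewrite rho_face.
Qed.

(** [zigzag C F q f]: the cochain [f] on [aug n.+1] is connected to the cochain
[F] on [aug 0] through the double complex with differentials [hd] and [delta]. *)
Fixpoint zigzag (C : forall n, nat -> (seq (aug n) -> M) -> Prop)
    (F : seq (aug 0) -> M) n q : (seq (aug n.+1) -> M) -> Prop :=
  match n return (seq (aug n.+1) -> M) -> Prop with
  | 0 => fun f => f = delta F
  | n'.+1 => fun f => exists g : seq (aug n'.+1) -> M,
      [/\ C n'.+1 q g, f = delta g & zigzag C F q.+1 (hd g)]
  end.

Section Grading.
Variables (G : degrees M) (hU : forall n, int -> aug n -> Prop) (e : int).
Hypothesis hUM : forall n i j x y, @hU n i x -> hU j y -> hU (i + j) (x * y).
Hypothesis rho_hom : forall n j x, @hU n j x -> inA G j (rho n x).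
Hypothesis aface_hom : forall n i j x, (i <= n)%N ->
  @hU n.+1 j x -> hU j (aface n i x).

Definition gcochain n q (f : seq (aug n) -> M) := cochain G (@hU n) q e f.

Lemma cochainZsign n q k f : gcochain q f ->
  gcochain q (fun w : seq (aug n) => (-1) ^+ k *: f w).
Proof.
move=> hf; elim: k => [|k IH].
  by rewrite (_ : (fun w => _) = f) //; apply: funext => w; rewrite scale1r.
have -> : (fun w => (-1) ^+ k.+1 *: f w) = fun w => 0 - (-1) ^+ k *: f w.
  by apply: funext => w; rewrite exprS mulN1r scaleNr sub0r.
by apply: cochainB => //; apply: cochain0.
Qed.

Lemma cochain_delta n q (f : seq (aug n) -> M) :
  gcochain q f -> gcochain q (delta f).
Proof.
move=> hf; have -> : delta f = fun w =>
    \sum_(i <- iota 0 n.+1) (if (i <= n)%N then (-1) ^+ i *: f (map (aface n i) w) else 0).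
  apply: funext => w; rewrite /delta /index_iota subn0 big_seq [RHS]big_seq.
  by apply: eq_bigr => i; rewrite mem_iota add0n ltnS => /andP[_ ->].
apply: cochain_sum => i; case: (boolP (i <= n)%N) => ni; last exact: cochain0.
have := cochainZsign i hf; apply: cochain_map.
- by move=> p x y; rewrite linearP.
- exact: rmorph1.
by move=> j x; apply: aface_hom.
Qed.

Lemma cochain_hd n q (f : seq (aug n) -> M) : gcochain q f -> gcochain q.+1 (hd f).
Proof.
by apply: cochain_hoch => [j x|i j x y]; [exact: rho_hom | exact: hUM].
Qed.

Lemma zigzagB F F' n q f f' :
  zigzag gcochain F q f -> zigzag gcochain F' q f' ->
  zigzag gcochain (fun w => F w - F' w) q (fun w : seq (aug n.+1) => f w - f' w).
Proof.
elim: n q f f' => [|n IH] q f f' /=.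
  by move=> -> ->; apply: funext => w; rewrite deltaB.
case=> g [hg -> zg] [g' [hg' -> zg']]; exists (fun w => g w - g' w); split.
- exact: cochainB.
- by apply: funext => w; rewrite deltaB.
have -> : hd (fun w => g w - g' w) = fun w => hd g w - hd g' w.
  by apply: funext => w; rewrite hdB.
exact: IH.
Qed.

Lemma zigzag0 n q : zigzag gcochain (fun=> 0) q (fun _ : seq (aug n.+1) => 0).
Proof.
elim: n q => [|n IH] q /=; first by apply: funext => w; rewrite delta0.
exists (fun=> 0); split; first exact: cochain0.
  by apply: funext => w; rewrite delta0.
have -> : hd (fun _ : seq (aug n.+1) => 0) = fun=> 0.
  by apply: funext => w; rewrite hd0.
exact: IH.
Qed.

Lemma zigzag_sum (I : Type) (s : seq I) (F : I -> seq (aug 0) -> M) n q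
    (f : I -> seq (aug n.+1) -> M) :
  (forall i, zigzag gcochain (F i) q (f i)) ->
  zigzag gcochain (fun w => \sum_(i <- s) F i w) q
                  (fun w => \sum_(i <- s) f i w).
Proof.
move=> hf; elim: s => [|i s IH].
  rewrite (_ : (fun w => \sum_(i <- [::]) f i w) = fun=> 0); last first.
    by apply: funext => w; rewrite big_nil.
  rewrite (_ : (fun w => \sum_(i <- [::]) F i w) = fun=> 0).
    exact: zigzag0.
  by apply: funext => w; rewrite big_nil.
have E (L : Type) (h : I -> L -> M) : (fun w => \sum_(j <- i :: s) h j w) =
    fun w => h i w - (0 - \sum_(j <- s) h j w).
  by apply: funext => w; rewrite big_cons sub0r opprK.
by rewrite !E; apply/zigzagB/zigzagB => //; apply: zigzag0.
Qed.

Variable h : forall n, aug n -> aug n.+1.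
Hypothesis h_lin : forall n p x y, @h n (p *: x + y) = p *: h x + h y.
Hypothesis h_one : forall n, @h n 1 = 1.
Hypothesis h_hom : forall n j x, @hU n j x -> hU j (h x).
Hypothesis h_face0 : forall n x, aface n 0 (@h n x) = x.
Hypothesis h_face : forall n x i, (i <= n)%N ->
  aface n.+1 i.+1 (@h n.+1 x) = @h n (aface n i x).
Hypothesis poly_exactness : forall n q f, @gcochain n.+1 q.+2 f ->
  (forall w, hd f w = 0) -> exists2 g, gcochain q.+1 g & hd g = f.

(** The rows of the double complex are exact: precomposition with [h] is a
contracting homotopy. *)
Lemma delta_exact n q (f : seq (aug n.+1) -> M) : gcochain q f ->
  (forall w, delta f w = 0) ->
  exists2 g, @gcochain n q g & f = delta g.
Proof.
move=> hf df; exists (fun w => f (map (@h n) w)).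
  by apply: cochain_map hf => //; apply: h_hom.
apply: funext => w; have := df (map (@h n.+1) w).
rewrite {1}/delta big_ltn // expr0 scale1r -map_comp.
rewrite (_ : map (_ \o _) w = w); last first.
  by rewrite -[RHS]map_id; apply: eq_map => x; apply: h_face0.
rewrite big_add1 /= => /eqP; rewrite addr_eq0 => /eqP ->.
rewrite -sumrN /delta big_nat_cond [RHS]big_nat_cond; apply: eq_bigr => i.
rewrite andbT => /andP[_ hi]; rewrite exprS mulN1r scaleNr opprK.
congr (_ *: f _); rewrite -!map_comp; apply: eq_map => x /=.
by rewrite h_face.
Qed.

(** Descend through the double complex by exactness of the rows. *)
Lemma zigzag_represent n q (f : seq (aug n.+1) -> M) : gcochain q f ->
  (forall w, hd f w = 0) -> (forall w, delta f w = 0) ->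
  exists F, [/\ @gcochain 0 (n + q) F, forall w, hd F w = 0 &
                zigzag gcochain F q f].
Proof.
elim: n q f => [|n IH] q f hf df deltaf.
  have [F hF fF] := delta_exact hf deltaf; exists F; split=> // w.
  have := df (map (@h 0) w); rewrite fF hd_delta /delta big_nat1 scale1r.
  rewrite -map_comp (_ : map (_ \o _) w = w) //.
  by rewrite -[RHS]map_id; apply: eq_map => x; apply: h_face0.
have [g hg fg] := delta_exact hf deltaf.
have [||F [hF dF zF]] := IH q.+1 (hd g) (cochain_hd hg).
- by move=> w; apply: hd_hd.
- by move=> w; rewrite -hd_delta -fg.
by exists F; split=> //; [rewrite addSnnS | exists g].
Qed.

(** Ascend through the double complex by exactness of the columns. *)
Lemma zigzag_lift n q F : @gcochain 0 (n + q.+1) F -> (forall w, hd F w = 0) ->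
  exists f, [/\ @gcochain n.+1 q.+1 f, forall w, hd f w = 0,
                forall w, delta f w = 0 & zigzag gcochain F q.+1 f].
Proof.
elim: n q => [|n IH] q hF dF.
  exists (delta F); split=> //; first exact: cochain_delta.
    by move=> w; rewrite hd_delta (_ : hd F = fun=> 0) ?delta0 //; apply: funext.
  by move=> w; rewrite delta_delta.
have [|f [hf df deltaf zf]] := IH q.+1 _ dF; first by rewrite -addSnnS.
have [g hg fg] := poly_exactness hf df.
exists (delta g); split.
- exact: cochain_delta.
- by move=> w; rewrite hd_delta fg deltaf.
- by move=> w; rewrite delta_delta.
by exists g; split=> //; rewrite fg.
Qed.

(** A diagram chase: a cochain connected to zero is a boundary; in simplicial degree
zero there are no boundaries. *)
Lemma zigzag_trivial n q (f : seq (aug n.+1) -> M) :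
  zigzag gcochain (fun=> 0) q.+1 f ->
  match n return (seq (aug n.+1) -> M) -> Prop with
  | 0 => fun f => f = fun=> 0
  | n'.+1 => fun f => exists u : seq (aug n'.+1) -> M,
      [/\ gcochain q.+1 u, forall w, hd u w = 0 & f = delta u]
  end f.
Proof.
elim: n q f => [|n IH] q f /=; first by move=> ->; apply: funext => w; rewrite delta0.
case=> g [hg fg zg]; have := IH _ _ zg.
case: n IH f g hg fg zg => [|n] IH f g hg fg zg.
  by move=> dg; exists g; split=> // w; rewrite dg.
case=> u [hu du dg]; have [v hv uv] := poly_exactness hu du.
exists (fun w => g w - delta v w); split.
- by apply: cochainB => //; apply: cochain_delta.
- by move=> w; rewrite hdB hd_delta uv dg subrr.
by rewrite fg; apply: funext => w; rewrite deltaB delta_delta subr0.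
Qed.

End Grading.
End Zigzag.

(** The coefficients in a shuffle product are signs. *)
Lemma additive_sh (K : comNzRingType) (V W : lmodType K) (phi : V -> W)
    (L : Type) (u v : seq L) (f : seq L -> V) :
  (forall x y, phi (x - y) = phi x - phi y) ->
  sh u (fun w => phi (f w)) v = phi (sh u f v).
Proof.
move=> phiB; have phi0 : phi 0 = 0 by rewrite -(subrr 0) phiB subrr.
have phiN x : phi (- x) = - phi x by rewrite -sub0r phiB phi0 sub0r.
have phiD x y : phi (x + y) = phi x + phi y by rewrite -{1}[y]opprK phiB phiN opprK.
elim: u f v => [|a u IHu] f v //; elim: v f => [|b v IHv] f //.
rewrite !sh_cons (IHu (prep a f)) (IHv (prep b f)) phiD; congr (_ + _).
by rewrite -signr_odd; case: odd; rewrite ?scaleN1r ?scale1r ?phiN.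
Qed.

Section CoefficientMaps.
Variables (P : comNzRingType) (A : comAlgType P) (M M' : lmodType A).
Variable aug : nat -> comAlgType P.
Variable aface : forall n : nat, nat -> {lrmorphism aug n.+1 -> aug n}.
Variable rho : forall n, {lrmorphism aug n -> A}.
Variable phi : M -> M'.
Hypothesis phiP : forall a x y, phi (a *: x + y) = a *: phi x + phi y.

Lemma coefD x y : phi (x + y) = phi x + phi y.
Proof. by rewrite -[x]scale1r phiP !scale1r. Qed.

Lemma coef0 : phi 0 = 0.
Proof. by apply: (addrI (phi 0)); rewrite -coefD !addr0. Qed.

Lemma coefZ a x : phi (a *: x) = a *: phi x.
Proof. by rewrite -[a *: x]addr0 phiP coef0 addr0. Qed.

Lemma coefN x : phi (- x) = - phi x.
Proof. by rewrite -scaleN1r coefZ scaleN1r. Qed.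

Lemma coef_sum (I : Type) (s : seq I) (F : I -> M) :
  phi (\sum_(i <- s) F i) = \sum_(i <- s) phi (F i).
Proof. by elim/big_rec2: _ => [|i y x _ <-]; rewrite ?coef0 ?coefD. Qed.

Lemma coef_sh (L : Type) (u v : seq L) (f : seq L -> M) :
  sh u (fun w => phi (f w)) v = phi (sh u f v).
Proof.
by apply: additive_sh => x y; rewrite coefD coefN.
Qed.

Lemma coef_hoch (L : Type) mul (rh : L -> A) f (w : seq L) :
  hoch mul rh (fun w => phi (f w)) w = phi (hoch mul rh f w).
Proof.
elim: w f => [|a w IH] f; first by rewrite coef0.
rewrite !hoch_cons (IH (prep a f)) coefD coefN; congr (_ - _).
by case: w {IH} => [|b w] /=; rewrite ?coef0 // !coefD coefN !coefZ.
Qed.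

Lemma coef_cochain (G : degrees M) (G' : degrees M') (U : comAlgType P)
    hU hU' q e e' f :
  (forall w j', in_word hU' w j' -> forall x, inM G' (e' + j') x) \/
  (hU = hU' /\ e = e' /\ forall j x, inM G j x -> inM G' j (phi x)) ->
  @cochain P A M G U hU q e f ->
  cochain G' hU' q e' (fun w => phi (f w)).
Proof.
move=> hdeg [fs fl fn fh fd]; split.
- by move=> w sw; rewrite fs ?coef0.
- by move=> u v p x y; rewrite fl coefD coefZ.
- by move=> w ow; rewrite fn ?coef0.
- by move=> u v u0 v0; rewrite coef_sh fh ?coef0.
move=> w j wj; case: hdeg => [hdeg|[hE [eE hphi]]]; first exact: (hdeg w).
by rewrite -eE; apply/hphi/fd; rewrite hE.
Qed.

Lemma coef_zigzag (C : forall n, nat -> (seq (aug n) -> M) -> Prop)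
    (C' : forall n, nat -> (seq (aug n) -> M') -> Prop) F n q f :
  (forall n q f, C n q f -> C' n q (fun w => phi (f w))) ->
  zigzag aface rho C F q f ->
  zigzag aface rho C' (fun w => phi (F w)) q (fun w : seq (aug n.+1) => phi (f w)).
Proof.
move=> CC'.
have delta_phi m (g : seq (aug m) -> M) :
    (fun w => phi (delta aface g w)) = delta aface (fun w => phi (g w)).
  by apply: funext => w; rewrite /delta coef_sum; apply: eq_bigr => i _; rewrite coefZ.
elim: n q f => [|n IH] q f /= => [->|]; first exact: delta_phi.
case=> g [hg -> zg]; exists (fun w => phi (g w)); split; [exact: CC'|exact: delta_phi|].
have -> : hd rho (fun w => phi (g w)) = fun w => phi (hd rho g w).
  by apply: funext => w; rewrite /hd coef_hoch.
exact: IH.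
Qed.

End CoefficientMaps.

(** * Cotangent and Harrison cohomology *)

Section Comparison.
Variables (P : comNzRingType) (A : comAlgType P) (S : simplicial_resolution A).

(** The resolution with [A] put in front: [raug n.+1] is the algebra of [n]-simplices. *)
Definition raug (n : nat) : comAlgType P :=
  if n is n'.+1 then polyalg P (gens S n') else A.

Definition rface (n : nat) (i : nat) : {lrmorphism raug n.+1 -> raug n} :=
  match n return {lrmorphism raug n.+1 -> raug n} with
  | 0 => augm S
  | n'.+1 => face S n' i
  end.

Definition rdegen (n : nat) (i : nat) : {lrmorphism raug n.+1 -> raug n.+2} :=
  degen S n i.

Fixpoint rrho n : {lrmorphism raug n -> A} :=
  match n return {lrmorphism raug n -> A} with
  | 0 => (idfun : {lrmorphism A -> A})
  | n'.+1 => (rrho n' \o rface n' 0 : {lrmorphism _ -> _})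
  end.

Lemma rrhoE n (x : raug n.+1) : rrho n.+1 x = to_base x.
Proof. by elim: n x => [|n IH] x //; rewrite -[LHS]/(rrho n.+1 (face S n 0 x)) IH. Qed.

Lemma rface_swap n i j (x : raug n.+2) : (i <= j)%N -> (j <= n)%N ->
  rface n i (rface n.+1 j.+1 x) = rface n j (rface n.+1 i x).
Proof.
case: n x => [|n] x ij jn; last exact: (@face_face _ _ S n i j.+1).
by case: j ij jn => // + _; case: i => // _; exact/esym/augm_face.
Qed.

Lemma rrho_face n i (x : raug n.+1) : (i <= n)%N ->
  rrho n (rface n i x) = rrho n.+1 x.
Proof.
elim: n i x => [|n IH] i x; first by rewrite leqn0 => /eqP ->.
case: i => [//|i] hi.
rewrite -[LHS]/(rrho n (rface n 0 (rface n.+1 i.+1 x))) rface_swap //.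
by rewrite IH.
Qed.

Variable M : lmodType A.
Variables (G : degrees M) (wt : forall n, gens S n -> int).

Definition rhU (n : nat) : int -> raug n -> Prop :=
  match n return int -> raug n -> Prop with
  | 0 => inA G
  | n'.+1 => poly_homog (inP G) (@wt n')
  end.

Hypothesis inPD : forall j x y, inP G j x -> inP G j y -> inP G j (x + y).
Hypothesis inPN : forall j x, inP G j x -> inP G j (- x).
Hypothesis inPM : forall i j x y, inP G i x -> inP G j y -> inP G (i + j) (x * y).
Hypothesis inA0 : forall j, inA G j 0.
Hypothesis inA1 : inA G 0 1.
Hypothesis inAD : forall j x y, inA G j x -> inA G j y -> inA G j (x + y).
Hypothesis inAN : forall j x, inA G j x -> inA G j (- x).
Hypothesis inAM' : forall i j x y, inA G i x -> inA G j y -> inA G (i + j) (x * y).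
Hypothesis rface_hom : forall n i j x, (i <= n)%N ->
  @rhU n.+1 j x -> rhU j (rface n i x).
Hypothesis rdegen_hom : forall n i j x, (i <= n)%N ->
  @rhU n.+1 j x -> rhU j (rdegen n i x).
Hypothesis ralt_exact : forall n j x, @rhU n.+1 j x -> alt rface x = 0 ->
  exists2 y, @rhU n.+2 j y & x = alt rface y.
Hypothesis raug_onto : forall j x, @rhU 0 j x ->
  exists2 y, @rhU 1 j y & rface 0 0 y = x.
Variables (BA : gbasis (inP G) (inA G)) (i1 : bI BA).
Hypothesis bEi1 : bE i1 = 1 :> A.
Hypothesis bdegi1 : bdeg i1 = 0.

Lemma inP_sum j (I : Type) (s : seq I) (F : I -> P) :
  (forall i, inP G j (F i)) -> inP G j (\sum_(i <- s) F i).
Proof. by move=> hF; apply: big_ind => // [|x y]; [exact: inP0|exact: inPD]. Qed.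

Lemma poly_homogP (X : choiceType) (w : X -> int) j (x : polyalg P X) :
  poly_homog (inP G) w j x <-> forall m, inP G (j - wdeg w m) x@_m.
Proof. by split=> [hx m|hx m _]; [exact: wdeg_poly | exact: hx]. Qed.

Lemma rhU0 n j : @rhU n j 0.
Proof.
case: n => [|n]; first exact: inA0.
by move=> m; rewrite msupp0.
Qed.

Lemma rhUD n j x y : @rhU n j x -> rhU j y -> rhU j (x + y).
Proof.
case: n x y => [|n] x y; first exact: inAD.
by move=> /poly_homogP hx /poly_homogP hy; apply/poly_homogP => m;
   rewrite mcoeffD; apply: inPD.
Qed.

Lemma rhUN n j x : @rhU n j x -> rhU j (- x).
Proof.
case: n x => [|n] x; first exact: inAN.
by move=> /poly_homogP hx; apply/poly_homogP => m; rewrite mcoeffN; apply: inPN.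
Qed.

Lemma rhUZ n i j p x : inP G i p -> @rhU n j x -> rhU (i + j) (p *: x).
Proof.
case: n x => [|n] x hp.
  by move=> hx; rewrite -[x]mul1r scalerAl; apply: inAM' => //; apply: inPA.
by move=> /poly_homogP hx; apply/poly_homogP => m; rewrite mcoeffZ -addrA; apply: inPM.
Qed.

Lemma rhUM n i j x y : @rhU n i x -> rhU j y -> rhU (i + j) (x * y).
Proof.
case: n x y => [|n] x y; first exact: inAM'.
move=> /poly_homogP hx /poly_homogP hy; apply/poly_homogP => m.
rewrite mcoeffMl; apply: inP_sum => k1; apply: inP_sum => k2.
have [<-|_] := eqVneq (mmul k1 k2) m; last by rewrite mulr0n; apply: inP0.
rewrite mulr1n wdegM (_ : i + j - _ = (i - wdeg (@wt n) k1) + (j - wdeg (@wt n) k2)).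
  exact: inPM.
by ring.
Qed.

Lemma rhU1 n : @rhU n 0 1.
Proof.
case: n => [|n]; first exact: inA1.
by rewrite -(wdeg1 (@wt n)); apply: monom_hom.
Qed.

Lemma rrho_hom n j x : @rhU n j x -> inA G j (rrho n x).
Proof. by elim: n x => [//|n IH] x hx; apply/IH/rface_hom. Qed.

Definition rbasis n : gbasis (inP G) (@rhU n) :=
  match n return gbasis (inP G) (@rhU n) with
  | 0 => BA
  | n'.+1 => poly_basis G (@wt n')
  end.

Definition rone n : bI (rbasis n) :=
  match n return bI (rbasis n) with 0 => i1 | n'.+1 => mone end.

Lemma rbE1 n : bE (rone n) = 1 :> raug n. Proof. by case: n. Qed.

Lemma rone_deg n : bdeg (rone n) = 0. Proof. by case: n => // n; apply: wdeg1. Qed.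

Lemma resolution_contraction : exists h : forall n, raug n -> raug n.+1,
  (forall n, contraction rface rhU (h n)) /\
  (forall n x i, (i <= n)%N -> rface n.+1 i.+1 (h n.+1 x) = h n (rface n i x)).
Proof.
have did n i j (x : raug n.+1) : (j <= i)%N -> (i <= j.+1)%N -> (j <= n)%N ->
  rface n.+1 i (rdegen n j x) = x := @face_degen_id _ _ S n i j x.
have dgt n i j (x : raug n.+2) : (j.+1 < i)%N -> (i <= n.+2)%N ->
    rface n.+2 i (rdegen n.+1 j x) = rdegen n j (rface n.+1 i.-1 x) :=
  @face_degen_gt _ _ S n i j x.
have dlt n i j (x : raug n.+2) : (i < j)%N -> (j <= n.+1)%N ->
    rface n.+2 i (rdegen n.+1 j x) = rdegen n j.-1 (rface n.+1 i x) :=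
  @face_degen_lt _ _ S n i j x.
have H := @exists_contraction P raug rface rdegen rface_swap did dgt dlt.
have {}H := H rhU rhU0 rhUD rhUN rface_hom rdegen_hom ralt_exact raug_onto.
exact: (H (inP G) rhUZ rhU1 rbasis rone rbE1 rone_deg).
Qed.

(** A derivation is the same as a Harrison cocycle of degree one. *)
Definition single n (D : raug n -> M) (w : seq (raug n)) : M :=
  if w is [:: x] then D x else 0.

Definition T_degree e n (D : raug n.+1 -> M) : Prop :=
  forall j x, rhU j x -> inM G (j + e) (D x).

(** The cocycles that represent classes of degree [e] in [T^(q - 1)]. *)
Definition Harr_rep e q (F : seq A -> M) : Prop :=
  cochain G (inA G) q e F /\ forall w, hoch *%R (fun a => a) F w = 0.

Lemma T_cochainP e n (D : raug n.+1 -> M) : T_cochain (S := S) (M := M) (n := n) D -> T_degree e D ->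
  gcochain G rhU e 1 (single D) /\ forall w, hd rrho (single D) w = 0.
Proof.
case=> DD DZ DM De.
have D1 : D 1 = 0.
  have := DM 1 1; rewrite mulr1 -rrhoE rmorph1 scale1r => /eqP.
  by rewrite -subr_eq0 opprD addNKr oppr_eq0 => /eqP.
split.
  split.
  - by case=> [|a [|b w]].
  - case=> [|c u] [|d v] p x y /=; rewrite ?scaler0 ?addr0 //.
    - by rewrite DD DZ.
    - by case: u; rewrite /= ?scaler0 ?addr0.
    by case: u; rewrite /= ?scaler0 ?addr0.
  - by case=> [|a [|b w]] //; rewrite inE => /eqP <-.
  - move=> [|a u] [|b v] // _ _; apply: sh_perm => w /perm_size.
    by case: w => [|c [|d w]] //=; rewrite size_cat /= addnS.
  case=> [|a [|b w]] j //=; try by move=> _; apply: inM0.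
  case=> i ai /eqP; rewrite subr_eq0 => /eqP ->.
  by rewrite addrC; apply: De.
move=> w; have [|sw] := eqVneq (size w) 2%N; last first.
  by apply: hoch_supported sw; case=> [|a [|b v]].
case: w => [|a [|b []]] // _.
have -> : hd rrho (single D) [:: a; b] =
  rrho n.+1 a *: D b - (D (a * b) - rrho n.+1 b *: D a) by [].
rewrite !rrhoE DM; zmodule.
Qed.

Lemma delta_single n (D : raug n.+1 -> M) w :
  delta rface (single D) w = if w is [:: x] then T_diff (S := S) (M := M) (n := n) D x else 0.
Proof.
case: w => [|x [|y w]].
- by rewrite /delta big1 // => i _; rewrite scaler0.
- by rewrite /delta big_mkord.
by rewrite /delta big1 // => i _; rewrite scaler0.
Qed.

Lemma T_cochain_of e n (f : seq (raug n.+1) -> M) : gcochain G rhU e 1 f ->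
  (forall w, hd rrho f w = 0) ->
  [/\ T_cochain (S := S) (M := M) (n := n) (fun x => f [:: x]), T_degree e (fun x => f [:: x]) &
      f = single (fun x => f [:: x])].
Proof.
case=> fs fl fn fh fd df; split.
- have f0 : f [:: 0] = 0.
    have := fl [::] [::] (-1) 1 1; rewrite /= !scaleN1r addNr => ->.
    by rewrite addNr.
  split=> [x y|p x|x y].
  + by have := fl [::] [::] 1 x y; rewrite /= !scale1r.
  + by have := fl [::] [::] p x 0; rewrite /= !addr0 f0 addr0.
  have := df [:: x; y]; rewrite -!rrhoE.
  have -> : hd rrho f [:: x; y] =
    rrho n.+1 x *: f [:: y] - (f [:: x * y] - rrho n.+1 y *: f [:: x]) by [].
  by move/eqP; rewrite subr_eq0 => /eqP ->; rewrite subrK.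
- move=> j x hx; rewrite addrC; apply: fd; exists j => //.
  by rewrite /= subrr.
by apply: funext; case=> [|x [|y w]] //; apply: fs.
Qed.

Lemma rpoly_exactness e n q (f : seq (raug n.+1) -> M) :
  gcochain G rhU e q.+2 f -> (forall w, hd rrho f w = 0) ->
  exists2 g, gcochain G rhU e q.+1 g & hd rrho g = f.
Proof. by apply: poly_exact => j x; apply: (@rrho_hom n.+1). Qed.

(** Cotangent cohomology of [A] and Harrison cohomology agree, in the form of a
relation between cocycles that is total on both sides and detects coboundaries. *)
Lemma T_represent e n (D : raug n.+1 -> M) : T_cocycle (S := S) (M := M) (n := n) D -> T_degree e D ->
  exists F, Harr_rep e n.+1 F /\
    zigzag rface rrho (gcochain G rhU e) F 1 (single D).
Proof.
case=> hD dD De; have [h [hP hf]] := resolution_contraction.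
have [cD zD] := T_cochainP hD De.
have [|F [cF dF zF]] := zigzag_represent rrho_face rhUM rrho_hom
  (fun n => ct_lin (hP n)) (fun n => ct_one (hP n))
  (fun n => ct_hom (hP n)) (fun n => ct_face (hP n)) hf cD zD.
  by move=> w; rewrite delta_single; case: w => [|x [|y w]].
by exists F; split=> //; rewrite -addn1.
Qed.

Lemma T_lift e n F : Harr_rep e n.+1 F ->
  exists D : raug n.+1 -> M, [/\ T_cocycle (S := S) (M := M) (n := n) D, T_degree e D &
    zigzag rface rrho (gcochain G rhU e) F 1 (single D)].
Proof.
case=> cF dF.
have [||f [cf df deltaf zf]] := @zigzag_lift _ _ _ _ _ rrho rface_swap rrho_face
  G rhU e rface_hom (rpoly_exactness (e := e)) n 0 F.
- by rewrite addn1.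
- exact: dF.
have [Tf Tdeg fE] := T_cochain_of cf df; exists (fun x => f [:: x]); split=> //.
  split=> // x; have := deltaf [:: x]; rewrite fE delta_single.
  by [].
by rewrite -fE.
Qed.

Lemma T_trivial e n (D : raug n.+1 -> M) :
  zigzag rface rrho (gcochain G rhU e) (fun=> 0) 1 (single D) ->
  T_coboundary_of (S := S) (M := M)
    (fun n' (E : raug n'.+1 -> M) => T_degree e E) (n := n) D.
Proof.
move/(zigzag_trivial rface_swap rrho_face rface_hom (rpoly_exactness (e := e))).
case: n D => [|n] D /=.
  by move=> D0 x; rewrite -[LHS]/(single D [:: x]) D0.
case=> u [cu du Du]; have [Tu Tdeg uE] := T_cochain_of cu du.
exists (fun x => u [:: x]); split=> // x.
by rewrite -[LHS]/(single D [:: x]) Du uE delta_single.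
Qed.

End Comparison.

(** * Values of cocycles on generators *)

Section ModuleBasis.
Variables (P : comNzRingType) (A : comAlgType P) (T : finType) (b : T -> A).
Hypothesis hb : module_basis b.

Definition mcoords (a : A) : {ffun T -> P} := sval (cid (hb a)).

Lemma mcoordsE a : a = \sum_i mcoords a i *: b i.
Proof. by rewrite /mcoords; case: (cid (hb a)) => c [] /=. Qed.

Lemma mcoords_unique a (c : T -> P) : a = \sum_i c i *: b i -> mcoords a =1 c.
Proof.
move=> ac i; have [c0 [_ c0u]] := hb a; have := mcoordsE a => /c0u e1.
have /c0u e2 : a = \sum_i [ffun i => c i] i *: b i.
  by rewrite ac; apply: eq_bigr => j _; rewrite ffunE.
by rewrite -e1 e2 ffunE.
Qed.

Variables (hP : int -> P -> Prop) (hA : int -> A -> Prop) (deg : T -> int).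
Hypothesis b_hom : forall i, hA (deg i) (b i).
Hypothesis coords_hom : forall j a i, hA j a -> hP (j - deg i) (mcoords a i).

Definition module_gbasis : gbasis hP hA.
Proof.
apply: (@GBasis _ _ _ _ T b mcoords (fun=> enum T) deg) => //.
- move=> p x y i; apply: (mcoords_unique (c := fun i => p * mcoords x i + mcoords y i)).
  rewrite {1}[x]mcoordsE {1}[y]mcoordsE scaler_sumr -big_split /=.
  by apply: eq_bigr => j _; rewrite scalerDl scalerA.
- by move=> x; apply: enum_uniq.
- by move=> x i; rewrite mem_enum.
- move=> i j; apply: (mcoords_unique (c := fun j => (i == j)%:R)).
  rewrite (bigD1 i) //= eqxx scale1r big1 ?addr0 // => l li.
  by rewrite eq_sym (negPf li) scale0r.
by move=> x; rewrite big_enum /= -mcoordsE.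
Defined.

End ModuleBasis.

Section MultilinearClosed.
Variables (P : comNzRingType) (A : comAlgType P) (M : lmodType A).
Variables (hP : int -> P -> Prop) (U : lmodType P) (hU : int -> U -> Prop).
Variable B : gbasis hP hU.
Variable Q : M -> Prop.
Hypothesis Q0 : Q 0.
Hypothesis QD : forall x y, Q x -> Q y -> Q (x + y).
Hypothesis QZ : forall p x, Q x -> Q (p%:A *: x).

(** A property of values that is stable under linear combinations can be checked on
basis words. *)
Lemma multilin_closed (f : seq U -> M) : multilin f ->
  (forall s, Q (f (map (@bE _ _ _ _ B) s))) -> forall w, Q (f w).
Proof.
move=> fl fQ w; rewrite -[w]/(map (@bE _ _ _ _ B) [::] ++ w).
elim: w [::] => [|a w IH] s; first by rewrite cats0.
rewrite (lin_bext B a (fl _ w)) /bext; apply: big_ind => // i _.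
by apply: QZ; have := IH (rcons s i); rewrite map_rcons !cat_rcons.
Qed.

End MultilinearClosed.

Section SquareZero.
Variables (P : comNzRingType) (A : comAlgType P) (k : nat) (z : 'I_k -> A).
Hypothesis hb : module_basis (with_one z).
Local Notation co := (mcoords hb).
Variable I : P -> Prop.
Hypothesis I0 : I 0.
Hypothesis ID : forall x y, I x -> I y -> I (x + y).
Hypothesis IN : forall x, I x -> I (- x).
Hypothesis IM : forall x y, I y -> I (x * y).
Hypothesis prod_I : forall i j t, I (co (z i * z j) t).

Lemma coD a a' t : co (a + a') t = co a t + co a' t.
Proof.
apply: (@mcoords_unique _ _ _ _ hb _ (fun t => co a t + co a' t)).
rewrite {1}[a](mcoordsE hb) {1}[a'](mcoordsE hb) -big_split /=.
by apply: eq_bigr => i _; rewrite scalerDl.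
Qed.

Lemma coZ p a t : co (p *: a) t = p * co a t.
Proof.
apply: (@mcoords_unique _ _ _ _ hb _ (fun t => p * co a t)).
rewrite {1}[a](mcoordsE hb) scaler_sumr.
by apply: eq_bigr => i _; rewrite scalerA.
Qed.

Lemma coN a t : co (- a) t = - co a t.
Proof. by rewrite -scaleN1r coZ mulN1r. Qed.

Lemma co_sum (J : Type) (s : seq J) (F : J -> A) t :
  co (\sum_(i <- s) F i) t = \sum_(i <- s) co (F i) t.
Proof.
have co0 : co 0 t = 0 by rewrite -(scale0r (0 : A)) coZ mul0r.
by elim/big_rec2: _ => // i y x _ <-; rewrite coD.
Qed.

Lemma co_basis i t : co (with_one z i) t = (i == t)%:R.
Proof.
apply: (@mcoords_unique _ _ _ _ hb _ (fun t => (i == t)%:R)).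
rewrite (bigD1 i) //= eqxx scale1r big1 ?addr0 // => l li.
by rewrite eq_sym (negPf li) scale0r.
Qed.

(** Multiplying by [z a] moves the coefficient of [1] to that of [z a], up to the
ideal [I]. *)
Lemma co_mul_z a x t : I (co (z a * x) t - (Some a == t)%:R * co x None).
Proof.
rewrite {1}[x](mcoordsE hb) mulr_sumr co_sum (bigD1 None) //=.
rewrite -scalerAr mulr1 coZ (co_basis (Some a)) mulrC addrAC subrr add0r.
apply: (big_ind I) => // -[i|] // _.
by rewrite -scalerAr coZ; apply/IM/prod_I.
Qed.

Lemma multilin_prodI (f : seq A -> A^o) i j w t : multilin f ->
  I (co (f (z i * z j :: w)) t).
Proof.
move=> fl; rewrite [z i * z j](mcoordsE hb).
rewrite (@linear_map_sum _ _ _ _ (fun x => f ([::] ++ x :: w)) _ _ _ _ (fl [::] w)).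
rewrite co_sum; apply: (big_ind I) => // l _.
by rewrite -[_ *: (_ : A^o)]/(_ * _) -scalerAl mul1r coZ mulrC; apply/IM/prod_I.
Qed.

(** All terms but the last contain a product of two generators; the last one is a
multiple of the last letter, which is not [t]. *)
Lemma hoch_tail_I (f : seq A -> A^o) i s t : multilin f ->
  Some (last i s) != t -> I (co (hoch_tail *%R (fun a => a) f (z i) (map z s)) t).
Proof.
elim: s i f => [|j s IH] i f fl /= it.
  have := co_mul_z i (f [::]) t; rewrite (negPf it) mul0r subr0.
  by [].
by rewrite coD coN; apply: ID; [exact: multilin_prodI | apply/IN/IH => //; apply: multilin_prep].
Qed.

(** If there are at least two generators [z i], the coefficient of [1] in a value
of a cocycle on generators lies in [I]: compare coefficients of [z a] in the
cocycle identity, with [a] different from the last index. *)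
Lemma cocycle_unit_coef (f : seq A -> A^o) i s : (1 < k)%N -> multilin f ->
  (forall w, hoch *%R (fun a => a) f w = 0) -> I (co (f (map z (i :: s))) None).
Proof.
move=> k2 fl df.
(* The coefficient of [z a] in the last term of the cocycle identity is in [I]. *)
have [a al] : exists a : 'I_k, last i s != a.
  pose a0 : 'I_k := Ordinal (ltnW k2); pose a1 : 'I_k := Ordinal k2.
  have [->|] := eqVneq (last i s) a0; last by exists a0.
  by exists a1.
have := df (map z (a :: i :: s)); rewrite /=.
move/eqP; rewrite subr_eq0 => /eqP/(congr1 (fun x => co x (Some a))).
have := co_mul_z a (f (map z (i :: s))) (Some a); rewrite eqxx mul1r => h1 h2.
have h3 : I (co (hoch_tail *%R (fun a => a) f (z a) (map z (i :: s))) (Some a)).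
  by apply: hoch_tail_I.
have -> : co (f (map z (i :: s))) None =
  - (co (z a * f (map z (i :: s))) (Some a) - co (f (map z (i :: s))) None)
  + co (z a * f (map z (i :: s))) (Some a) by ring.
apply: ID; first exact: IN.
by move: h2 h3; rewrite /= => <-.
Qed.

End SquareZero.

(** * Noether normalisations *)

Section GeneratedIdeals.
Variables (A : comNzRingType) (T : finType) (D : pred T) (e : T -> A).

Lemma ideal_genD x y :
  ideal_gen D e x -> ideal_gen D e y -> ideal_gen D e (x + y).
Proof.
case=> c -> [c' ->]; exists (fun i => c i + c' i); rewrite -big_split /=.
by apply: eq_bigr => i _; rewrite mulrDl.
Qed.

Lemma ideal_genM a x : ideal_gen D e x -> ideal_gen D e (a * x).
Proof.
case=> c ->; exists (fun i => a * c i); rewrite mulr_sumr.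
by apply: eq_bigr => i _; rewrite mulrA.
Qed.

Lemma ideal_gen0 : ideal_gen D e 0.
Proof. by exists (fun=> 0); rewrite big1 // => i _; rewrite mul0r. Qed.

Lemma ideal_genN x : ideal_gen D e x -> ideal_gen D e (- x).
Proof. by rewrite -mulN1r; apply: ideal_genM. Qed.

Lemma ideal_gen_mem i : D i -> ideal_gen D e (e i).
Proof.
move=> Di; exists (fun j => (j == i)%:R); rewrite (bigD1 i) //= eqxx mul1r.
by rewrite big1 ?addr0 // => j /andP[_ /negPf ->]; rewrite mul0r.
Qed.

Lemma ideal_gen_sum (J : Type) (s : seq J) (Q : pred J) (F : J -> A) :
  (forall j, Q j -> ideal_gen D e (F j)) -> ideal_gen D e (\sum_(j <- s | Q j) F j).
Proof. by apply: big_ind => [|x y]; [exact: ideal_gen0 | exact: ideal_genD]. Qed.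

End GeneratedIdeals.

Section NoetherNormalisation.
Variables (C : fieldType) (N d : nat) (P : comUnitRingType).
Variable phi : {rmorphism polyalg C 'I_N -> P}.
Variables (A : comUnitAlgType P) (hA : local_ring A) (z : 'I_d.-1 -> A).
Hypothesis hz : noether_normalisation phi z.

Let hb : module_basis (with_one z) := nn_basis hz.
Local Notation co := (mcoords hb).
Local Notation crd := (coordinates z (fun j : 'I_N => (phi (pvar C j))%:A)).

Lemma coef_unit (p : P) : (p%:A \is a @GRing.unit A) = (p \is a GRing.unit).
Proof.
apply/idP/idP => [pu|pu]; last first.
  apply/unitrPr; exists (p^-1)%:A.
  by rewrite -scalerAl mul1r scalerA mulrV // scale1r.
apply/unitrPr; exists (co ((p%:A)^-1) None).
have := mulrV pu; rewrite -scalerAl mul1r => /(congr1 (fun x => co x None)).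
by rewrite coZ => ->; have /= -> := co_basis hb None None.
Qed.

Lemma nonunitN (x : A) : nonunit x -> nonunit (- x).
Proof. by rewrite /nonunit unitrN. Qed.

Lemma nonunitM (a x : A) : nonunit x -> nonunit (a * x).
Proof. by rewrite /nonunit unitrM negb_and => ->; rewrite orbT. Qed.

Lemma nonunit0 : nonunit (0 : A).
Proof. by rewrite /nonunit unitr0. Qed.

Lemma unit_sub_nonunit (u x : A) :
  u \is a GRing.unit -> nonunit x -> x - u \is a GRing.unit.
Proof.
move=> uu nx; apply: contraT => nxu; move: uu; rewrite -unitrN -[- u](addKr x).
by move/negPn/negP; case; apply: hA; [exact: nonunitN | exact: nxu].
Qed.

Lemma base_nonunitD (p q : P) : nonunit p -> nonunit q -> nonunit (p + q).
Proof.
rewrite /nonunit -!coef_unit scalerDl; exact: hA.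
Qed.

Lemma coordinate_nonunit t : nonunit (crd t).
Proof. by have [gen _] := nn_coord hz; apply/gen/ideal_gen_mem. Qed.

(** An element of [P] vanishing at the origin is a fraction whose numerator has no
constant term. *)
Lemma base_maximal_ideal (p : P) : nonunit p ->
  ideal_gen predT (fun j : 'I_N => phi (pvar C j)) p.
Proof.
move=> np; have [f [g [g1 pgf]]] := lao_frac (nn_loc hz) p.
have gu := lao_unit (nn_loc hz) g1.
have f1 : f@_(mone) = 0.
  apply/eqP; apply: contraT => /(lao_unit (nn_loc hz)).
  by rewrite -pgf unitrM (negPf np).
have -> : p = (phi g)^-1 * phi f by rewrite -pgf mulrC mulrK.
apply: ideal_genM; rewrite [f]monalgE rmorph_sum; apply: ideal_gen_sum => m _.
have [->|m1] := eqVneq m mone.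
  by rewrite f1 monalgU0 rmorph0; apply: ideal_gen0.
have [j mj] : exists j, (0 < m j)%N.
  apply/existsP; move: m1; apply: contraNT; rewrite negb_exists => /forallP h.
  by apply/cmP => j; rewrite cm1; apply/eqP; rewrite -leqn0 leqNgt.
have -> : << f@_m *g m >> = << f@_m *g divcm m (ucm j) >> * pvar C j.
  by rewrite /pvar [RHS]malgM_def fgmulUU mulr1 mulmC mul_ucm_div.
by rewrite rmorphM; apply/ideal_genM/ideal_gen_mem.
Qed.

(** A product of two generators is a nonunit, so its coefficient of [1] is one too. If
its coefficient of some [z l] were a unit, one could solve for [z l] in terms of the
other generators, against minimality; for [i = j = l] the equation is
[(z l - c) * z l = ...] with [c] a unit, and [z l - c] is a unit as well. *)
Lemma product_coef_nonunit i j t : nonunit (co (z i * z j) t).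
Proof.
have prodE := mcoordsE hb (z i * z j); rewrite (bigD1 None) //= in prodE.
have c0 : nonunit (co (z i * z j) None).
  apply/negP; rewrite -coef_unit => cu.
  have := unit_sub_nonunit cu (nonunitM (z i) (coordinate_nonunit (inl j))).
  rewrite {1}prodE addrAC subrr add0r; apply/negP.
  rewrite -/(nonunit _); apply: (big_ind (@nonunit A)) => [|x y|[l|] // _].
  - exact: nonunit0.
  - exact: hA.
  rewrite -[with_one z _]mul1r scalerAl.
  exact/nonunitM/(coordinate_nonunit (inl l)).
case: t => [l|//]; apply/negP => cu.
have [_ /(_ (inl l))] := nn_coord hz; case; rewrite /=.
set J := ideal_gen _ _; have JD := @ideal_genD _ _ (predC1 (inl l)) crd.
have Jz m : m != l -> J (z m).
  move=> ml; apply: (@ideal_gen_mem _ _ (predC1 (inl l)) crd (inl m)).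
  by rewrite /=; apply: contra ml => /eqP[->].
have J0 : J (co (z i * z j) None)%:A.
  have [c ->] := base_maximal_ideal c0; rewrite scaler_suml.
  apply: ideal_gen_sum => m _; rewrite -scalerA.
  have -> (y : A) : c m *: y = (c m)%:A * y by rewrite -scalerAl mul1r.
  exact/ideal_genM/(@ideal_gen_mem _ _ (predC1 (inl l)) crd (inr m)).
have Jrest : J (z i * z j - co (z i * z j) (Some l) *: z l).
  rewrite {1}prodE (bigD1 (Some l)) //= addrCA addrAC subrr add0r.
  apply: JD => //; apply: ideal_gen_sum => -[m|] // /andP[_ ml].
  by rewrite -[with_one z _]mul1r scalerAl; apply/ideal_genM/Jz.
have uA : (co (z i * z j) (Some l))%:A \is a @GRing.unit A by rewrite coef_unit.
suff [u uu Ju] : exists2 u : A, u \is a GRing.unit & J (u * z l).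
  by rewrite -(mulKr uu (z l)); apply: ideal_genM.
have [jl|jl] := eqVneq j l; last first.
  exists ((co (z i * z j) (Some l))%:A) => //.
  rewrite -scalerAl mul1r -[_ *: z l](subKr (z i * z j)).
  by apply: JD; [exact/ideal_genM/Jz | exact: ideal_genN].
have [il|il] := eqVneq i l; last first.
  exists ((co (z i * z j) (Some l))%:A) => //.
  rewrite -scalerAl mul1r -[_ *: z l](subKr (z i * z j)).
  apply: JD; last exact: ideal_genN.
  by rewrite mulrC; apply/ideal_genM/Jz.
exists (z l - (co (z i * z j) (Some l))%:A).
  exact/unit_sub_nonunit/(coordinate_nonunit (inl l)).
by rewrite mulrBl -scalerAl mul1r; move: Jrest; rewrite il jl.
Qed.

(** On words in the [z i] the coefficient of [1] is a nonunit by [cocycle_unit_coef];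
multilinearity does the rest. *)
Lemma cocycle_maximal (f : seq A -> A^o) : (3 <= d)%N -> multilin f ->
  normalized 1 f -> f [::] = 0 -> (forall w, hoch *%R (fun a => a) f w = 0) ->
  forall w, nonunit (f w : A).
Proof.
move=> d3 fl fn f0 df.
pose B := @module_gbasis P A _ _ hb (fun _ _ => True) (fun _ _ => True) (fun=> 0)
  (fun _ => I) (fun _ _ _ _ => I).
apply: (@multilin_closed _ _ A^o _ _ _ B (@nonunit A)).
- exact: nonunit0.
- exact: hA.
- by move=> p x; apply: nonunitM.
- exact: fl.
move=> s; have [ns|] := boolP (None \in s).
  by rewrite fn; [exact: nonunit0 | apply/mapP; exists None].
move=> ns; have {ns}[s' ->] : exists s', s = map Some s'.
  elim: s ns => [|[i|] s IH] //; first by exists [::].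
  by rewrite inE => /IH[s' ->]; exists (i :: s').
rewrite -map_comp; case: s' => [|i s']; first by rewrite f0; apply: nonunit0.
have base_nonunitM (p q : P) : nonunit q -> nonunit (p * q).
  by rewrite /nonunit unitrM negb_and => ->; rewrite orbT.
have base_nonunitN (p : P) : nonunit p -> nonunit (- p) by rewrite /nonunit unitrN.
have base_nonunit0 : nonunit (0 : P) by rewrite /nonunit unitr0.
have d2 : (1 < d.-1)%N by lia.
have c0 := @cocycle_unit_coef P A _ z hb (@nonunit P) base_nonunit0 base_nonunitD
  base_nonunitN base_nonunitM product_coef_nonunit f i s' d2 fl df.
rewrite -[X in f X]/(map z (i :: s')) [f _](mcoordsE hb).
apply: (big_ind (@nonunit A)) => // [|[l|] _]; first exact: nonunit0.
  rewrite -[with_one z _]mul1r scalerAl.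
  exact/nonunitM/(coordinate_nonunit (inl l)).
by rewrite /nonunit coef_unit.
Qed.

End NoetherNormalisation.

(** * Cotangent cohomology with values in the maximal ideal *)

Section Ungraded.
Variables (P : comNzRingType) (A : comAlgType P) (quotient : nat -> P).
Hypothesis quotientP : forall n, n.+1%:R * quotient n.+1 = 1.

(** Every element has every degree. *)
Definition ungraded (M : lmodType A) : degrees M :=
  @Degrees P A M (fun _ _ => True) (fun _ _ => True) (fun _ _ => True) quotient
    (fun _ => I) I (fun _ => I) (fun _ _ _ _ _ => I) (fun _ _ _ => I)
    (fun _ _ _ _ _ _ => I) (fun _ _ _ => I) quotientP (fun _ => I).

Variables (S : simplicial_resolution A) (k : nat) (z : 'I_k -> A).
Hypothesis hb : module_basis (with_one z).

Lemma alt_ord n (x : raug S n.+1) :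
  alt (rface S) x = \sum_(i < n.+1) (-1) ^+ i * rface S n i x.
Proof. by rewrite /alt big_mkord. Qed.

Lemma ralt_exact n (x : raug S n.+1) : alt (rface S) x = 0 ->
  exists y, x = alt (rface S) y.
Proof.
rewrite alt_ord; case: n x => [|n] x x0.
  have [|y xy] := @exact0 _ _ S x; last by exists y; rewrite xy alt_ord.
  by move: x0; rewrite big_ord1 mul1r.
by have [y xy] := exactS x0; exists y; rewrite xy alt_ord.
Qed.

Section Coefficients.
Variable M : lmodType A.
Local Notation U := (rhU (S := S) (ungraded M) (fun _ _ => 0)).
Local Notation comparison F D :=
  (zigzag (rface S) (rrho S) (gcochain (ungraded M) U 0) F 1 (single D)).

Lemma ungraded_hom n j x : @U n j x.
Proof. by case: n x. Qed.

Lemma ungraded_represent n (D : raug S n.+1 -> M) :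
  T_cocycle (S := S) (M := M) (n := n) D ->
  exists F, Harr_rep (ungraded M) 0 n.+1 F /\ comparison F D.
Proof.
move=> hD; pose B := @module_gbasis P A _ _ hb (fun _ _ => True) (fun _ _ => True)
  (fun=> 0) (fun _ => I) (fun _ _ _ _ => I).
apply: (@T_represent P A S M (ungraded M) (fun _ _ => 0) _ _ _ _ _ _ _ _ _ _ _ _
  B None) => //.
- by move=> *; apply: ungraded_hom.
- move=> m j x _ /ralt_exact[y xy]; exists y => //; exact: ungraded_hom.
by move=> j x _; have [y yx] := augm_surj S x; exists y => //; apply: ungraded_hom.
Qed.

Lemma ungraded_lift n F : Harr_rep (ungraded M) 0 n.+1 F ->
  exists D : raug S n.+1 -> M,
    T_cocycle (S := S) (M := M) (n := n) D /\ comparison F D.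
Proof.
case/(T_lift (S := S) (wt := fun _ _ => 0)).
  by move=> *; apply: ungraded_hom.
by move=> D [hD _ zD]; exists D.
Qed.

Lemma ungraded_trivial n (D : raug S n.+1 -> M) :
  comparison (fun=> 0) D -> T_coboundary (S := S) (M := M) (n := n) D.
Proof.
move/T_trivial; rewrite /T_coboundary; case: n D => [|n] D /= h.
  by apply: h => *; apply: ungraded_hom.
case: h => [|E [hE _ DE]]; first by move=> *; apply: ungraded_hom.
by exists E.
Qed.

End Coefficients.
End Ungraded.

Section ValuesInMaximalIdeal.
Variables (C : numFieldType) (N d : nat) (P : comUnitRingType).
Variable phi : {rmorphism polyalg C 'I_N -> P}.
Variables (A : comUnitAlgType P) (hA : local_ring A) (z : 'I_d.-1 -> A).
Hypothesis hz : noether_normalisation phi z.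
Hypothesis hd : (3 <= d)%N.

Definition inv_nat (n : nat) : P := phi (n%:R^-1)%:A.

Lemma inv_natP n : n.+1%:R * inv_nat n.+1 = 1.
Proof.
rewrite /inv_nat -(rmorph_nat phi) -rmorphM mulr_natl scalerMnl -mulr_natl.
by rewrite divff ?pnatr_eq0 // scale1r rmorph1.
Qed.

Local Notation G := (ungraded inv_natP).

Lemma max_ideal_inclP a (x y : max_ideal hA) :
  max_ideal_incl (a *: x + y) = a *: max_ideal_incl x + max_ideal_incl y.
Proof. by []. Qed.

(** The values are nonunits by [cocycle_maximal]; as the inclusion of the maximal ideal
is injective, the cocycle conditions lift along it. *)
Lemma Harr_rep_maximal n (F : seq A -> A^o) : Harr_rep (G A^o) 0 n.+1 F ->
  exists E : seq A -> max_ideal hA,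
    Harr_rep (G (max_ideal hA)) 0 n.+1 E /\ F = fun w => max_ideal_incl (E w).
Proof.
case=> -[Fs Fl Fn Fh Fd] dF.
have FN w : F w \in nonunit_pred hA.
  rewrite unfold_in; apply: (cocycle_maximal hA hz hd Fl Fn _ dF).
  exact: Fs.
pose E w : max_ideal hA := exist _ (F w) (FN w).
have FE : F = fun w => max_ideal_incl (E w) by [].
exists E; split=> //.
have E0 (f : max_ideal hA) : max_ideal_incl f = 0 -> f = 0.
  by move=> f0; apply: val_inj.
split; last first.
  move=> w; apply: E0; rewrite -(coef_hoch max_ideal_inclP); exact: dF.
split=> //.
- by move=> w sw; apply/E0/Fs.
- by move=> u v p x y; apply: val_inj; apply: Fl.
- by move=> w w1; apply/E0/Fn.
by move=> u v u0 v0; apply: E0; rewrite -(coef_sh max_ideal_inclP); apply: Fh.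
Qed.

(** A cocycle is represented by a Harrison cocycle, which is lifted to the maximal
ideal and brought back to the resolution. *)
Lemma cotangent_maximal (S : simplicial_resolution A) n :
  T_map_surjective S (@max_ideal_incl A hA) n.
Proof.
move=> D hD.
have [F [hF FD]] := @ungraded_represent P A inv_nat inv_natP S _ z (nn_basis hz) A^o n D hD.
have [E [hE FE]] := Harr_rep_maximal hF.
have [D' [hD' ED]] := ungraded_lift S hE.
exists D'; split=> //; apply: (ungraded_trivial (quotientP := inv_natP)).
have ED' := @coef_zigzag P A (max_ideal hA) A^o (raug S) (rface S) (rrho S) _
  max_ideal_inclP _ (gcochain (G A^o) (rhU (G A^o) (fun _ _ => 0)) 0) _ n 1 _ _ ED.
have ED2 : zigzag (rface S) (rrho S)
    (gcochain (G A^o) (rhU (G A^o) (fun _ _ => 0)) 0) F 1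
    (single (fun x => max_ideal_incl (D' x))).
  rewrite FE; have -> : single (fun x => max_ideal_incl (D' x)) =
      fun w : seq (raug S n.+1) => max_ideal_incl (single (M := max_ideal hA) D' w).
    by apply: funext => -[|a [|b w]].
  apply: ED' => n0 q f; apply: (coef_cochain max_ideal_inclP); left.
  by [].
have := zigzagB FD ED2.
rewrite (_ : (fun w => F w - F w) = fun=> 0); last first.
  by apply: funext => w; rewrite subrr.
rewrite (_ : (fun w : seq (raug S n.+1) => _ - _) =
  single (S := S) (M := A^o) (n := n.+1) (fun x => D x - max_ideal_incl (D' x))) //.
by apply: funext => -[|a [|b w]] //=; rewrite subrr.
Qed.

End ValuesInMaximalIdeal.

(** * Components of a grading *)

(** The additive part of [Z_grading]. *)
Record graded_group (V : zmodType) (gr : int -> V -> Prop) : Prop := {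
  gg_0 : forall i, gr i 0;
  gg_B : forall i x y, gr i x -> gr i y -> gr i (x - y);
  gg_span : forall x, exists (s : seq int) (c : int -> V),
    (forall i, gr i (c i)) /\ x = \sum_(i <- s) c i;
  gg_free : forall (s : seq int) (c : int -> V), uniq s ->
    (forall i, gr i (c i)) -> \sum_(i <- s) c i = 0 ->
    forall i, i \in s -> c i = 0
}.

Section Components.
Variables (V : zmodType) (gr : int -> V -> Prop).
Hypothesis gV : graded_group gr.

Lemma ggN i x : gr i x -> gr i (- x).
Proof. by move=> hx; rewrite -sub0r; exact: (gg_B gV (gg_0 gV i) hx). Qed.

Lemma ggD i x y : gr i x -> gr i y -> gr i (x + y).
Proof. by move=> hx hy; rewrite -[y]opprK; exact: (gg_B gV hx (ggN hy)). Qed.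

Lemma gg_sum i (J : Type) (s : seq J) (Q : pred J) (F : J -> V) :
  (forall j, Q j -> gr i (F j)) -> gr i (\sum_(j <- s | Q j) F j).
Proof. by apply: big_ind => [|x y]; [exact: (gg_0 gV) | exact: ggD]. Qed.

(** The projection to the part of degree [i]; [component_eq] shows that it does not
depend on the chosen decomposition. *)
Definition component (i : int) (x : V) : V :=
  let s := sval (cid (gg_span gV x)) in
  \sum_(j <- s | j == i) sval (cid (svalP (cid (gg_span gV x)))) j.

Lemma sum_by_degree (s r : seq int) (c : int -> V) : uniq r -> {subset s <= r} ->
  \sum_(i <- s) c i = \sum_(i <- r) \sum_(j <- s | j == i) c j.
Proof.
move=> ur sr; under [RHS]eq_bigr => i _ do rewrite big_mkcond.
rewrite exchange_big /=; apply: eq_big_seq => j js.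
rewrite (bigD1_seq j) ?sr //= eqxx big1 ?addr0 // => i /negPf.
by rewrite eq_sym => ->.
Qed.

Lemma component_eq (s : seq int) (c : int -> V) i x : (forall i, gr i (c i)) ->
  x = \sum_(j <- s) c j -> component i x = \sum_(j <- s | j == i) c j.
Proof.
move=> hc xE; rewrite /component; move: (svalP (cid _)) => h.
move: (sval (cid (gg_span gV x))) h => s' h.
case: (cid h) => c' /= [hc' xE']; clear h.
pose r := undup (i :: s ++ s').
pose c0 i := \sum_(j <- s' | j == i) c' j - \sum_(j <- s | j == i) c j.
suff : c0 i = 0 by move/eqP; rewrite subr_eq0 => /eqP.
apply: (@gg_free _ _ gV r).
- exact: undup_uniq.
- by move=> j; apply: (gg_B gV); apply: gg_sum => k /eqP <-.
- rewrite sumrB -!sum_by_degree ?undup_uniq -?xE -?xE' ?subrr //.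
  + by move=> j js; rewrite mem_undup inE mem_cat js orbT.
  by move=> j js; rewrite mem_undup inE mem_cat js !orbT.
by rewrite mem_undup mem_head.
Qed.

Lemma component_homog i x : gr i (component i x).
Proof.
have [s [c [hc xE]]] := gg_span gV x; rewrite (component_eq _ hc xE).
by apply: gg_sum => j /eqP <-.
Qed.

Lemma component_sum x : exists2 r : seq int, uniq r &
  forall r', uniq r' -> {subset r <= r'} -> x = \sum_(i <- r') component i x.
Proof.
have [s [c [hc xE]]] := gg_span gV x; exists (undup s); first exact: undup_uniq.
move=> r' ur' sr'; rewrite {1}xE (@sum_by_degree s r') //.
  by apply: eq_bigr => i _; rewrite (component_eq _ hc xE).
by move=> i; rewrite -mem_undup; apply: sr'.
Qed.

Lemma component_id i j x : gr i x -> component j x = (if i == j then x else 0).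
Proof.
move=> xi; rewrite (@component_eq [:: i] (fun k => if k == i then x else 0)).
- by rewrite big_cons big_nil eqxx addr0.
- by move=> k; case: eqP => [->|_]; [exact: xi | exact: (gg_0 gV)].
by rewrite big_seq1 eqxx.
Qed.

Lemma componentB i x y : component i (x - y) = component i x - component i y.
Proof.
have [s [c [hc xE]]] := gg_span gV x; have [s' [c' [hc' yE]]] := gg_span gV y.
rewrite (component_eq i hc xE) (component_eq i hc' yE).
pose c0 i := \sum_(j <- s | j == i) c j - \sum_(j <- s' | j == i) c' j.
pose r := undup (i :: s ++ s').
rewrite (@component_eq r c0).
- rewrite -big_filter (_ : [seq j <- r | j == i] = [:: i]) ?big_seq1 //.
  by rewrite filter_pred1_uniq ?undup_uniq // mem_undup mem_head.
- by move=> j; apply: (gg_B gV); apply: gg_sum => l /eqP <-.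
rewrite sumrB -!sum_by_degree ?undup_uniq -?xE -?yE //.
  by move=> j js; rewrite mem_undup inE mem_cat js !orbT.
by move=> j js; rewrite mem_undup inE mem_cat js orbT.
Qed.

Lemma component0 i : component i 0 = 0.
Proof. by rewrite -{1}(subrr 0) componentB subrr. Qed.

Lemma componentD i x y : component i (x + y) = component i x + component i y.
Proof.
by rewrite -{1}[y]opprK -[- y]sub0r !componentB component0 sub0r opprK.
Qed.

Lemma component_big i (J : Type) (s : seq J) (F : J -> V) :
  component i (\sum_(j <- s) F j) = \sum_(j <- s) component i (F j).
Proof. by elim/big_rec2: _ => [|j x y _ <-]; rewrite ?component0 ?componentD. Qed.

End Components.

(** Projecting a solution of a homogeneous equation gives a homogeneous solution; this
is how exactness passes to the homogeneous parts. *)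
Lemma component_morph (V W : zmodType) (gr : int -> V -> Prop) (gr' : int -> W -> Prop)
    (gV : graded_group gr) (gW : graded_group gr') (g : V -> W) e i x :
  (forall x y, g (x - y) = g x - g y) -> (forall i x, gr i x -> gr' (i + e) (g x)) ->
  component gW (i + e) (g x) = g (component gV i x).
Proof.
move=> gB hg; have g0 : g 0 = 0 by rewrite -(subrr 0) gB subrr.
have gD y z : g (y + z) = g y + g z by rewrite -{1}[z]opprK -[- z]sub0r !gB g0 sub0r opprK.
have g_sum (s : seq int) (Q : pred int) (c : int -> V) :
    g (\sum_(j <- s | Q j) c j) = \sum_(j <- s | Q j) g (c j).
  by elim/big_rec2: _ => // j y z _ <-; rewrite gD.
have [s [c [hc xE]]] := gg_span gV x; rewrite (component_eq gV _ hc xE) g_sum.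
rewrite (@component_eq _ _ gW [seq j + e | j <- s] (fun j => g (c (j - e)))).
- rewrite big_map; apply: eq_big => [j|j _]; last by rewrite addrK.
  exact: (inj_eq (addIr e)).
- by move=> j; have := hg _ _ (hc (j - e)); rewrite subrK.
by rewrite {1}xE g_sum big_map; apply: eq_bigr => j _; rewrite addrK.
Qed.

Lemma spannedD (V : zmodType) (gr : int -> V -> Prop) (x y : V) :
  (forall i, gr i 0) -> (forall i x y, gr i x -> gr i y -> gr i (x + y)) ->
  (exists s c, (forall i, gr i (c i)) /\ x = \sum_(i <- s) c i) ->
  (exists s c, (forall i, gr i (c i)) /\ y = \sum_(i <- s) c i) ->
  exists (s : seq int) (c : int -> V), (forall i, gr i (c i)) /\ x + y = \sum_(i <- s) c i.
Proof.
move=> g0 gD [s [c [hc ->]]] [s' [c' [hc' ->]]]; pose r := undup (s ++ s').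
exists r, (fun i => \sum_(j <- s | j == i) c j + \sum_(j <- s' | j == i) c' j).
have gsum i (t : seq int) (b : int -> V) : (forall i, gr i (b i)) ->
    gr i (\sum_(j <- t | j == i) b j).
  by move=> hb; apply: big_ind => [|u v|j /eqP <-] //; apply: gD.
split=> [i|]; first by apply: gD; apply: gsum.
rewrite big_split /= -!sum_by_degree ?undup_uniq // => i is_; by
  rewrite mem_undup mem_cat is_ ?orbT.
Qed.

(** A polynomial is homogeneous when the degrees of its coefficients complement
those of the monomials. *)
Lemma malg_graded (V : nzRingType) (K : monomType) (wd : K -> int)
    (gr : int -> V -> Prop) : graded_group gr ->
  graded_group (fun j (f : {malg V[K]}) => forall m, gr (j - wd m) f@_m).
Proof.
move=> gV; have h0 i m : gr (i - wd m) (0 : {malg V[K]})@_m.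
  by rewrite mcoeff0; apply: gg_0.
split=> //.
- by move=> i x y hx hy m; rewrite mcoeffB; apply: (gg_B gV).
- move=> f; rewrite [f]monalgE.
  pose h j (f : {malg V[K]}) := forall m, gr (j - wd m) f@_m.
  pose spanned x := exists s c, (forall i, h i (c i)) /\ x = \sum_(i <- s) c i.
  apply: (big_ind spanned) => [|x y|m _].
  + by exists [::], (fun=> 0); rewrite big_nil; split=> // i m; exact: h0.
  + apply: spannedD => [i m|i u v hu hv m]; first exact: h0.
    by rewrite mcoeffD; apply: (ggD gV).
  have [s [c [hc ->]]] := gg_span gV f@_m.
  exists [seq i + wd m | i <- s], (fun i => << c (i - wd m) *g m >>); split.
    move=> i m'; rewrite mcoeffU; case: eqP => [<-|_] /=; last exact: (gg_0 gV).
    by rewrite mulr1n.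
  rewrite big_map; apply/malgP => m'; rewrite [LHS]mcoeffU [RHS]raddf_sum /= -sumrMnl.
  by apply: eq_bigr => i _; rewrite addrK mcoeffU.
move=> s c us hc c0 i is_; apply/malgP => m; rewrite mcoeff0.
have := @gg_free _ _ gV [seq i - wd m | i <- s] (fun i => (c (i + wd m))@_m).
rewrite map_inj_uniq; last exact: addIr.
move=> /(_ us) h; rewrite -(subrK (wd m) i).
apply: h.
- by move=> j; have := hc (j + wd m) m; rewrite addrK.
- transitivity ((\sum_(j <- s) c j)@_m); last by rewrite c0 mcoeff0.
  rewrite big_map [RHS]raddf_sum /=; by apply: eq_bigr => j _; rewrite subrK.
by apply: (map_f (fun i => i - wd m)).
Qed.

(** * The graded case *)

Section StandardGrading.
Variables (C : numFieldType) (N : nat).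
Notation P := (polyalg C 'I_N).
Local Notation homog := (@std_homog C N).

(** The grading of the coefficients for which the degree of a polynomial is that of its
monomials. *)
Definition concentrated (i : int) (c : C) : Prop := i != 0 -> c = 0.

Lemma concentrated_graded : graded_group concentrated.
Proof.
split=> // [i x y hx hy i0|x|s c us hc c0 i is_].
- by rewrite hx // hy // subrr.
- exists [:: 0], (fun i => if i == 0 then x else 0).
  by rewrite big_seq1 eqxx; split=> // i /negPf ->.
have [i0|/hc //] := eqVneq i 0; rewrite -c0 (bigD1_seq i) //= big1 ?addr0 // => j ji.
by apply: hc; rewrite -i0.
Qed.

Lemma std_homogP j (p : P) :
  homog j p <-> forall m, concentrated (j - (mdeg m)%:Z) p@_m.
Proof.
split=> [hp m jm|hp m].
  apply/eqP; rewrite mcoeff_eq0; apply: contra jm => /hp ->; by rewrite subrr.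
rewrite -mcoeff_neq0; have := hp m; rewrite /concentrated subr_eq0.
by case: eqP => [->//|_ ->]; rewrite ?eqxx.
Qed.

Lemma std_graded : graded_group homog.
Proof.
have [h0 hB hs hf] := malg_graded (K := {cmonom 'I_N}) (fun m => (mdeg m)%:Z)
  concentrated_graded.
split.
- by move=> i; apply/std_homogP; apply: h0.
- move=> i x y /std_homogP hx /std_homogP hy; apply/std_homogP; exact: hB.
- move=> x; have [s [c [hc xE]]] := hs x; exists s, c; split=> // i.
  exact/std_homogP/hc.
by move=> s c us hc; apply: hf => // i; apply/std_homogP.
Qed.

Lemma std_homog1 : homog 0 1.
Proof.
move=> m; rewrite -mcoeff_neq0 mcoeff1; case: (m =P mone) => [->|_]; last by rewrite eqxx.
by rewrite mdeg1.
Qed.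

Lemma std_homogZ c j p : homog j p -> homog j (c *: p).
Proof.
move=> hp m; rewrite -mcoeff_neq0 mcoeffZ mulf_eq0 negb_or mcoeff_neq0.
by case/andP => _; apply: hp.
Qed.

Lemma std_homogM i j p q : homog i p -> homog j q -> homog (i + j) (p * q).
Proof.
move=> hp hq m; rewrite -mcoeff_neq0 mcoeffMl; apply: contraTeq => mij.
rewrite negbK; apply/eqP; rewrite big_seq big1 // => k1 /hp k1i.
rewrite big_seq big1 // => k2 /hq k2j.
have [mE|_] := eqVneq (mmul k1 k2) m; last by rewrite mulr0n.
by move: mij; rewrite -mE mdegM PoszD k1i k2j eqxx.
Qed.

Lemma std_homog_neg j p : j < 0 -> homog j p -> p = 0.
Proof.
move=> j0 hp; apply/malgP => m; rewrite mcoeff0; apply/eqP; rewrite mcoeff_eq0.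
by apply/negP => /hp mj; move: j0; rewrite -mj.
Qed.

Lemma std_homog_pos j p : 0 < j -> homog j p -> p@_(mone) = 0.
Proof.
move=> j0 hp; apply/eqP; rewrite mcoeff_eq0; apply/negP => /hp.
by rewrite mdeg1 => mj; move: j0; rewrite -mj ltxx.
Qed.

Lemma std_homog_const p : homog 0 p -> p@_(mone) = 0 -> p = 0.
Proof.
move=> hp p0; apply/malgP => m; rewrite mcoeff0; apply/eqP; rewrite mcoeff_eq0.
apply/negP => mp; have := hp _ mp => -[] /eqP; rewrite mdeg_eq0 => /eqP m1.
by move: mp; rewrite -mcoeff_neq0 m1 p0 eqxx.
Qed.

End StandardGrading.

Section GradedModel.
Variables (C : numFieldType) (N k : nat).
Notation P := (polyalg C 'I_N).
Local Notation homog := (@std_homog C N).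
Variables (B : comAlgType P) (grB : int -> B -> Prop) (z : 'I_k -> B).
Hypothesis hgr : Z_grading grB.
Hypothesis base_hom : forall j p, homog j p -> grB j p%:A.
Hypothesis z_hom : forall i, grB 1 (z i).
Hypothesis hb : module_basis (with_one z).
Hypothesis hk : (1 < k)%N.
Local Notation co := (mcoords hb).

Lemma grB_graded : graded_group grB.
Proof. by case: hgr. Qed.

Lemma grBZ i j p x : homog i p -> grB j x -> grB (i + j) (p *: x).
Proof.
by move=> hp hx; rewrite -[x]mul1r scalerAl; apply: (zgr_M hgr) => //; apply: base_hom.
Qed.

Definition zdeg (t : option 'I_k) : int := if t is Some _ then 1 else 0.

Lemma with_one_hom t : grB (zdeg t) (with_one z t).
Proof. by case: t => [i|]; [exact: z_hom | exact: zgr_1]. Qed.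

(** The component of degree [j] of an expansion in the basis is obtained from the
components of the coefficients. *)
Lemma coords_hom j a t : grB j a -> homog (j - zdeg t) (co a t).
Proof.
move=> ha; pose c := component (std_graded C N).
have -> : co a t = c (j - zdeg t) (co a t); last exact: component_homog.
apply: (@mcoords_unique _ _ _ _ hb _ (fun t => c (j - zdeg t) (co a t))).
have aE : component grB_graded j a = a by rewrite (component_id _ _ ha) eqxx.
rewrite -[LHS]aE {1}[a](mcoordsE hb).
rewrite component_big; apply: eq_bigr => i _.
rewrite -[j in LHS](subrK (zdeg i)).
apply: (component_morph (std_graded C N) grB_graded (g := fun p => p *: with_one z i)).
  by move=> x y; rewrite scalerBl.
by move=> d p hp; apply: grBZ (with_one_hom i).
Qed.

Definition std_quotient (n : nat) : P := n%:R^-1%:A.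

Lemma std_quotientP n : n.+1%:R * std_quotient n.+1 = 1.
Proof. by rewrite mulr_natl scalerMnl -mulr_natl divff ?pnatr_eq0 // scale1r. Qed.

Lemma quotient_homog n : homog 0 (std_quotient n).
Proof. exact/std_homogZ/std_homog1. Qed.

Definition standard : degrees B^o :=
  @Degrees P B B^o homog grB grB std_quotient (gg_0 (std_graded C N)) (@std_homog1 C N)
    (gg_0 grB_graded) (ggD grB_graded) (ggN grB_graded) (zgr_M hgr) base_hom
    std_quotientP quotient_homog.

Definition zbasis : gbasis homog grB :=
  @module_gbasis P B _ _ hb homog grB zdeg with_one_hom coords_hom.

Lemma low_degree j x : j < 0 -> grB j x -> x = 0.
Proof.
move=> j0 hx; rewrite [x](mcoordsE hb) big1 // => t _.
rewrite (std_homog_neg _ (coords_hom (t := t) hx)) ?scale0r //.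
by case: t => [t|] /=; lia.
Qed.

Lemma z_prod_coef i j t : (co (z i * z j) t)@_(mone) = 0.
Proof.
have := coords_hom (t := t) (zgr_M hgr (z_hom i) (z_hom j)).
by apply: std_homog_pos; case: t.
Qed.

Lemma degree0_unit x : grB 0 x -> (co x None)@_(mone) = 0 -> x = 0.
Proof.
move=> hx x0; rewrite [x](mcoordsE hb) big1 // => -[t|] _.
  by rewrite (std_homog_neg _ (coords_hom (t := Some t) hx)) ?scale0r.
have := coords_hom (t := None) hx; rewrite subr0 => h.
by rewrite (std_homog_const h x0) scale0r.
Qed.

Lemma in_word_z s : in_word grB (map z s) (size s)%:Z.
Proof.
elim: s => [|i s IH] //=; exists 1; first exact: z_hom.
by rewrite -addn1 PoszD addrK.
Qed.

(** A cocycle of very negative degree can only be nonzero on words in the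
generators, where its values are constants; these are excluded by
[cocycle_unit_coef]. *)
Lemma cocycle_low_degree e n F : e < - n%:Z -> Harr_rep standard e n.+1 F ->
  F = fun=> 0.
Proof.
move=> en [[Fs Fl Fn Fh Fd] dF]; apply: funext.
apply: (multilin_eq (B := zbasis) Fl) => [u v p x y|s]; first by rewrite scaler0 addr0.
have [ns|ns] := boolP (None \in s).
  by apply: Fn; apply/mapP; exists None.
have {ns}[s' ->] : exists s', s = map Some s'.
  elim: s ns => [|[i|] s IH] //; first by exists [::].
  by rewrite inE => /IH[s' ->]; exists (i :: s').
rewrite -map_comp -[X in F X]/(map z s').
have [ss|ss] := eqVneq (size s') n.+1; last by apply: Fs; rewrite size_map.
have hF : grB (e + n.+1%:Z) (F (map z s')).
  by apply: Fd; rewrite -ss; apply: in_word_z.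
have [e0|e0] := eqVneq (e + n.+1%:Z) 0; last by apply: low_degree hF; lia.
(* The remaining case is [e = - n - 1], where the value is a constant. *)
rewrite e0 in hF; apply: degree0_unit => //; case: s' ss {hF} => [//|i s' _].
pose I (p : P) := p@_(mone) = 0.
apply: (@cocycle_unit_coef P B k z hb I) => //; rewrite /I.
- exact: mcoeff0.
- by move=> x y x0 y0; rewrite mcoeffD x0 y0 addr0.
- by move=> x x0; rewrite mcoeffN x0 oppr0.
- by move=> x y y0; rewrite rmorphM /= y0 mulr0.
exact: z_prod_coef.
Qed.

Local Notation comp := (component grB_graded).
Local Notation G0 := (@ungraded P B std_quotient std_quotientP B^o).
Local Notation wz := (map (with_one z)).

Lemma componentZ i j a x : grB i a -> comp (j + i) (a *: (x : B^o)) = a *: (comp j x : B^o).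
Proof.
move=> ha; apply: (component_morph _ _ (g := fun x : B => a * x)).
  by move=> x' y; rewrite mulrBr.
by move=> j' x' hx; rewrite addrC; apply: (zgr_M hgr).
Qed.

Definition word_deg (s : seq (option 'I_k)) : int := \sum_(t <- s) zdeg t.

(** The part of degree [e] of a multilinear map, as a map on basis words. *)
Definition part (F : seq B -> B^o) (e : int) : seq B -> B^o :=
  mext (B := zbasis) (fun s => comp (e + word_deg s) (F (wz s)) : B^o).

Lemma part_word F e w j : multilin F -> in_word grB w j ->
  part F e w = comp (e + j) (F w).
Proof.
move=> Fl; suff H s : in_word grB w j ->
    mext (B := zbasis) (fun s' => comp (e + word_deg (s ++ s')) (F (wz (s ++ s'))) : B^o) w =
    comp (e + word_deg s + j) (F (wz s ++ w)).
  by move/(H [::]); rewrite /word_deg big_nil addr0.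
elim: w s j => [|a w IH] s j /=.
  by move=> ->; rewrite !cats0 addr0.
case=> i ai wj.
have -> : F (wz s ++ a :: w) = bext (B := zbasis) (fun t => F (wz s ++ with_one z t :: w)) a.
  exact: (lin_bext zbasis a (Fl (wz s) w)).
rewrite /bext component_big; apply: eq_bigr => t _.
have hco := coords_hom (t := t) ai.
have -> : e + word_deg s + j = (e + word_deg (rcons s t) + (j - i)) + (i - zdeg t).
  by rewrite /word_deg -cats1 big_cat big_seq1 /=; ring.
rewrite componentZ; last exact: base_hom.
congr (_ *: _); rewrite -(cat_rcons _ (wz s)) -(map_rcons (with_one z) s t) -IH //.
by congr (mext _ w); apply: funext => s'; rewrite /prep cat_rcons.
Qed.

(** Taking the part of a given degree commutes with the differential. *)
Lemma hoch_component (F H : seq B -> B^o) e :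
  (forall w j, in_word grB w j -> H w = comp (e + j) (F w)) ->
  forall w j, in_word grB w j ->
    hoch *%R id H w = comp (e + j) (hoch *%R id F w).
Proof.
move=> HF w; elim: w F H e HF => [|a w IH] F H e HF j /=.
  by rewrite component0.
case=> i ai wj.
rewrite -[LHS]/(hoch *%R id H (a :: w)) -[X in comp _ X]/(hoch *%R id F (a :: w)).
rewrite !hoch_cons componentB; congr (_ - _); last first.
  rewrite (_ : e + j = (e + i) + (j - i)); last by ring.
  apply: IH wj => w' j' hw'; rewrite /prep -addrA; apply: HF.
  by exists i => //; rewrite addrAC subrr add0r.
case: w wj {IH} => [|b w] /=; first by rewrite component0.
case=> i' bi wj; rewrite componentB componentD.
congr (_ + _ - _).
- rewrite (_ : e + j = (e + (j - i)) + i); last by ring.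
  rewrite componentZ //; congr (_ *: _); apply: HF; exists i' => //.
- rewrite (_ : e + j = (e + (j - i')) + i'); last by ring.
  rewrite componentZ //; congr (_ *: _); apply: HF; exists i => //.
  by rewrite addrAC.
apply: HF; exists (i + i'); first exact: (zgr_M hgr).
by rewrite opprD addrA.
Qed.

Lemma basis_word_deg s : in_word grB (wz s) (word_deg s).
Proof.
elim: s => [|t s IH]; rewrite /word_deg ?big_nil // big_cons; exists (zdeg t).
  exact: with_one_hom.
by rewrite addrAC subrr add0r.
Qed.

Lemma part_cocycle F n e : Harr_rep G0 0 n.+1 F -> Harr_rep standard e n.+1 (part F e).
Proof.
case=> -[Fs Fl Fn Fh _] dF; split; last first.
  apply: (multilin_eq (B := zbasis)) => [|u v p x y|s].
  - apply: hoch_multilin; [by [] | exact: mext_multilin].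
  - by rewrite scaler0 addr0.
  rewrite (hoch_component (e := e) (F := F) _ (basis_word_deg s)) ?dF ?component0 //.
  by move=> w j; apply: part_word.
apply: (@mext_cochain P B B^o standard B grB zbasis None).
- by [].
- by move=> s ss; rewrite Fs ?component0 // size_map.
- by move=> s s1; rewrite Fn ?component0 //; apply/mapP; exists None.
- move=> u v u0 v0.
  transitivity (sh (M := B^o) u (fun s => comp (e + word_deg (u ++ v)) (F (wz s)) : B^o) v).
    by apply: sh_perm_eq => s ps; rewrite /word_deg (perm_big _ ps).
  have -> := @additive_sh B B^o B^o (fun x => comp (e + word_deg (u ++ v)) x) _ u v
    (fun s => F (wz s)) (componentB _ _).
  by rewrite sh_map Fh ?component0 // -?size_eq0 ?size_map ?size_eq0 //.
by move=> s; rewrite -/(word_deg s); apply: component_homog.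
Qed.

(** On basis words of the length of [F] only finitely many parts are nonzero, and there
are finitely many such words. *)
Lemma part_sum F n : Harr_rep G0 0 n.+1 F ->
  exists r : seq int, forall w, F w = \sum_(e <- r) part F e w.
Proof.
case=> -[Fs Fl _ _ _] _.
have /choice[deg degP] (x : B) : exists r : seq int, uniq r /\
    forall r', uniq r' -> {subset r <= r'} -> x = \sum_(i <- r') comp i x.
  by have [r ur rP] := component_sum grB_graded x; exists r.
pose r := undup (flatten [seq [seq i - word_deg s | i <- deg (F (wz s))]
  | s <- map (@tval _ _) (enum {: n.+1.-tuple (option 'I_k)})]).
exists r; apply: (multilin_eq (B := zbasis)) => // [u v p x y|s].
  rewrite scaler_sumr -big_split /=; apply: eq_bigr => e _.
  exact: mext_multilin.
have -> : \sum_(e <- r) part F e (map (@bE _ _ _ _ zbasis) s) =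
    \sum_(i <- [seq e + word_deg s | e <- r]) comp i (F (wz s)).
  by rewrite big_map; apply: eq_bigr => e _; rewrite /part mextE.
have [ss|ss] := eqVneq (size s) n.+1; last first.
  by rewrite big1 ?Fs ?size_map // => i _; rewrite component0.
apply: (degP (F (wz s))).2.
  by rewrite map_inj_uniq ?undup_uniq //; apply: addIr.
move=> i is_; rewrite -(subrK (word_deg s) i); apply: (map_f (fun e => e + word_deg s)).
rewrite mem_undup; apply/flattenP.
exists [seq j - word_deg s | j <- deg (F (wz s))]; last exact: (map_f (fun j => j - _)).
apply/mapP; exists s => //; apply/mapP.
by exists (tcast ss (in_tuple s)); rewrite ?mem_enum // val_tcast.
Qed.

Variables (S : simplicial_resolution B) (wt : forall n, gens S n -> int).
Hypothesis hS : graded_resolution homog grB wt.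
Local Notation U := (rhU (S := S) standard wt).

Lemma std_homogN j (p : P) : homog j p -> homog j (- p).
Proof. exact: (ggN (std_graded C N)). Qed.

Lemma std_homogD j (p q : P) : homog j p -> homog j q -> homog j (p + q).
Proof. exact: (ggD (std_graded C N)). Qed.

Lemma graded_face n i j x : (i <= n)%N -> @U n.+1 j x -> U j (rface S n i x).
Proof.
case: n x => [|n] x; last exact: (face_homog hS).
by rewrite leqn0 => /eqP ->; apply: (augm_homog hS).
Qed.

Lemma graded_degen n i j x : (i <= n)%N -> @U n.+1 j x -> U j (rdegen S n i x).
Proof. exact: (degen_homog hS). Qed.

Lemma resolution_graded n : graded_group (@U n).
Proof.
case: n => [|n]; first exact: grB_graded.
have [h0 hB hs hf] := malg_graded (K := {cmonom (gens S n)})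
  (fun m => wdeg (@wt n) m) (std_graded C N).
split.
- by move=> i; apply/poly_homogP/h0.
- move=> i x y /poly_homogP hx /poly_homogP hy; apply/poly_homogP; exact: hB.
- move=> x; have [s [c [hc xE]]] := hs x; exists s, c; split=> // i.
  exact/poly_homogP/hc.
by move=> s c us hc; apply: (hf s c us) => i m; apply: (proj1 (poly_homogP standard _ _ _) (hc i)).
Qed.

Lemma graded_exact n j x : @U n.+1 j x -> alt (rface S) x = 0 ->
  exists2 y, @U n.+2 j y & x = alt (rface S) y.
Proof.
move=> hx /ralt_exact[y xy]; exists (component (resolution_graded n.+2) j y).
  exact: component_homog.
have <- : component (resolution_graded n.+1) j x = x.
  by rewrite (component_id _ _ hx) eqxx.
rewrite xy -[j in LHS]addr0.
apply: (component_morph (resolution_graded n.+2) (resolution_graded n.+1)).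
  move=> u v; rewrite /alt -sumrB; apply: eq_bigr => i _.
  by rewrite raddfB mulrBr.
move=> i u hu; rewrite addr0 /alt big_mkord.
apply: (gg_sum (resolution_graded n.+1)) => m _.
have hm : @U n.+1 i (rface S n.+1 m u) by apply: graded_face => //; rewrite -ltnS.
rewrite -signr_odd; case: odd; rewrite ?mul1r ?mulN1r //.
exact: (ggN (resolution_graded n.+1)).
Qed.

Lemma graded_augmentation j x : @U 0 j x -> exists2 y, @U 1 j y & rface S 0 0 y = x.
Proof.
move=> hx; have [y yx] := augm_surj S x.
exists (component (resolution_graded 1) j y); first exact: component_homog.
have <- : component (resolution_graded 0) j x = x by rewrite (component_id _ _ hx) eqxx.
rewrite -yx -[j in RHS]addr0; apply/esym.
apply: (component_morph (resolution_graded 1) (resolution_graded 0) (g := augm S)).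
  exact: raddfB.
by move=> i u hu; rewrite addr0; apply: (augm_homog hS).
Qed.

Lemma graded_represent e n (D : raug S n.+1 -> B^o) :
  T_cocycle (S := S) (M := B^o) (n := n) D -> T_degree standard wt e D ->
  exists F, Harr_rep standard e n.+1 F /\
    zigzag (rface S) (rrho S) (gcochain standard U e) F 1 (single D).
Proof.
apply: (@T_represent P B S B^o standard wt std_homogD std_homogN (@std_homogM C N)
  (gg_0 (grB_graded)) (zgr_1 hgr) (ggD (grB_graded)) (ggN (grB_graded))
  (zgr_M hgr) graded_face graded_degen graded_exact graded_augmentation zbasis None) => //.
Qed.

(** A cocycle is represented by a Harrison cocycle, whose parts are lifted to
homogeneous cocycles on the resolution. *)
Lemma T_degrees n : T_in_degrees_ge homog grB wt n (- n%:Z).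
Proof.
split=> [D hD|e D en hD De]; last first.
  have [F [hF FD]] := graded_represent hD De.
  apply: (T_trivial (G := standard) graded_face); move: FD.
  by rewrite (cocycle_low_degree en hF).
have [F [hF FD]] := @ungraded_represent P B _ std_quotientP S k z hb B^o n D hD.
have [r Fr] := part_sum hF.
have /choice[E hE] (e : int) := T_lift (G := standard) graded_face
  (part_cocycle e hF).
exists r, E; split; first by move=> e; have [] := hE e.
apply: (ungraded_trivial (quotientP := std_quotientP)).
pose cochains := gcochain G0 (rhU (S := S) G0 (fun _ _ => 0)) 0.
have zE e : zigzag (rface S) (rrho S) cochains (part F e) 1
    (single (S := S) (M := B^o) (n := n.+1) (E e)).
  have [_ _] := hE e.
  apply: (coef_zigzag (phi := fun x => x)) => // m q f.
  by apply: (coef_cochain (phi := fun x => x)) => //; left.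
have := zigzagB FD (zigzag_sum r zE).
rewrite (_ : (fun w => F w - _) = fun=> 0); last first.
  by apply: funext => w; rewrite {1}Fr subrr.
rewrite (_ : (fun w : seq (raug S n.+1) => _ - _) =
  single (S := S) (M := B^o) (n := n.+1) (fun x => D x - \sum_(e <- r) E e x)) //.
by apply: funext => -[|a [|b w]] //=; rewrite big1 ?subrr.
Qed.

End GradedModel.

(** * The shuffle algebra *)

Section ShuffleAlgebra.
Variables (L : Type) (K : comNzRingType) (M : lmodType K).
Implicit Types (u v w x y : seq L) (f g : seq L -> M) (H : seq L -> seq L -> M).

Lemma sign_odd m n : odd m = odd n -> (-1) ^+ m = (-1) ^+ n :> K.
Proof. by rewrite -signr_odd => ->; rewrite signr_odd. Qed.

Lemma sh_ext f g u v :
  (forall w, size w = (size u + size v)%N -> f w = g w) -> sh u f v = sh u g v.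
Proof.
elim: u f g v => [|a u IHu] f g v fg; first by rewrite !sh0l fg.
elim: v f g fg => [|b v IHv] f g fg; first by rewrite !sh0r fg ?addn0.
rewrite !sh_cons (IHu (prep a f) (prep a g)) => [|w sw]; last first.
  by rewrite /prep fg //= sw.
by rewrite (IHv (prep b f) (prep b g)) // => w sw; rewrite /prep fg //= sw addnS.
Qed.

Lemma sh_comm u f v : sh u f v = (-1) ^+ (size u * size v) *: sh v f u.
Proof.
elim: u f v => [|a u IHu] f v; first by rewrite sh0l sh0r scale1r.
elim: v f => [|b v IHv] f; first by rewrite sh0l sh0r muln0 scale1r.
rewrite !sh_cons (IHu (prep a f)) (IHv (prep b f)) !scalerDr !scalerA -!exprD /=.
rewrite addrC; congr (_ *: _ + _ *: _); apply: sign_odd;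
  by rewrite !(oddM, oddD, oddS) /=; do 2?case: odd.
Qed.

Lemma sh_assoc u f v w :
  sh u (fun x => sh x f w) v = sh v (fun y => sh u f y) w.
Proof.
elim: u f v w => [|a u IHu] f v w; first by rewrite sh0l.
elim: v f w => [|b v IHv] f w; first by rewrite sh0r sh0l.
elim: w f => [|c w IHw] f.
  by rewrite [RHS]sh0r; apply: sh_ext => x _; rewrite sh0r.
have E1 : sh (a :: u) (fun x => sh x f (c :: w)) (b :: v) =
    sh u (fun x => sh x (prep a f) (c :: w)) (b :: v)
    + (-1) ^+ (size u).+1 *: sh (a :: u) (fun x => sh x (prep b f) (c :: w)) v
    + (-1) ^+ (size u + size v) *:
        sh (a :: u) (fun x => sh x (prep c f) w) (b :: v).
  rewrite !sh_cons.
  have -> : sh u (prep a (fun x => sh x f (c :: w))) (b :: v) =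
      sh u (fun x => sh x (prep a f) (c :: w)
        + (-1) ^+ (size u + size v) *: prep a (fun x => sh x (prep c f) w) x) (b :: v).
    apply: sh_ext => x sx; rewrite /prep sh_cons sx /=; congr (_ + _ *: _).
    by rewrite addnS !exprS !mulN1r opprK.
  have -> : sh (a :: u) (prep b (fun x => sh x f (c :: w))) v =
      sh (a :: u) (fun x => sh x (prep b f) (c :: w)
        + (-1) ^+ (size u + size v) *: prep b (fun x => sh x (prep c f) w) x) v.
    apply: sh_ext => x sx; rewrite /prep sh_cons sx /=; congr (_ + _ *: _).
    by rewrite addSn !exprS !mulN1r opprK.
  rewrite !(opD (sh_lin _ _)) !(opZ (sh_lin _ _)) !scalerDr.
  rewrite [_ *: (_ *: sh _ (prep b _) _)]scaleCA; zmodule.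
have E2 : sh (b :: v) (fun y => sh (a :: u) f y) (c :: w) =
    sh (b :: v) (fun y => sh u (prep a f) y) (c :: w)
    + (-1) ^+ (size u).+1 *: sh v (fun y => sh (a :: u) (prep b f) y) (c :: w)
    + (-1) ^+ (size u + size v) *: sh (b :: v) (fun y => sh (a :: u) (prep c f) y) w.
  rewrite !sh_cons.
  have -> d : prep d (fun y => sh (a :: u) f y) =
      fun y => prep d (fun y => sh u (prep a f) y) y
        + (-1) ^+ (size u).+1 *: sh (a :: u) (prep d f) y.
    by apply: funext => y; rewrite /prep sh_cons.
  rewrite !(opD (sh_lin _ _)) !(opZ (sh_lin _ _)) !scalerDr scalerA -exprD.
  rewrite (_ : (-1) ^+ ((size v).+1 + (size u).+1) = (-1) ^+ (size u + size v)).
    zmodule.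
  by apply: sign_odd; rewrite !(oddD, oddS) /=; do 2?case: odd.
by rewrite E1 E2 IHu IHv IHw.
Qed.

(** The sum over the deconcatenations of [w]. *)
Definition cut H w : M := \sum_(0 <= i < (size w).+1) H (take i w) (drop i w).

Lemma cut0 H : cut H [::] = H [::] [::].
Proof. by rewrite /cut big_nat1. Qed.

Lemma cut_cons H a w : cut H (a :: w) = H [::] (a :: w) + cut (fun x => H (a :: x)) w.
Proof. by rewrite /cut big_nat_recl. Qed.

Lemma cut_ext H H' w : (forall x y, x ++ y = w -> H x y = H' x y) -> cut H w = cut H' w.
Proof. by move=> h; apply: eq_bigr => i _; rewrite h // cat_take_drop. Qed.

Lemma cutD H H' w : cut (fun x y => H x y + H' x y) w = cut H w + cut H' w.
Proof. exact: big_split. Qed.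

Lemma cutZ c H w : cut (fun x y => c *: H x y) w = c *: cut H w.
Proof. by rewrite /cut scaler_sumr. Qed.

(** Deconcatenation is multiplicative for the shuffle product: a cut of a shuffle
consists of a cut of each of the two words. *)
Lemma sh_cut u H v : sh u (cut H) v =
  cut (fun u1 u2 => cut (fun v1 v2 => (-1) ^+ (size u2 * size v1) *:
    sh u1 (fun x => sh u2 (H x) v2) v1) v) u.
Proof.
elim: u H v => [|a u IHu] H v.
  by rewrite sh0l cut0; apply: cut_ext => x y _; rewrite mul0n scale1r !sh0l.
elim: v H => [|b v IHv] H.
  rewrite sh0r; apply: cut_ext => x y _.
  by rewrite cut0 muln0 scale1r sh0r sh0r.
pose Q H u1 u2 v1 v2 := (-1) ^+ (size u2 * size v1) *:
  sh u1 (fun x => sh u2 (H x) v2) v1.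
rewrite -/(Q H); pose Ha x := H (a :: x); pose Hb x := H (b :: x).
have prep_cut c : prep c (cut H) =
    fun w => prep c (H [::]) w + cut (fun x => H (c :: x)) w.
  by apply: funext => w; rewrite /prep cut_cons.
rewrite sh_cons !prep_cut !(opD (sh_lin _ _)) -/Ha -/Hb IHu IHv.
have E1 : cut (fun u1 u2 => cut (Q Ha u1 u2) (b :: v)) u =
    cut (fun u1 u2 => sh u2 (H (a :: u1)) (b :: v)) u
    + cut (fun u1 u2 => cut (fun v1 => Q Ha u1 u2 (b :: v1)) v) u.
  rewrite -cutD; apply: cut_ext => x y _; rewrite cut_cons; congr (_ + _).
  by rewrite /Q muln0 scale1r sh0r.
have E2 : cut (fun u1 u2 => cut (Q H u1 u2) (b :: v)) (a :: u) =
    sh (a :: u) (H [::]) (b :: v)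
    + cut (fun v1 v2 => (-1) ^+ ((size u).+1 * (size v1).+1) *:
             sh (a :: u) (H (b :: v1)) v2) v
    + cut (fun u1 u2 => sh u2 (H (a :: u1)) (b :: v)) u
    + cut (fun u1 u2 => cut (fun v1 => Q H (a :: u1) u2 (b :: v1)) v) u.
  have T1 : Q H [::] (a :: u) [::] (b :: v) = sh (a :: u) (H [::]) (b :: v).
    by rewrite /Q muln0 scale1r.
  have T2 : cut (fun u1 u2 => cut (Q H (a :: u1) u2) (b :: v)) u =
      cut (fun u1 u2 => sh u2 (H (a :: u1)) (b :: v)) u
      + cut (fun u1 u2 => cut (fun v1 => Q H (a :: u1) u2 (b :: v1)) v) u.
    rewrite -cutD; apply: cut_ext => x y _; rewrite cut_cons; congr (_ + _).
    by rewrite /Q muln0 scale1r sh0r.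
  by rewrite cut_cons cut_cons T1 T2 !addrA.
have E3 : cut (fun u1 u2 => cut (Q Hb u1 u2) v) (a :: u) =
    (-1) ^+ (size u).+1 *: cut (fun v1 v2 => (-1) ^+ ((size u).+1 * (size v1).+1) *:
             sh (a :: u) (H (b :: v1)) v2) v
    + cut (fun u1 u2 => cut (Q Hb (a :: u1) u2) v) u.
  rewrite cut_cons; congr (_ + _); rewrite -cutZ; apply: cut_ext => x y _.
  rewrite scalerA -exprD /Q sh0l; congr (_ *: _); apply: sign_odd.
  by rewrite !(oddM, oddD, oddS) /=; do 2?case: odd.
have E4 : cut (fun u1 u2 => cut (fun v1 => Q H (a :: u1) u2 (b :: v1)) v) u =
    cut (fun u1 u2 => cut (fun v1 => Q Ha u1 u2 (b :: v1)) v) u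
    + (-1) ^+ (size u).+1 *: cut (fun u1 u2 => cut (Q Hb (a :: u1) u2) v) u.
  rewrite -cutZ -cutD; apply: cut_ext => x y xy.
  rewrite -cutZ -cutD; apply: cut_ext => x' y' _.
  rewrite /Q sh_cons scalerDr !scalerA -!exprD; congr (_ + _ *: _).
  apply: sign_odd; rewrite -xy size_cat !(oddM, oddD, oddS) /=.
  by do 3?case: odd.
rewrite E1 E2 E3 E4 sh_cons !scalerDr signsK; zmodule.
Qed.

End ShuffleAlgebra.

(** * Adams operations *)

Section AdamsOperation.
Variables (L : eqType) (K : comNzRingType) (M : lmodType K).
Implicit Types (u v w x y : seq L) (f F : seq L -> M) (ws : seq (seq L)).

(** Precomposition with the second Adams operation, the composite of
deconcatenation and the shuffle product. *)
Definition adams F : seq L -> M := cut (fun x y => sh x F y).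

(** The Adams operations are ring endomorphisms of the shuffle algebra, by [sh_cut] and
commutativity. *)
Lemma adams_mul F w y :
  sh w (adams F) y = adams (fun v => adams (fun u => sh u F v) w) y.
Proof.
rewrite /adams sh_cut /cut exchange_big /=; apply: eq_bigr => j _.
rewrite (op_sum (sh_lin _ _)); apply: eq_bigr => i _.
move: (take i w) (drop i w) (take j y) (drop j y) => w1 w2 y1 y2.
have -> : (fun x => sh w2 (sh x F) y2) = fun x => sh x (fun x => sh x F y2) w2.
  by apply: funext => x; rewrite sh_assoc.
rewrite sh_assoc.
have -> : (fun v => sh w1 (fun u => sh u F v) w2) = fun v => sh w2 (fun x => sh w1 F x) v.
  by apply: funext => v; rewrite sh_assoc.
rewrite -[RHS]sh_assoc [RHS]sh_comm; congr (_ *: sh _ _ _).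
by apply: funext => x; rewrite -sh_assoc.
Qed.

(** The value of [F] at the shuffle product of the words [ws]. *)
Fixpoint msh ws F : M :=
  if ws is w :: ws' then msh ws' (fun y => sh w F y) else F [::].

Lemma msh_lin ws : oplin (msh ws).
Proof.
elim: ws => [|w ws IH] c f g //=; rewrite -IH; congr msh.
by apply: funext => y; rewrite (sh_lin w y).
Qed.

Definition proper ws := all (fun w => w != [::]) ws.

Definition kills_products k F := forall ws, proper ws -> (k <= size ws)%N -> msh ws F = 0.

Lemma supported_kills q F : supported q F -> kills_products q.+1 F.
Proof.
move=> Fq ws; elim: ws q F Fq => [|w ws IH] q F Fq //= /andP[w0 ws0] qs.
case: w w0 => [//|a w] _.
have size_sh u G v n : (forall x, size x = (size u + size v)%N -> G x = 0 :> M) ->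
  (size u + size v)%N = n -> sh u G v = 0.
  by move=> G0 _; rewrite (sh_ext (g := fun=> 0)) ?(op0 (sh_lin _ _)).
case: q Fq qs => [|q] Fq qs.
  rewrite (_ : (fun y => _) = fun=> 0) ?(op0 (msh_lin _)) //; apply: funext => y.
  by apply: size_sh => // x sx; apply: Fq; rewrite sx.
have [qw|wq] := leqP (size w) q; last first.
  rewrite (_ : (fun y => _) = fun=> 0) ?(op0 (msh_lin _)) //; apply: funext => y.
  by apply: size_sh => // x sx; apply: Fq; rewrite sx /= ; apply/eqP; lia.
apply: (IH (q - size w)%N) => //; last by lia.
move=> y sy; apply: size_sh => // x sx; apply: Fq; rewrite sx /=.
by apply: contra sy => /eqP; lia.
Qed.

Lemma adams_cons F a w :
  adams F (a :: w) = F (a :: w) *+ 2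
  + cut (fun x y => if y is [::] then 0 else sh (a :: x) F y) w.
Proof.
rewrite /adams cut_cons sh0l mulr2n -addrA; congr (_ + _).
rewrite /cut !big_nat_recr //= take_size drop_size sh0r addr0 addrC.
congr (_ + _); apply: eq_big_nat => i /andP[_ iw].
by case E : (drop i w) => //; move: iw; rewrite -subn_gt0 -size_drop E.
Qed.

(** On products of [k] words, the second Adams operation is multiplication by
[2 ^ k], up to products of more words. *)
Lemma msh_adams k F ws : kills_products k.+1 F -> proper ws -> size ws = k ->
  msh ws (adams F) = msh ws F *+ (2 ^ k).
Proof.
elim: k F ws => [|k IH] F [|w ws] //= Fk.
  by rewrite /adams cut0 sh0l.
case/andP=> w0 ws0 [sw]; pose F' y := adams (fun u => sh u F y) w.
have -> : (fun y => sh w (adams F) y) = adams F'.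
  by apply: funext => y; rewrite adams_mul.
case: w w0 @F' => [//|a w] _ F'.
have F'E : F' = fun y => sh (a :: w) F y *+ 2 +
    cut (fun x x' => if x' is [::] then 0 else
      sh (a :: x) (fun u => sh u F y) x') w.
  by apply: funext => y; rewrite /F' adams_cons.
pose T x x' y := if x' is [::] then 0 else sh (a :: x) (fun u => sh u F y) x'.
have T0 x x' ys : proper ys -> (k <= size ys)%N -> msh ys (T x x') = 0.
  move=> ys0 ks; rewrite /T; case: x' => [|b x']; first exact: (op0 (msh_lin _)).
  have -> : (fun y => sh (a :: x) (fun u => sh u F y) (b :: x')) =
     fun y => sh (b :: x') (fun z => sh (a :: x) F z) y.
    by apply: funext => y; rewrite sh_assoc.
  by apply: (Fk [:: a :: x, b :: x' & ys]).
have mF' ys : proper ys -> (k <= size ys)%N ->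
    msh ys F' = msh ys (fun y => sh (a :: w) F y) *+ 2.
  move=> ys0 ks; rewrite F'E (opD (msh_lin _)).
  have -> : msh ys (fun y => sh (a :: w) F y *+ 2) = msh ys (fun y => sh (a :: w) F y) *+ 2.
    by rewrite -scaler_nat -(opZ (msh_lin _)); congr msh; apply: funext => y;
       rewrite scaler_nat.
  have -> : msh ys (fun y => cut (fun x x' => T x x' y) w) = 0.
    by rewrite /cut (op_sum (msh_lin _)) big1 // => i _; apply: T0.
  by rewrite addr0.
rewrite (IH F') // => [|ys ys0 ks].
  by rewrite mF' ?sw // -mulrnA -expnS.
by rewrite mF' 1?ltnW // [msh _ _](Fk ((a :: w) :: ys)) // mul0rn.
Qed.

Hypothesis torsion_free : forall n (x : M), x *+ n.+1 = 0 -> x = 0.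

(** By descending induction on the number [k >= 2] of factors: on products of [k] words
the factors [2] and [2 ^ k] have to agree. *)
Lemma adams_harrison q F : supported q F -> (forall w, adams F w = F w *+ 2) ->
  harrison F.
Proof.
move=> Fq F2; (* Products of more than [q] nonempty words vanish for reasons of length. *)
suff H k : kills_products (q.+1 - k).+2 F.
  move=> u v u0 v0; have := H q.+1 [:: u; v]; rewrite subnn /= sh0r => -> //.
  by rewrite /proper /= u0 v0.
elim: k => [|k IH] ws ws0 ks.
  by apply: (supported_kills Fq); [|lia].
have [le|lt] := leqP (q.+1 - k).+2 (size ws); first exact: IH.
have [sq|sq] := leqP q.+1 (size ws); first exact: (supported_kills Fq).
have sws : size ws = (q.+1 - k).+1 by lia.
have := msh_adams (k := size ws) _ ws0 erefl; rewrite {1}sws => /(_ _ IH).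
rewrite (_ : adams F = fun w => 2%:R *: F w); last first.
  by apply: funext => w; rewrite F2 scaler_nat.
rewrite (opZ (msh_lin _)) scaler_nat => /eqP; rewrite eq_sym -subr_eq0 -mulrnBr; last first.
  by rewrite sws expnS leq_pmulr ?expn_gt0.
case E : (2 ^ size ws - 2)%N => [|m]; last by move/eqP/torsion_free.
have {}sws : size ws = (size ws - 2).+2 by lia.
by move: E; rewrite sws 2!expnS; have := expn_gt0 2 (size ws - 2); lia.
Qed.

End AdamsOperation.

(** * Normalization of Harrison cocycles *)

(** Inserting a unit in front of a marked letter. *)
Section UnitInsertion.
Variables (L : eqType) (mul : L -> L -> L) (one : L).
Hypothesis mulC : commutative mul.
Hypothesis mul1 : left_id one mul.
Variables (K : comNzRingType) (rho : L -> K).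
Hypothesis rho1 : rho one = 1.
Variable M : lmodType K.
Implicit Types (a b : L) (u v w : seq L) (f : seq L -> M).
Local Notation d := (hoch mul rho).

Definition insert_unit f w : M := insert (fun a => [:: (one, a)]) f w.

Lemma mark_unit (h : L -> seq L -> M) w :
  mark (fun a => [:: (one, a)]) h w = h one w *+ size w.
Proof. by elim: w h => [|a w IH] h //=; rewrite IH big_seq1 mulrS. Qed.

Lemma insert_unit_cons f a w :
  insert_unit f (a :: w) = f (one :: a :: w) *+ (size w).+1 - insert_unit (prep a f) w.
Proof.
by rewrite /insert_unit -[LHS]/(mark _ _ (a :: w) - _) mark_unit. Qed.

Lemma hoch_mulsize f w : d (fun x => f x *+ (size x).+1) w = d f w *+ size w.
Proof.
case: w => [|a w]; first by rewrite mulr0n.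
suff tailE k : hoch_tail mul rho (fun x => f x *+ (size x + k)) a w =
    hoch_tail mul rho f a w *+ (size w + k).
  rewrite /= mulrnBl -[_.+1]addn1 -tailE -scalerMnr addn1; congr (_ - _).
  by congr (hoch_tail _ _ _ _ _); apply: funext => x; rewrite addn1.
elim: w f a k => [|b w IH] f a k /=; first by rewrite scalerMnr.
rewrite mulrnBl; congr (_ - _); rewrite addSnnS -IH.
by congr (hoch_tail _ _ _ _ _); apply: funext => x; rewrite /prep /= addSnnS.
Qed.

(** The operator that [insert_unit] contracts. *)
Definition unit_laplace f w : M := d (insert_unit f) w + insert_unit (d f) w.

(** Most terms of the two composites cancel; what remains is, for every letter, a one
inserted in front of it and the differential of the part of the word starting there. *)
Lemma unit_laplace_cons f a w : unit_laplace f (a :: w) =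
  unit_laplace (prep a f) w + hoch_tail mul rho (prep one f) a w.
Proof.
have insB g g' x : insert_unit (fun y => g y - g' y) x = insert_unit g x - insert_unit g' x.
  exact: (opB (insert_lin _ _)).
have insD g g' x : insert_unit (fun y => g y + g' y) x = insert_unit g x + insert_unit g' x.
  exact: (opD (insert_lin _ _)).
have insZ c g x : insert_unit (fun y => c *: g y) x = c *: insert_unit g x.
  exact: (opZ (insert_lin _ _)).
pose f1 := prep one f; pose n := size w.
rewrite /unit_laplace hoch_cons insert_unit_cons.
have -> : prep a (insert_unit f) = fun x =>
    prep a f1 x *+ (size x).+1 - insert_unit (prep a f) x.
  by apply: funext => x; rewrite /prep insert_unit_cons.
have -> : prep a (d f) = fun x => hoch_comm mul rho a f x - d (prep a f) x.
  by apply: funext => x; rewrite /prep hoch_cons.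
rewrite (opB (hoch_lin _ _ _)) hoch_mulsize insB.
have -> : d f (one :: a :: w) = hoch_tail mul rho f1 a w.
  by rewrite /= mul1 rho1 scale1r opprB addrC subrK.
suff E : hoch_comm mul rho a (insert_unit f) w
    = insert_unit (hoch_comm mul rho a f) w + d (prep a f1) w *+ n
      - hoch_tail mul rho f1 a w *+ n.
  by rewrite E mulrS -/n; zmodule.
rewrite /n; case: w {n} => [|b v].
  by rewrite /insert_unit /= !mulr0n subr0 addr0.
have -> : insert_unit (hoch_comm mul rho a f) (b :: v) =
    rho a *: f1 (b :: v) *+ (size v).+1 -
    (rho a *: insert_unit (prep b f) v + rho b *: insert_unit (prep a f) v
     - insert_unit (prep (mul a b) f) v).
  rewrite insert_unit_cons -insZ -insZ -insD -insB; congr (_ - _).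
  by rewrite /= rho1 scale1r [mul a one]mulC mul1 addrK.
rewrite /hoch_comm !insert_unit_cons.
have -> : d (prep a f1) (b :: v) = rho b *: f1 (a :: v) - hoch_tail mul rho (prep a f1) b v.
  by [].
have -> : hoch_tail mul rho f1 a (b :: v) =
  f1 (mul a b :: v) - hoch_tail mul rho (prep a f1) b v by [].
rewrite [size (b :: v)]/= !mulrnBl !scalerBr !scalerMnr /f1 /prep; zmodule.
Qed.

End UnitInsertion.

Arguments insert_unit : simpl never.

Section Normalization.
Variables (P : comNzRingType) (A : comAlgType P) (k : nat) (z : 'I_k -> A).
Hypothesis hb : module_basis (with_one z).
Variable M : lmodType A.
Implicit Types (f G : seq A -> M) (s X : seq (option 'I_k)).
Local Notation b := (with_one z).
Local Notation d := (hoch *%R (fun a : A => a)).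
Local Notation T := (hoch_tail *%R (fun a : A => a)).

(** The sum of the positions of the letters [z i], counted from the right. *)
Fixpoint zweight s : nat :=
  if s is t :: s' then ((if t is Some _ then (size s').+1 else 0) + zweight s')%N else 0.

(** This is [1] if the initial run of ones has even length and [0] otherwise. *)
Fixpoint run_parity s : nat :=
  if s is None :: s' then 1 - run_parity s' else 1.

(** The sum of the lengths of the runs of ones, each halved and rounded up. *)
Fixpoint run_count s : nat :=
  if s is t :: s' then (run_count s' + if t is None then run_parity s' else 0)%N else 0.

Lemma multilin_basis0 G a v : multilin G -> (forall t, G (b t :: v) = 0) ->
  G (a :: v) = 0.
Proof.
move=> Gl G0; rewrite [a](mcoordsE hb).
rewrite (@linear_map_sum _ _ _ _ (fun x => G ([::] ++ x :: v)) _ _ _ _ (Gl [::] v)).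
by rewrite big1 // => t' _; rewrite /= G0 scaler0.
Qed.

(** In a term of the differential of a function that starts with an inserted one, the
letters after the one move to the right, and two letters merge or the last one is
dropped. The following three lemmas use that this does not raise [zweight], and that it
lowers it if the first letter is a [z i]. *)
Lemma tail_weak G t s : multilin G ->
  (forall X, size X = size s -> (zweight X <= zweight (t :: s))%N -> G (map b X) = 0) ->
  T G (b t) (map b s) = 0.
Proof.
elim: s G t => [|u s IH] G t Gl G0 /=; first by rewrite (G0 [::]) ?scaler0.
rewrite (IH (prep (b t) G)); first 1 last.
- exact: multilin_prep.
- by move=> X sX WX; apply: (G0 (t :: X)); rewrite /= ?sX //; move: WX => /=; case: t {G0}; lia.
rewrite subr0; case: t G0 => [i|] G0 /=; last first.
  by rewrite mul1r (G0 (u :: s)) //=; lia.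
case: u G0 => [j|] G0 /=; last first.
  by rewrite mulr1 (G0 (Some i :: s)) //=; lia.
apply: (multilin_basis0) => // t'; apply: (G0 (t' :: s)) => //=.
by case: t'; lia.
Qed.

Lemma tail_z G i s : multilin G ->
  (forall X, size X = size s -> (zweight X < zweight (Some i :: s))%N -> G (map b X) = 0) ->
  T G (z i) (map b s) = 0.
Proof.
case: s => [|u s] Gl G0 /=; first by rewrite (G0 [::]) ?scaler0.
rewrite (@tail_weak (prep (z i) G)); first 1 last.
- exact: multilin_prep.
- by move=> X sX WX; apply: (G0 (Some i :: X)); rewrite /= ?sX //; move: WX => /=; lia.
rewrite subr0; case: u G0 => [j|] G0 /=; last first.
  by rewrite mulr1 (G0 (Some i :: s)) //=; lia.
apply: (multilin_basis0) => // t'; apply: (G0 (t' :: s)) => //=.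
by case: t'; lia.
Qed.

Lemma tail_one G s : multilin G ->
  (forall X, size X = size s -> (zweight X < zweight s)%N -> G (map b X) = 0) ->
  T G 1 (map b s) = G (map b s) *+ run_parity s.
Proof.
elim: s G => [|u s IH] G Gl G0 /=; first by rewrite scale1r.
rewrite mul1r; case: u G0 => [i|] G0.
  rewrite (@tail_z (prep 1 G)) ?subr0 //; first exact: multilin_prep.
  by move=> X sX WX; apply: (G0 (None :: X)); rewrite /= ?sX.
rewrite /= (IH (prep 1 G)); first 1 last.
- exact: multilin_prep.
- by move=> X sX WX; apply: (G0 (None :: X)); rewrite /= ?sX.
have c1 : (run_parity s <= 1)%N by case: s {IH G0} => [|[]] //= s; apply: leq_subr.
by rewrite mulrnBr.
Qed.

Local Notation lap := (unit_laplace *%R 1 (fun a : A => a)).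

(** On words in the basis, the operator [unit_laplace] is triangular with respect
to [zweight]; its diagonal entries count ones. *)
Lemma unit_laplace_basis f s : multilin f ->
  (forall X, size X = size s -> None \in X -> (zweight X < zweight s)%N ->
     f (map b X) = 0) ->
  lap f (map b s) = f (map b s) *+ run_count s.
Proof.
elim: s f => [|t s IH] f fl f0; first by rewrite /unit_laplace /insert_unit /= addr0.
rewrite [map b (t :: s)]/= (unit_laplace_cons (@mulrC A) (@mul1r A)) //.
rewrite (IH (prep (b t) f)); first 1 last.
- exact: multilin_prep.
- move=> X sX X1 WX; apply: (f0 (t :: X)); rewrite ?inE ?X1 ?orbT //= sX //.
  by rewrite ltn_add2l.
rewrite /= mulrnDr; congr (_ + _); case: t f0 => [i|] f0.
  rewrite mulr0n (@tail_z (prep 1 f)) //; first exact: multilin_prep.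
  by move=> X sX WX; apply: (f0 (None :: X)); rewrite /= ?sX.
rewrite (@tail_one (prep 1 f)) //; first exact: multilin_prep.
by move=> X sX WX; apply: (f0 (None :: X)); rewrite /= ?sX.
Qed.

Lemma run_count_gt0 s : None \in s -> (0 < run_count s)%N.
Proof.
elim: s => [|[i|] s IH] //=; first by rewrite inE /= addn0.
by case: s {IH} => [|[i|] s] _ //=; [rewrite addn1|lia].
Qed.

Lemma run_parity_le1 s : (run_parity s <= 1)%N.
Proof. by case: s => [|[i|] s] //=; apply: leq_subr. Qed.

Lemma run_count_le s : (run_count s <= size s)%N.
Proof. by elim: s => [|[i|] s IH] //=; have := run_parity_le1 s; lia. Qed.

Lemma zweight_le s : (zweight s <= size s * size s)%N.
Proof. by elim: s => [|[i|] s IH] //=; nia. Qed.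

End Normalization.

Section NormalizedRepresentative.
Variables (P : comNzRingType) (A : comAlgType P) (k : nat) (z : 'I_k -> A).
Hypothesis hb : module_basis (with_one z).
Variable quotient : nat -> P.
Hypothesis quotientP : forall n, n.+1%:R * quotient n.+1 = 1.
Variable M : lmodType A.
Implicit Types (f g : seq A -> M) (s X : seq (option 'I_k)).
Local Notation b := (with_one z).
Local Notation d := (hoch *%R (fun a : A => a)).
Local Notation ins := (insert_unit 1).
Local Notation lap := (unit_laplace *%R 1 (fun a : A => a)).

(** Harrison cochains without the normalization. *)
Record hcochain q f : Prop := HCochain {
  hc_supp : supported q f;
  hc_lin : multilin f;
  hc_harr : harrison f
}.

Lemma hcochain_comb q (c : A) f g : hcochain q f -> hcochain q g ->
  hcochain q (fun w => c *: f w + g w).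
Proof.
case=> fs fl fh [gs gl gh]; split.
- by move=> w sw; rewrite fs // gs // scaler0 addr0.
- exact: multilin_comb.
by move=> u v u0 v0; rewrite (sh_lin u v) fh // gh // scaler0 addr0.
Qed.

Lemma hcochain0 q : hcochain q (fun=> 0).
Proof.
split=> // [u v p x y|u v _ _]; first by rewrite scaler0 addr0.
exact: (op0 (sh_lin _ _)).
Qed.

Lemma hcochain_hoch q f : hcochain q f -> hcochain q.+1 (d f).
Proof.
case=> fs fl fh; split; [exact: hoch_supported | | exact: (hoch_harrison _ (@mulrC A))].
by apply: (@hoch_multilin P A M A id).
Qed.

Lemma insert_unit_multilin f : multilin f -> multilin (ins f).
Proof.
move=> fl u v p x y; elim: u f fl => [|a u IH] f fl; rewrite ?cat_cons ?cat0s.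
  rewrite !insert_unit_cons; have /= -> := fl [:: 1] v p x y.
  rewrite (prep_lin _ _ _ fl) /insert_unit (insert_lin _ v) mulrnDl scalerBr scalerMnr.
  zmodule.
rewrite !insert_unit_cons; have /= -> := fl [:: 1, a & u] v p x y.
rewrite (IH (prep a f)); last exact: multilin_prep.
rewrite !size_cat mulrnDl scalerBr scalerMnr /=; zmodule.
Qed.

Lemma hcochain_insert q f : hcochain q.+1 f -> hcochain q (ins f).
Proof.
case=> fs fl fh; split; [|exact: insert_unit_multilin|].
  exact: insert_supported.
exact: insert_harrison.
Qed.

Local Notation basis := (@module_gbasis P A _ _ hb (fun _ _ => True) (fun _ _ => True)
  (fun=> 0) (fun _ => I) (fun _ _ _ _ => I)).

Lemma multilin_normalized f : multilin f ->
  (forall s, None \in s -> f (map b s) = 0) -> normalized 1 f.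
Proof.
move=> fl f0; have -> : f = mext (B := basis) (fun s => f (map b s)).
  apply: funext; apply: (multilin_eq (B := basis)) => // [|s].
    exact: mext_multilin.
  by rewrite mextE.
by apply: (@mext_normalized P A M (ungraded quotientP M) A _ basis None) => // s; apply: f0.
Qed.

(** Every Harrison cocycle is cohomologous to a normalized one. The words in the
basis containing a one are killed in the lexicographic order of their weights and
run counts. *)
Lemma exists_normalized q f : hcochain q.+1 f -> (forall w, d f w = 0) ->
  exists2 g, hcochain q g & normalized 1 (fun w => f w - d g w).
Proof.
(* Lexicographic order: on words of length [q.+1] the run count is at most [q.+1]. *)
move=> hf df; pose rank s := (zweight s * q.+3 + run_count s)%N.
suff H r : exists2 g, hcochain q g & forall s, None \in s -> (rank s < r)%N ->
    f (map b s) - d g (map b s) = 0.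
  have [g hg g0] := H (q.+1 * q.+1 * q.+3 + q.+3)%N; exists g => //.
  have hfg : hcochain q.+1 (fun w => -1 *: d g w + f w).
    by apply: hcochain_comb => //; apply: hcochain_hoch.
  have E : (fun w => f w - d g w) = fun w => -1 *: d g w + f w.
    by apply: funext => w; rewrite scaleN1r addrC.
  rewrite E; apply: multilin_normalized; first exact: hc_lin hfg.
  move=> s s1; have [ss|ss] := eqVneq (size s) q.+1; last first.
    by apply: (hc_supp hfg); rewrite size_map.
  rewrite scaleN1r addrC; apply: g0 => //; rewrite /rank.
  by have := zweight_le s; have := run_count_le s; rewrite ss; nia.
elim: r => [|r [g hg g0]]; first by exists (fun=> 0); [exact: hcochain0|].
(* Words of rank [r] have run count [r %% q.+3], which is positive. *)
case N0 : (r %% q.+3)%N => [|N].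
  exists g => // s s1; rewrite ltnS leq_eqVlt => /orP[/eqP rs|]; last exact: g0.
  have [ss|ss] := eqVneq (size s) q.+1; last first.
    by rewrite (hc_supp hf) ?(hc_supp (hcochain_hoch hg)) ?subr0 ?size_map.
  move: N0; rewrite -rs /rank modnMDl modn_small; last first.
    by have := run_count_le s; lia.
  by have := run_count_gt0 s1; case: run_count.
pose f' w := f w - d g w.
have E : f' = fun w => -1 *: d g w + f w.
  by apply: funext => w; rewrite scaleN1r addrC.
have hf' : hcochain q.+1 f' by rewrite E; apply: hcochain_comb => //; apply: hcochain_hoch.
have df' w : d f' w = 0.
  rewrite (opB (hoch_lin _ _ w)) df [d (d g) w]hoch_hoch ?subrr //.
  exact: mulrA.
pose c : A := (quotient N.+1)%:A.
have cN (x : M) : c *: (x *+ N.+1) = x.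
  rewrite -scaler_nat scalerA (_ : c * N.+1%:R = 1) ?scale1r //.
  by rewrite mulr_natr scalerMnl -mulr_natl quotientP scale1r.
have hg' : hcochain q (fun w => c *: ins f' w + g w).
  by apply: hcochain_comb => //; apply: hcochain_insert.
exists (fun w => c *: ins f' w + g w) => // s s1 rs.
have [ss|ss] := eqVneq (size s) q.+1; last first.
  by rewrite (hc_supp hf) ?(hc_supp (hcochain_hoch hg')) ?subr0 ?size_map.
rewrite (hoch_lin _ _ (map b s)).
have -> : d (ins f') (map b s) = lap f' (map b s).
  rewrite /unit_laplace (_ : d f' = fun=> 0); last exact: funext.
  by rewrite /insert_unit (op0 (insert_lin _ _)) addr0.
rewrite (unit_laplace_basis hb (hc_lin hf')); last first.
  move=> X sX X1 WX; apply: g0 => //; rewrite ltnS in rs; apply: leq_trans rs.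
  by have := run_count_le X; rewrite /rank sX ss; nia.
rewrite opprD addrCA; apply/eqP; rewrite addrC subr_eq0 -/(f' _); apply/eqP.
move: rs; rewrite ltnS leq_eqVlt => /orP[/eqP rs|rs]; last first.
  by rewrite /f' g0 // mul0rn scaler0.
suff -> : run_count s = N.+1 by rewrite cN.
move: N0; rewrite -rs /rank modnMDl modn_small //.
by have := run_count_le s; lia.
Qed.

End NormalizedRepresentative.

(** * Cochains on tuples *)

Section Shuffles.
Variables (A : nzRingType) (K : comNzRingType) (M : lmodType K).

Definition ffun_of n (w : seq A) : {ffun 'I_n -> A} := [ffun i : 'I_n => nth 0 w i].

Definition fcons n (x : A) (c : {ffun 'I_n -> A}) : {ffun 'I_n.+1 -> A} :=
  [ffun i => if unlift ord0 i is Some i' then c i' else x].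

Lemma ffun_of_cons n x w : ffun_of n.+1 (x :: w) = fcons x (ffun_of n w).
Proof.
apply/ffunP => i; rewrite !ffunE; case: unliftP => [j ->|->] //=.
by rewrite ffunE.
Qed.

(** A permutation is determined by the preimage of [0] and the rest. *)
Lemma lift_perm_bij n :
  bijective (fun jt : 'I_n.+1 * 'S_n => lift_perm jt.1 ord0 jt.2).
Proof.
apply: inj_card_bij; last by rewrite card_prod card_ord !card_Sn factS.
move=> [j t] [j' t'] /= e.
have jj' : j = j'.
  have := congr1 (fun s : 'S_n.+1 => (s^-1)%g ord0) e.
  by rewrite !lift_permV !lift_perm_id.
rewrite -{j'}jj' in e *; congr (_, _); apply/permP => i; apply: (@lift_inj _ ord0).
by rewrite -!(lift_perm_lift j) e.
Qed.

Lemma sum_lift_perm n (Q : pred 'S_n.+1) (F : 'S_n.+1 -> M) :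
  \sum_(s | Q s) F s = \sum_(j < n.+1) \sum_(t : 'S_n | Q (lift_perm j ord0 t))
    F (lift_perm j ord0 t).
Proof.
rewrite (reindex _ (onW_bij _ (lift_perm_bij n))) /=.
by rewrite (pair_big_dep xpredT (fun j t => Q (lift_perm j ord0 t))
  (fun j t => F (lift_perm j ord0 t))).
Qed.

Lemma is_shuffleP n p (s : 'S_n) :
  reflect (forall i j : 'I_n, (i < j)%N -> (j < p)%N || (p <= i)%N -> (s i < s j)%N)
    (is_shuffle p s).
Proof.
apply: (iffP forallP) => [h i j ij pij|h i].
  by have /forallP/(_ j) := h i; rewrite ij pij.
by apply/forallP => j; apply/implyP => /andP[ij pij]; apply: h.
Qed.

Lemma is_shuffle_first n p (t : 'S_n) :
  is_shuffle p.+1 (lift_perm ord0 ord0 t) = is_shuffle p t.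
Proof.
apply/is_shuffleP/is_shuffleP => h i j ij pij.
  have := h (lift ord0 i) (lift ord0 j); rewrite !lift_perm_lift !lift0 /= !ltnS.
  exact.
case: (unliftP ord0 j) ij pij => [j' ->|-> //].
case: (unliftP ord0 i) => [i' ->|->]; last by rewrite lift_perm_id lift_perm_lift.
by rewrite !lift_perm_lift !lift0 !ltnS; apply: h.
Qed.

Lemma is_shuffle_middle n (p : 'I_n.+1) (t : 'S_n) :
  is_shuffle p (lift_perm p ord0 t) = is_shuffle p t.
Proof.
apply/is_shuffleP/is_shuffleP => h i j ij pij.
  have := h (lift p i) (lift p j); rewrite !lift_perm_lift /= /bump !ltnS.
  by apply; lia.
case: (unliftP p j) ij pij => [j' ->|->] ij pij; last first.
  by move: pij; rewrite ltnn /= leqNgt ij.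
case: (unliftP p i) ij pij => [i' ->|->] ij pij; last by rewrite lift_perm_id lift_perm_lift.
rewrite !lift_perm_lift /= /bump !ltnS; move: ij pij; rewrite /= /bump => ij pij.
by apply: h; lia.
Qed.

Lemma is_shuffle_other n p (j : 'I_n.+1) (t : 'S_n) : (j : nat) != 0%N ->
  (j : nat) != p -> is_shuffle p (lift_perm j ord0 t) = false.
Proof.
move=> j0 jp; apply/negP => /is_shuffleP h.
have ji : (j.-1 < n.+1)%N by have := ltn_ord j; lia.
have := h (Ordinal ji) j; rewrite lift_perm_id ltn0 /= => H.
by suff : false by []; apply: H; lia.
Qed.

Lemma nth_lift n (j : 'I_n.+1) (i : 'I_n) (l : seq A) : size l = n.+1 ->
  nth 0 l (lift j i) = nth 0 (take j l ++ drop j.+1 l) i.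
Proof.
move=> sl; rewrite nth_cat size_take sl ltn_ord /= /bump.
have [ij|ji] := ltnP i j; first by rewrite nth_take.
by rewrite nth_drop; congr nth; lia.
Qed.

Lemma lift_term n (j : 'I_n.+1) (t : 'S_n) (l : seq A) (g : {ffun 'I_n.+1 -> A} -> M) :
  size l = n.+1 ->
  (-1) ^+ lift_perm j ord0 t *: g [ffun i => nth 0 l ((lift_perm j ord0 t)^-1%g i)] =
  (-1) ^+ j *: ((-1) ^+ t *: g (fcons (nth 0 l j)
    [ffun i => nth 0 (take j l ++ drop j.+1 l) (t^-1%g i)])).
Proof.
move=> sl; rewrite odd_lift_perm addbF signr_addb signr_odd scalerA.
congr (_ *: g _); apply/ffunP => i; rewrite !ffunE lift_permV.
case: unliftP => [i' ->|->]; last by rewrite lift_perm_id.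
by rewrite lift_perm_lift nth_lift // ffunE.
Qed.

(** The sum over shuffle permutations obeys the recursion of [sh]: the first letter
of a shuffle is the first letter of one of the two words. *)
Lemma shuffle_sum n p (l : seq A) (g : {ffun 'I_n -> A} -> M) : size l = n ->
  (p <= n)%N ->
  \sum_(s : 'S_n | is_shuffle p s) (-1) ^+ s *: g [ffun i => nth 0 l (s^-1%g i)] =
  sh (take p l) (fun w => g (ffun_of n w)) (drop p l).
Proof.
elim: n p l g => [|n IH] p l g sl pn.
  move/size0nil: sl => ->; rewrite leqn0 in pn; rewrite (eqP pn) sh0l.
  rewrite (big_pred1 1%g) => [|s]; last first.
    rewrite [RHS](_ : _ = true); first by apply/is_shuffleP => -[].
    by apply/eqP/permP => -[].
  by rewrite odd_perm1 scale1r; congr g; apply/ffunP => -[].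
rewrite sum_lift_perm; under eq_bigr => j _ do
  (under eq_bigr => t _ do rewrite (lift_term j t g sl); rewrite -scaler_sumr).
case: l sl => [//|x l] [sl].
case: p pn => [|p] pn.
  rewrite big_ord_recl [X in _ + X]big1 ?addr0 => [|j _]; last first.
    by rewrite big_pred0 ?scaler0 // => t; apply: is_shuffle_other.
  rewrite expr0 scale1r /= drop0; under eq_bigl => t do
    rewrite (is_shuffle_middle ord0).
  by rewrite (IH 0%N l (fun c => g (fcons x c))) // take0 drop0 !sh0l ffun_of_cons.
rewrite big_ord_recl /= drop0; under eq_bigl => t do rewrite is_shuffle_first.
rewrite expr0 scale1r (IH p l (fun c => g (fcons x c))) //.
have ffE w : g (fcons x (ffun_of n w)) = prep x (fun w => g (ffun_of n.+1 w)) w.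
  by rewrite /prep ffun_of_cons.
under [X in sh _ X _]funext => w do rewrite ffE.
case: (ltnP p n) => np; last first.
  have pE : p = n by apply/eqP; rewrite eqn_leq np andbT.
  rewrite big1 => [|j _].
    by rewrite addr0 drop_oversize ?sl ?pE // !sh0r.
  rewrite big_pred0 ?scaler0 // => t; apply: is_shuffle_other => //=.
  by rewrite /bump /= pE; have := ltn_ord j; lia.
rewrite (bigD1 (Ordinal np)) //= addrA [X in _ + X]big1 ?addr0; last first.
  move=> j jp; rewrite big_pred0 ?scaler0 // => t; apply: is_shuffle_other => //=.
pose q : 'I_n.+1 := Ordinal (np : p.+1 < n.+1)%N.
have qE : lift ord0 (Ordinal np) = q by apply: val_inj.
rewrite !qE /=; under [X in _ *: X]eq_bigl => t do rewrite (is_shuffle_middle q).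
rewrite (_ : bump 0 p = p.+1) // !add0n -[nat_of_ord q]/p.+1.
have sl' : size (x :: take p l ++ drop p.+1 l) = n.
  by rewrite /= size_cat size_take size_drop sl np; lia.
rewrite (IH p.+1 _ (fun c => g (fcons (nth 0 l p) c)) sl') //.
rewrite (drop_nth 0) ?sl // sh_cons size_take sl np; congr (_ + _ *: _).
rewrite /= take_cat drop_cat size_take sl np ltnn subnn take0 drop0 cats0.
by apply: sh_ext => w _; rewrite /prep ffun_of_cons.
Qed.

End Shuffles.

Section Words.
Variables (P : comNzRingType) (A : comAlgType P) (M : lmodType A).
Local Notation ffun_of := (@ffun_of A).

Definition list_of n (c : {ffun 'I_n -> A}) : seq A := [seq c i | i <- enum 'I_n].

Lemma size_list_of n (c : {ffun 'I_n -> A}) : size (list_of c) = n.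
Proof. by rewrite size_map size_enum_ord. Qed.

Lemma nth_list_of n (c : {ffun 'I_n -> A}) (i : 'I_n) : nth 0 (list_of c) i = c i.
Proof. by rewrite (nth_map i) ?size_enum_ord // nth_ord_enum. Qed.

Lemma list_ofK n (c : {ffun 'I_n -> A}) : ffun_of n (list_of c) = c.
Proof. by apply/ffunP => i; rewrite ffunE nth_list_of. Qed.

Lemma ffun_ofK n w : size w = n -> list_of (ffun_of n w) = w.
Proof.
move=> sw; apply: (@eq_from_nth _ 0); rewrite size_list_of // => j jw.
by rewrite -[j]/(nat_of_ord (Ordinal jw)) nth_list_of ffunE.
Qed.

(** A map on [n]-tuples, as a functional on words supported in length [n]. *)
Definition on_words n (f : {ffun 'I_n -> A} -> M) (w : seq A) : M :=
  if size w == n then f (ffun_of n w) else 0.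

Definition on_ffuns n (F : seq A -> M) (c : {ffun 'I_n -> A}) : M := F (list_of c).

Lemma on_words_list n (f : {ffun 'I_n -> A} -> M) c : on_words f (list_of c) = f c.
Proof. by rewrite /on_words size_list_of eqxx list_ofK. Qed.

Lemma on_words_supported n (f : {ffun 'I_n -> A} -> M) : supported n (on_words f).
Proof. by move=> w /negPf sw; rewrite /on_words sw. Qed.

Lemma list_of_upd n (c : {ffun 'I_n -> A}) i x :
  list_of (upd c i x) = take i (list_of c) ++ x :: drop i.+1 (list_of c).
Proof.
have si : size (take i (list_of c)) = i by rewrite size_take size_list_of ltn_ord.
apply: (@eq_from_nth _ 0); rewrite size_list_of.
  by rewrite size_cat si /= size_drop size_list_of; have := ltn_ord i; lia.
move=> j jn; rewrite -[j]/(nat_of_ord (Ordinal jn)) nth_list_of ffunE nth_cat si.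
rewrite -val_eqE /=; have [ji|ji|->] := ltngtP j i; last by rewrite subnn.
  by rewrite nth_take // -[j]/(nat_of_ord (Ordinal jn)) nth_list_of.
rewrite (_ : (j - i)%N = (j - i.+1).+1) /=; last by lia.
rewrite nth_drop (_ : (i.+1 + (j - i.+1))%N = j); last by lia.
by rewrite -[X in nth 0 _ X]/(nat_of_ord (Ordinal jn)) nth_list_of.
Qed.

Lemma on_ffuns_multilinear n F : multilin F -> multilinear (on_ffuns (n := n) F).
Proof. by move=> Fl c i p x y; rewrite /on_ffuns !list_of_upd Fl. Qed.

Lemma on_words_multilin n (f : {ffun 'I_n -> A} -> M) : multilinear f -> multilin (on_words f).
Proof.
move=> fl u v p x y; rewrite /on_words !size_cat /=.
case: eqP => [sn|_]; last by rewrite scaler0 addr0.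
have un : (size u < n)%N by rewrite -sn addnS ltnS leq_addr.
have E t : ffun_of n (u ++ t :: v) = upd (ffun_of n (u ++ 0 :: v)) (Ordinal un) t.
  apply/ffunP => i; rewrite !ffunE -val_eqE /= !nth_cat.
  by case: ltngtP => // [ui|->]; [rewrite -(subnSK ui)|rewrite subnn].
by rewrite (E (p *: x + y)) (E x) (E y) fl.
Qed.

Lemma eval_shE n (F : seq A -> M) (c : {ffun 'I_n -> A}) :
  eval_sh (on_ffuns F) c =
  \sum_(1 <= p < n) sh (take p (list_of c)) F (drop p (list_of c)).
Proof.
apply: eq_big_nat => p /andP[_ pn].
rewrite (sh_ext (g := fun w => on_ffuns (n := n) F (ffun_of n w))) => [|w sw].
  rewrite -shuffle_sum ?size_list_of ?(ltnW pn) //; apply: eq_bigr => s _.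
  have -> : [ffun i => c (s^-1%g i)] = [ffun i => nth 0 (list_of c) (s^-1%g i)].
    by apply/ffunP => i; rewrite !ffunE nth_list_of.
  by [].
rewrite /on_ffuns ffun_ofK // sw -size_cat cat_take_drop size_list_of //.
Qed.

Definition merge_words k (w : seq A) : seq A :=
  take k w ++ nth 0 w k * nth 0 w k.+1 :: drop k.+2 w.

Lemma hoch_tailE (F : seq A -> M) a w :
  hoch_tail *%R (fun x : A => x) F a w =
  \sum_(k < size w) (-1) ^+ k *: F (merge_words k (a :: w))
  + (-1) ^+ size w *: (last a w *: F (belast a w)).
Proof.
elim: w F a => [|b w IH] F a; first by rewrite big_ord0 add0r scale1r.
rewrite /= (IH (prep a F)) big_ord_recl /= expr0 scale1r opprD addrA.
rewrite [(-1) ^+ _.+1]exprS mulN1r scaleNr /merge_words /= drop0; congr (_ + _ - _).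
rewrite -sumrN; apply: eq_bigr => k _.
by rewrite /bump /= add1n exprS mulN1r scaleNr.
Qed.

Lemma list_of_merge n (c : {ffun 'I_n.+1 -> A}) (k : 'I_n) :
  list_of (Defs.merge c k) = merge_words k (list_of c).
Proof.
have kn := ltn_ord k; have kn1 : (k < n.+1)%N by lia.
have sk : size (take k (list_of c)) = k by rewrite size_take size_list_of kn1.
have nthE i (ni : (i < n.+1)%N) : nth 0 (list_of c) i = c (Ordinal ni).
  by rewrite -nth_list_of.
have eqc (i i' : 'I_n.+1) : i = i' :> nat -> c i = c i'.
  by move=> e; congr (c _); apply: val_inj.
apply: (@eq_from_nth _ 0); rewrite size_list_of.
  by rewrite size_cat sk /= size_drop size_list_of; lia.
move=> j jn; rewrite -[j]/(nat_of_ord (Ordinal jn)) nth_list_of ffunE nth_cat sk.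
rewrite -val_eqE /=; have [jk|jk|jk] := ltngtP j k.
- have j1 : (j < n.+1)%N by lia.
  by rewrite nth_take // (nthE _ j1); apply: eqc; rewrite /= /bump; lia.
- have j1 : (j.+1 < n.+1)%N by lia.
  rewrite (_ : (j - k)%N = (j - k.+1).+1) /=; last by lia.
  rewrite nth_drop (_ : (k.+2 + (j - k.+1))%N = j.+1); last by lia.
  by rewrite (nthE _ j1); apply: eqc.
have k2 : (k.+1 < n.+1)%N by lia.
have -> : (j - k = 0)%N by rewrite jk subnn.
rewrite /= (nthE _ kn1) (nthE _ k2); congr (_ * _); apply: eqc; rewrite /= /bump /=; lia.
Qed.

Lemma list_of_cons n (c : {ffun 'I_n.+1 -> A}) :
  list_of c = c ord0 :: list_of [ffun i => c (lift ord0 i)].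
Proof.
rewrite /list_of enum_ordSl /= -map_comp; congr (_ :: _).
by apply: eq_map => i; rewrite ffunE.
Qed.

Lemma list_of_rcons n (c : {ffun 'I_n.+1 -> A}) :
  list_of c = rcons (list_of [ffun i => c (lift ord_max i)]) (c ord_max).
Proof.
rewrite /list_of enum_ordSr map_rcons -map_comp; congr (rcons _ _).
apply: eq_map => i; rewrite ffunE /=; congr (c _); apply: val_inj.
by rewrite /= /bump leqNgt (ltn_ord i).
Qed.

Lemma hochschild_diffE n (F : seq A -> M) (c : {ffun 'I_n.+1 -> A}) :
  hochschild_diff (on_ffuns (n := n) F) c = hoch *%R (fun x : A => x) F (list_of c).
Proof.
rewrite /hochschild_diff list_of_cons /hoch /on_ffuns hoch_tailE opprD addrA.
rewrite -list_of_cons size_list_of; congr (_ + _ + _).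
  rewrite -sumrN; apply: eq_bigr => k _.
  by rewrite list_of_merge exprS mulN1r scaleNr.
rewrite exprS mulN1r scaleNr; congr (- (_ *: _)).
have := list_of_rcons c; rewrite {1}list_of_cons lastI => /rcons_inj[-> ->].
by [].
Qed.

End Words.

(** * Harrison cohomology with values in the maximal ideal *)

Section HarrisonCochains.
Variables (P : comNzRingType) (A : comAlgType P) (M : lmodType A).

Lemma Harr_cochain_of_words n (F : seq A -> M) : hcochain n F ->
  Harr_cochain (on_ffuns (n := n) F).
Proof.
case=> Fs Fl Fh; split; first exact: on_ffuns_multilinear.
move=> c; rewrite eval_shE big_nat_cond big1 // => p /andP[/andP[p0 pn] _].
apply: Fh; rewrite -size_eq0 ?size_take ?size_drop size_list_of ?pn; lia.
Qed.

Hypothesis torsion_free : forall n (x : M), x *+ n.+1 = 0 -> x = 0.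

(** The sum over all shuffles is the second Adams operation minus the two trivial
deconcatenations. *)
Lemma words_of_Harr_cochain n (f : {ffun 'I_n.+1 -> A} -> M) : Harr_cochain f ->
  hcochain n.+1 (on_words f).
Proof.
case=> fl fh; split; [exact: on_words_supported | exact: on_words_multilin |].
apply: (adams_harrison torsion_free (@on_words_supported _ _ _ _ f)) => w.
have [sw|sw] := eqVneq (size w) n.+1; last first.
  rewrite on_words_supported // mul0rn /adams /cut big1 // => i _.
  rewrite (sh_ext (g := fun=> 0)) ?(op0 (sh_lin _ _)) // => x sx.
  by apply: on_words_supported; rewrite sx -size_cat cat_take_drop.
have fE : on_ffuns (n := n.+1) (on_words f) = f.
  by apply: funext => c; rewrite /on_ffuns on_words_list.
have h : eval_sh (on_ffuns (on_words f)) (ffun_of n.+1 w) = 0 by rewrite fE.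
rewrite eval_shE ffun_ofK // in h.
rewrite /adams /cut sw big_ltn // big_nat_recr //= h add0r.
by rewrite take0 drop0 sh0l take_oversize ?drop_oversize ?sw // sh0r mulr2n.
Qed.

Lemma words_cocycle n (f : {ffun 'I_n.+1 -> A} -> M) :
  hcochain n.+1 (on_words f) -> (forall c, hochschild_diff f c = 0) ->
  forall w, hoch *%R (fun a : A => a) (on_words f) w = 0.
Proof.
move=> hf df w; have [sw|sw] := eqVneq (size w) n.+2; last first.
  exact: (hc_supp (hcochain_hoch hf)).
rewrite -(ffun_ofK sw) -hochschild_diffE.
have -> : on_ffuns (n := n.+1) (on_words f) = f; last exact: df.
by apply: funext => c; rewrite /on_ffuns on_words_list.
Qed.

End HarrisonCochains.

Section HarrisonMaximal.
Variables (C : numFieldType) (N d : nat) (P : comUnitRingType).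
Variable phi : {rmorphism polyalg C 'I_N -> P}.
Variables (A : comUnitAlgType P) (hA : local_ring A) (z : 'I_d.-1 -> A).
Hypothesis hz : noether_normalisation phi z.
Hypothesis hd : (3 <= d)%N.
Local Notation quotientP := (inv_natP phi).

Lemma algebra_torsion_free n (x : A^o) : x *+ n.+1 = 0 -> x = 0.
Proof.
move=> x0; have c1 : (inv_nat phi n.+1)%:A * n.+1%:R = 1 :> A.
  by rewrite mulr_natr scalerMnl -mulr_natl quotientP scale1r.
by rewrite -[x]scale1r -c1 -scalerA scaler_nat x0 scaler0.
Qed.

(** The coboundary subtracted is the one that normalizes [f]. *)
Lemma harrison_maximal n (f : {ffun 'I_n.+1 -> A} -> A^o) : Harr_cocycle f ->
  exists g : {ffun 'I_n.+1 -> A} -> max_ideal hA,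
    Harr_cocycle g /\ Harr_coboundary (fun a => f a - max_ideal_incl (g a)).
Proof.
case=> fh df; have hF := words_of_Harr_cochain algebra_torsion_free fh.
have dF := words_cocycle hF df.
have [g hg gn] := exists_normalized (nn_basis hz) quotientP hF dF.
pose F' w := on_words f w - hoch *%R (fun a : A => a) g w.
have hF' : hcochain n.+1 F'.
  have -> : F' = fun w => -1 *: hoch *%R (fun a : A => a) g w + on_words f w.
    by apply: funext => w; rewrite scaleN1r addrC.
  by apply: hcochain_comb => //; apply: hcochain_hoch.
have rF' : Harr_rep (ungraded quotientP A^o) 0 n.+1 F'.
  case: hF' => Fs Fl Fh; split; first by split.
  move=> w; rewrite (opB (hoch_lin _ _ w)) dF hoch_hoch ?subrr //.
  exact: mulrA.
have [E [[[Es El En Eh _] dE] FE]] := Harr_rep_maximal hA hz hd rF'.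
exists (on_ffuns (n := n.+1) E); split.
  split; first exact: Harr_cochain_of_words.
  by move=> c; rewrite hochschild_diffE.
exists (on_ffuns (n := n) g); split; first exact: Harr_cochain_of_words.
move=> c; rewrite hochschild_diffE /on_ffuns -[max_ideal_incl _]/((fun w => max_ideal_incl (E w)) _).
by rewrite -FE /F' on_words_list opprB addrC subrK.
Qed.

End HarrisonMaximal.

Theorem mainTheorem8 (R : realType) (N d : nat) (hd : (3 <= d)%N)
    (P : comUnitRingType) (phi : {rmorphism polyalg R[i] 'I_N -> P})
    (A : comUnitAlgType P) (hA : local_ring A)
    (hCM : CM_minimal_multiplicity A N d)
    (z : 'I_d.-1 -> A) (hz : noether_normalisation phi z) (n : nat) :
  (* (1) *)
  [/\ forall S : simplicial_resolution A,
        T_map_surjective S (@max_ideal_incl A hA) n,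
      forall f : {ffun 'I_n.+1 -> A} -> A^o, Harr_cocycle f ->
        exists g : {ffun 'I_n.+1 -> A} -> max_ideal hA,
          Harr_cocycle g /\
          Harr_coboundary (fun a => f a - max_ideal_incl (g a))
    & (* (2) *)
      forall (B : comAlgType (polyalg R[i] 'I_N)) (grB : int -> B -> Prop)
        (zB : 'I_d.-1 -> B) (psi : {rmorphism B -> A})
        (hB : graded_model phi z grB zB psi)
        (S : simplicial_resolution B) (w : forall k, gens S k -> int)
        (hS : graded_resolution (@std_homog R[i] N) grB w),
        T_in_degrees_ge (@std_homog R[i] N) grB w n (- (n%:Z))].
Proof.
split=> [S|f hf|B grB zB psi hB S w hS]; last 1 first.
- have dz : (1 < d.-1)%N by lia.
  by case: hB => gB bB zB1 hbB *; apply: (T_degrees gB bB zB1 hbB dz hS).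
- exact: (cotangent_maximal hA hz hd).
exact: (harrison_maximal hA hz hd).
Qed.
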